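(* Let $H\in(0,1)$, $x_0\in\mathbb R$, $\theta\in\mathbb R$, and let $X=\{X_t,t\ge0\}$ be the fractional Ornstein--Uhlenbeck process with drift parameter $\theta$, initial value $x_0$ and Hurst parameter $H$. (i) If $\theta<0$, then the estimator $$\hat\theta_T^{(1)}=-\left(\frac{1}{H\Gamma(2H)T}\int_0^TX_t^2\,dt\right)^{-\frac{1}{2H}}$$ is strongly consistent as $T\to\infty$, i.e. $\hat\theta_T^{(1)}\to\theta$ almost surely. (ii) If $\theta>0$, then the estimator $$\hat\theta_T^{(2)}=\frac{X_T^2}{2\int_0^TX_t^2\,dt}$$ is strongly consistent as $T\to\infty$, i.e. $\hat\theta_T^{(2)}\to\theta$ almost surely.
   Context: Let $B^H=\{B^H_t,t\in\mathbb R\}$ be a fractional Brownian motion with Hurst parameter $H\in(0,1)$, i.e. a centered Gaussian process with $\mathbf E B^H_tB^H_s=\frac12(|t|^{2H}+|s|^{2H}-|t-s|^{2H})$, taken in its continuous modification. The fractional Ornstein--Uhlenbeck process $X$ is the unique solution of $X_t=x_0+\theta\int_0^tX_s\,ds+B^H_t$, $t\ge0$; equivalently $X_t=x_0e^{\theta t}+\theta e^{\theta t}\int_0^te^{-\theta s}B^H_s\,ds+B^H_t$. $\Gamma$ is the Gamma function. *)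

(* Defs.v *)
From mathcomp Require Import all_boot all_order all_algebra.
From mathcomp Require Import all_classical all_reals all_analysis.

Set Implicit Arguments.
Unset Strict Implicit.
Unset Printing Implicit Defensive.

Import Order.TTheory GRing.Theory Num.Theory.
Import numFieldNormedType.Exports.

Local Open Scope classical_set_scope.
Local Open Scope ring_scope.

Definition Gamma {R : realType} (x : R) : R :=
  \int[lebesgue_measure]_(t in `]0, +oo[) (t `^ (x - 1) * expR (- t)).

(* Constants count as Gaussian. They need their own clause, because the
   library's [normal_prob m 0] is the uniform law on [0, 1], not [\d_m]. *)
Definition gaussian_law {R : realType} (mu : set R -> \bar R) : Prop :=
  (exists m : R, forall A, measurable A -> mu A = \d_m A) \/
  (exists m s : R, 0 < s /\ forall A, measurable A -> mu A = normal_prob m s A).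

(* All finite-dimensional laws are (possibly degenerate) Gaussian vectors. *)
Definition gaussian_process {R : realType} (d : measure_display)
    (Omega : measurableType d) (P : probability Omega R)
    (B : R -> {RV P >-> R}) : Prop :=
  forall (n : nat) (t a : 'I_n -> R),
    gaussian_law (pushforward P (fun w : Omega => \sum_(i < n) a i * B (t i) w)).

Definition fractional_brownian_motion {R : realType} (d : measure_display)
    (Omega : measurableType d) (P : probability Omega R)
    (H : R) (B : R -> {RV P >-> R}) : Prop :=
  [/\ gaussian_process B,
      forall t, ('E_P[B t] = 0)%E,
      forall t s, ('E_P[B t \* B s])%E =
        (2^-1 * (`|t| `^ (2 * H) + `|s| `^ (2 * H) - `|t - s| `^ (2 * H)))%:E
    & \forall w \ae P, continuous (fun t => B t w)].

(* The solution is meant pathwise. Integrability is required explicitly, since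
   the real-valued integral is also defined (as a default) without it.
   The values of [X] at negative times are irrelevant. *)
Definition fractional_OU {R : realType} (d : measure_display)
    (Omega : measurableType d) (P : probability Omega R)
    (x0 theta : R) (B X : R -> {RV P >-> R}) : Prop :=
  \forall w \ae P, forall t : R, 0 <= t ->
    lebesgue_measure.-integrable `[0, t] (fun s => (X s w)%:E) /\
    X t w =
      x0 + theta * (\int[lebesgue_measure]_(s in `[0, t]) X s w) + B t w.

(* The estimators, as functionals of the observed path [x]. *)
Definition theta_hat1 {R : realType} (H : R) (x : R -> R) (T : R) : R :=
  - ((H * Gamma (2 * H) * T)^-1 *
     \int[lebesgue_measure]_(t in `[0, T]) (x t ^+ 2)) `^ (- (2 * H)^-1).

Definition theta_hat2 {R : realType} (x : R -> R) (T : R) : R :=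
  x T ^+ 2 / (2 * \int[lebesgue_measure]_(t in `[0, T]) (x t ^+ 2)).

Definition strongly_consistent {R : realType} (d : measure_display)
    (Omega : measurableType d) (P : probability Omega R)
    (est : R -> Omega -> R) (theta : R) : Prop :=
  \forall w \ae P, est T w @[T --> +oo] --> theta.

(* Main.v *)
(** If [theta < 0], put [lam = - theta] and let [v t] be the integral over [[0, t]]
    of [lam * expR (- lam * (t - s)) * X s ^+ 2]. In [X t ^+ 2 + v t] the drift
    cancels: up to a negligible term it is the integral of
    [lam * expR (- lam * (t - s)) * (B t - B s) ^+ 2] over [[0, t]]. Since
    [v' = lam * (X ^+ 2 - v)], the time averages of [X ^+ 2] are asymptotically half
    of those of this functional of the stationary increments of [B]. For a fixed
    lag the covariance of two squared increments decays polynomially in their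
    distance, so the variance of the time averages over [[0, N]] is O(N^-g).
    Borel-Cantelli along N = n^K and monotone interpolation give almost sure
    convergence to the mean, the integral of [lam * expR (- lam * u) * u `^ (2 * H)]
    over [u > 0], which is [2 * H * Gamma (2 * H) * lam `^ (- (2 * H))].

    If [theta > 0], [expR (- theta * T) * X T] converges to the random variable [xi]
    that is [x0] plus [theta] times the integral of [expR (- theta * s) * B s] over
    [s > 0], and the estimator converges to [theta] wherever [xi != 0]. This holds
    almost surely: [xi] is a limit of Gaussian Riemann sums with variances bounded
    below, so that [`|xi| <= e] has probability O(e). *)

Require Import Defs.
From mathcomp Require Import all_boot all_order all_algebra.
From mathcomp Require Import all_classical all_reals all_analysis.
From mathcomp Require Import measurable_realfun ring lra.
Import Order.TTheory GRing.Theory Num.Theory.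
Import numFieldNormedType.Exports.
Local Open Scope classical_set_scope.
Local Open Scope ring_scope.
Set Implicit Arguments.
Unset Strict Implicit.
Unset Printing Implicit Defensive.

(** * Primitives of continuous functions *)

(** [gaussian_process] speaks only of finite linear combinations of values of [B], so every
    probabilistic estimate has to be brought down to such combinations, while [X] is treated path by
    path. Cancelling the drift serves this purpose: apart from a decaying term only increments of
    [B] remain, with explicit covariances, and no covariance of [X] is ever computed. The remaining
    functional is an exponentially weighted mean over the lag, and its time average over [[0, N]] is
    a mean over shifts [r] in [[0, 1]] of sums over the grid [k + r]; Jensen's inequality and
    Tonelli's theorem then leave the mean square deviation of a finite sum of squared increments.
    The covariance of two such squares at distance [j] is of order [j ^ (4H - 4)], not summable for
    [H >= 3/4]. The exponent [g = min(1/2, 4 - 4H)] treats all [H] at once at the price of a slow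
    rate, whence the sparse times [n ^ K] with [K * g >= 2]. In both regimes the growth of [B]
    enters only through a bound [M * expR (kap * t)] with [kap] a fraction of [|theta|], which
    moments of high order provide. *)

Section primitive.
Context {R : realType}.
Implicit Types (f g F G : R -> R) (t T : R).
Notation mu := (@lebesgue_measure R).

(** For [t < 0] the interval is empty and the value is 0. Primitives are thus continuous on the
    whole line, but are differentiated at [t > 0] only. *)
Definition prim f t : R := \int[mu]_(s in `[0, t]) f s.

Lemma continuous_integrable f a b :
  continuous f -> mu.-integrable `[a, b] (EFin \o f).
Proof.
move=> cf; apply: continuous_compact_integrable; first exact: segment_compact.
exact: continuous_subspaceT.
Qed.

Lemma prim0 f : prim f 0 = 0.
Proof. by rewrite /prim set_itv1 Rintegral_set1. Qed.

Lemma prim_neg f t : t <= 0 -> prim f t = 0.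
Proof.
rewrite le_eqVlt => /predU1P[->|t0]; first exact: prim0.
by rewrite /prim set_itv_ge ?Rintegral_set0// bnd_simp -ltNge.
Qed.

Lemma is_derive_prim f t : continuous f -> 0 < t ->
  is_derive t 1 (prim f) (f t).
Proof.
move=> cf t0; have [||||d1 d2] := @continuous_FTC1_closed R f 0 t (t + 1).
- by rewrite ltrDl.
- exact: continuous_integrable.
- by [].
- exact: cf.
- by split; [exact: d1|rewrite -derive1E].
Qed.

(** Stated for a merely integrable [f]: the paths of [X] are not known in advance to be
    continuous. *)
Lemma continuous_prim_integrable (f : R -> R) :
  (forall t : R, 0 <= t -> mu.-integrable `[0, t] (EFin \o f)) ->
  continuous (prim f).
Proof.
move=> fi x; have [x0|x0|->] := ltgtP x 0.
- apply: (@near_cst_continuous _ _ 0); near=> y.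
  rewrite prim_neg//; apply/ltW; near: y; exact: lt_nbhsl.
- have x1 : 0 < x + 1 by rewrite addr_gt0.
  have := parameterized_integral_continuous (ltW x1) (fi _ (ltW x1)).
  move=> /(continuous_within_itvP _ x1)[+ _ _]; apply.
  by rewrite in_itv/= x0 ltrDl ltr01.
- rewrite /continuous_at prim0.
  apply: (@parameterized_integral_cvg_left R 0 1) => //; exact: fi.
Unshelve. all: by end_near. Qed.

Lemma continuous_prim f : continuous f -> continuous (prim f).
Proof.
by move=> cf; apply: continuous_prim_integrable => t _; exact: continuous_integrable.
Qed.

Lemma eq_of_derive F G T :
  continuous F -> continuous G -> F 0 = G 0 ->
  (forall t, 0 < t -> exists d, is_derive t 1 F d /\ is_derive t 1 G d) ->
  0 <= T -> F T = G T.
Proof.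
move=> cF cG FG0 dFG; rewrite le_eqVlt => /predU1P[<-//|T0].
have [||c _] := @MVT R (F \- G) (fun=> 0) 0 T T0.
- move=> x; rewrite in_itv/= => /andP[x0 _]; have [d [dF dG]] := dFG _ x0.
  by apply: is_derive_eq; rewrite subrr.
- by apply: continuous_subspaceT => x; apply: continuousB; [exact: cF|exact: cG].
- by rewrite mul0r /= FG0 subrr subr0 => /subr0_eq.
Qed.

End primitive.

Section primitive_algebra.
Context {R : realType}.
Implicit Types (f g F G : R -> R) (t T : R).
Notation mu := (@lebesgue_measure R).

Lemma prim_eq f g T : (forall t, 0 <= t <= T -> f t = g t) -> prim f T = prim g T.
Proof. by move=> fg; apply: eq_Rintegral => t; rewrite inE/= in_itv/= => /fg. Qed.

Lemma primD f g T : continuous f -> continuous g ->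
  prim (fun t => f t + g t) T = prim f T + prim g T.
Proof. by move=> cf cg; rewrite /prim RintegralD//; exact: continuous_integrable. Qed.

Lemma primB f g T : continuous f -> continuous g ->
  prim (fun t => f t - g t) T = prim f T - prim g T.
Proof. by move=> cf cg; rewrite /prim RintegralB//; exact: continuous_integrable. Qed.

Lemma primZ (c : R) f T : continuous f ->
  prim (fun t => c * f t) T = c * prim f T.
Proof. by move=> cf; rewrite /prim RintegralZl//; exact: continuous_integrable. Qed.

Lemma prim_cst (c : R) T : 0 <= T -> prim (fun=> c) T = c * T.
Proof.
move=> T0; rewrite /prim Rintegral_cst//= lebesgue_measure_itv/= lte_fin.
by case: ltgtP T0 => //= [_|<-] _; rewrite ?mulr0// oppr0 addr0.
Qed.

Lemma le_prim f g T : continuous f -> continuous g ->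
  (forall t, 0 <= t <= T -> f t <= g t) -> prim f T <= prim g T.
Proof.
move=> cf cg fg; by apply: le_Rintegral => //; exact: continuous_integrable.
Qed.

Lemma prim_ge0 f T : (forall t, 0 <= t -> 0 <= f t) -> 0 <= prim f T.
Proof.
by move=> f0; apply: Rintegral_ge0 => t /=; rewrite in_itv/= => /andP[/f0].
Qed.

Lemma nondecreasing_prim f S T : continuous f -> (forall t, 0 <= t -> 0 <= f t) ->
  S <= T -> prim f S <= prim f T.
Proof.
move=> cf f0 ST; rewrite /prim /Rintegral fine_le//.
- exact: (integrable_fin_num _ (continuous_integrable _ _ cf)).
- exact: (integrable_fin_num _ (continuous_integrable _ _ cf)).
- apply: ge0_subset_integral => //=.
  + by have /integrableP[] := continuous_integrable 0 T cf.
  + by move=> t; rewrite in_itv/= lee_fin => /andP[/f0].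
  + by apply: subset_itvl; rewrite bnd_simp.
Qed.

(** A form of the fundamental theorem suited to primitives from 0: [F] is continuous everywhere but
    differentiable only at [t > 0]. *)
Lemma prim_of_derive f F T : continuous f -> continuous F ->
  (forall t, 0 < t -> is_derive t 1 F (f t)) -> 0 <= T ->
  prim f T = F T - F 0.
Proof.
move=> cf cF dF T0.
apply: (@eq_of_derive _ (prim f) (fun t => F t - F 0) T) => //.
- exact: continuous_prim.
- by move=> x; apply: continuousB; [exact: cF|exact: cst_continuous].
- by rewrite prim0 subrr.
- move=> t t0; exists (f t); split; first exact: is_derive_prim.
  have ? := dF _ t0.
  by apply: is_derive_eq; rewrite subr0.
Qed.

Lemma prim_shift f a T : continuous f -> 0 <= a -> 0 <= T ->
  prim (fun t => f (a + t)) T = prim f (a + T) - prim f a.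
Proof.
move=> cf a0 T0.
have ca : continuous (fun t : R => a + t).
  by move=> x; apply: continuousD; [exact: cst_continuous|exact: id].
have cfa : continuous (fun t => f (a + t)).
  by move=> x; exact: (continuous_comp (ca x) (cf _)).
have cPa : continuous (fun t => prim f (a + t)).
  by move=> x; apply: (continuous_comp (ca x)); exact: continuous_prim.
rewrite (prim_of_derive cfa cPa _ T0) ?addr0// => t t0.
have d1 := is_derive_prim cf (ltr_wpDl a0 t0).
have d2 : is_derive t 1 (fun t : R => a + t) 1.
  by apply: is_derive_eq; ring.
have := @is_derive1_comp R (prim f) (fun t => a + t) t _ _ d1 d2.
by rewrite mulr1.
Qed.

Lemma prim_rev f T : continuous f -> 0 <= T ->
  prim (fun t => f (T - t)) T = prim f T.
Proof.
move=> cf; rewrite le_eqVlt => /predU1P[<-|T0]; first by rewrite !prim0.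
have cT : continuous (fun t : R => T - t).
  by move=> x; apply: continuousB; [exact: cst_continuous|exact: id].
have cfT : continuous (fun t => f (T - t)).
  by move=> x; exact: (continuous_comp (cT x) (cf _)).
pose F t := - prim f (T - t).
have cF : continuous F.
  move=> x; apply: cvgN; apply: (continuous_comp (cT x)).
  exact: continuous_prim.
have := @continuous_FTC2 R (fun t => f (T - t)) F 0 T T0
  (continuous_subspaceT cfT).
rewrite /prim /Rintegral => ->.
- by rewrite /= /F subr0 subrr prim0 oppr0 sub0r opprK.
- split.
  + move=> x; rewrite in_itv/= => /andP[x0 xT].
    have d1 : is_derive (T - x) 1 (prim f) (f (T - x)) by apply: is_derive_prim; rewrite ?subr_gt0.
    apply: derivableN.
    apply/derivable1_diffP; apply: (@differentiable_comp _ _ _ _ (fun t => T - t) (prim f)); last first.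
      exact/derivable1_diffP.
    exact/derivable1_diffP.
  + by apply: cvg_at_right_filter; exact: cF.
  + by apply: cvg_at_left_filter; exact: cF.
- move=> x; rewrite in_itv/= => /andP[x0 xT].
  have d1 : is_derive (T - x) 1 (prim f) (f (T - x)) by apply: is_derive_prim; rewrite ?subr_gt0.
  have d2 : is_derive x 1 (fun t : R => T - t) (-1).
    by apply: is_derive_eq; ring.
  have d3 := @is_derive1_comp R (prim f) (fun t => T - t) x _ _ d1 d2.
  rewrite derive1E /F.
  have d4 : is_derive x 1 (fun t => - prim f (T - t)) (- (f (T - x) * -1)).
    exact: is_deriveN.
  by rewrite derive_val mulrN1 opprK.
Qed.

End primitive_algebra.

Section continuity.
Context {R : realType}.
Implicit Types f g : R -> R.

Lemma ctnD f g : continuous f -> continuous g -> continuous (fun t => f t + g t).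
Proof. by move=> cf cg x; apply: cvgD; [exact: cf|exact: cg]. Qed.

Lemma ctnN f : continuous f -> continuous (fun t => - f t).
Proof. by move=> cf x; apply: cvgN; exact: cf. Qed.

Lemma ctnM f g : continuous f -> continuous g -> continuous (fun t => f t * g t).
Proof. by move=> cf cg x; apply: cvgM; [exact: cf|exact: cg]. Qed.

Lemma ctnX f n : continuous f -> continuous (fun t => f t ^+ n).
Proof.
move=> cf x; apply: (continuous_comp (g := fun y : R => y ^+ n) (cf x)).
exact: exprn_continuous.
Qed.

Lemma ctnexpR f : continuous f -> continuous (fun t => expR (f t)).
Proof.
move=> cf x; apply: (continuous_comp (g := @expR R) (cf x)).
exact: continuous_expR.
Qed.

Lemma ctncst (c : R) : continuous (fun _ : R => c).
Proof. exact: cst_continuous. Qed.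

Lemma ctnid : continuous (fun t : R => t).
Proof. by move=> x; exact: cvg_id. Qed.

Lemma ctnMl (c : R) : continuous ( *%R c).
Proof. exact: mulrl_continuous. Qed.

Lemma ctnDl (c : R) : continuous (+%R c).
Proof. exact: (@ctnD (fun=> c) _ (@ctncst c) ctnid). Qed.

Lemma ctnNid : continuous (-%R : R -> R).
Proof. exact: (@ctnN _ ctnid). Qed.

Lemma ctnprim f : continuous f -> continuous (fun t => prim f t).
Proof. exact: continuous_prim. Qed.

End continuity.

Ltac ctn := repeat match goal with
  | H : continuous ?f |- continuous ?f => exact: H
  | H : continuous ?f |- continuous (fun x => ?f x) => exact: H
  | |- continuous (fun _ => expR _) => apply: ctnexpR
  | |- continuous (fun _ => prim ?f _) => apply: (@ctnprim _ f)
  | |- continuous (prim ?f) => apply: (@ctnprim _ f)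
  | |- continuous (fun _ => - _) => apply: ctnN
  | |- continuous (fun _ => _ + _) => apply: ctnD
  | |- continuous (fun _ => _ * _) => apply: ctnM
  | |- continuous (fun _ => _ ^+ _) => apply: ctnX
  | |- continuous ( *%R _) => exact: ctnMl
  | |- continuous -%R => exact: ctnNid
  | |- continuous (+%R _) => exact: ctnDl
  | |- continuous (fun t => t) => exact: ctnid
  | |- continuous (fun _ => ?c) => exact: ctncst
  end.
Ltac drv := apply: is_derive_eq; rewrite /GRing.scale /=; ring.

(** * The stable Langevin equation along a path *)

Section langevin_path.
Context {R : realType}.
Variables (lam x0 : R) (b x : R -> R).
Hypotheses (lam0 : 0 < lam) (cb : continuous b) (cx : continuous x).
Implicit Types t T s : R.
Hypothesis xE : forall t, 0 <= t -> x t = x0 - lam * prim x t + b t.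

(** By [e_m] and [e_v], [m t] and [v t + m t ^+ 2] are the mean and the second moment of [b] under
    the weights [lam * expR (- (lam * (t - s)))] on [[0, t]], completed by a mass
    [expR (- (lam * t))] at the value [- x0]. As [x = b - m], the decomposition below is the
    bias-variance identity for the mean square distance to [b t]. *)
Let m t := lam * prim x t - x0.
Let E1 := prim (fun s => expR (lam * s) * b s).
Let E2 := prim (fun s => expR (lam * s) * b s ^+ 2).
Definition memory_energy t :=
  lam * expR (- (lam * t)) * prim (fun s => expR (lam * s) * x s ^+ 2) t.
Definition memory_increment t :=
  prim (fun s => lam * expR (- (lam * (t - s))) * (b t - b s) ^+ 2) t.
Notation v := memory_energy.
Notation W1 := memory_increment.

Let mE t : 0 <= t -> b t = x t + m t.
Proof. by move=> t0; rewrite /m xE//; ring. Qed.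

Let cm : continuous m. Proof. by rewrite /m; ctn. Qed.

Let dm t : 0 < t -> is_derive t 1 m (lam * x t).
Proof. by move=> t0; have ? := is_derive_prim cx t0; rewrite /m; drv. Qed.

Let e_m t : 0 <= t -> expR (lam * t) * m t = lam * E1 t - x0.
Proof.
move=> t0; rewrite /E1 -primZ; last by ctn.
pose F t := expR (lam * t) * m t.
rewrite (_ : prim _ t = F t - F 0).
  by rewrite /F mulr0 expR0 /m prim0; ring.
refine (@prim_of_derive _ _ F _ _ _ _ _); [by ctn|by rewrite /F; ctn| |by []].
move=> s s0; have ? := dm s0.
by rewrite /F (mE (ltW s0)); drv.
Qed.

(** The derivative of [expR (lam * t) * m t ^+ 2] is [lam * expR (lam * t) * (b t ^+ 2 - x t ^+ 2)],
    because [b = x + m]. *)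
Let e_v t : 0 <= t ->
  expR (lam * t) * v t = lam * E2 t - expR (lam * t) * m t ^+ 2 + x0 ^+ 2.
Proof.
move=> t0; have -> : expR (lam * t) * v t =
    lam * prim (fun s => expR (lam * s) * x s ^+ 2) t.
  by rewrite /v expRN; field; rewrite expR_eq0.
suff : lam * E2 t - lam * prim (fun s => expR (lam * s) * x s ^+ 2) t =
    expR (lam * t) * m t ^+ 2 - x0 ^+ 2 by move=> h; lra.
rewrite /E2 -!primZ -?primB; try by ctn.
pose F t := expR (lam * t) * m t ^+ 2.
rewrite (_ : prim _ t = F t - F 0).
  by rewrite /F mulr0 expR0 /m prim0; ring.
refine (@prim_of_derive _ _ F _ _ _ _ _); [by ctn|by rewrite /F; ctn| |by []].
move=> s s0; have ? := dm s0.
by rewrite /F (mE (ltW s0)); drv.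
Qed.

Let W1E t : 0 <= t -> expR (lam * t) * W1 t =
  b t ^+ 2 * (expR (lam * t) - 1) - 2 * b t * lam * E1 t + lam * E2 t.
Proof.
move=> t0; rewrite /W1 -primZ; last by ctn.
have -> : expR (lam * t) - 1 = prim (fun s => lam * expR (lam * s)) t.
  rewrite (_ : prim _ t = expR (lam * t) - expR (lam * 0)).
    by rewrite mulr0 expR0.
  refine (@prim_of_derive _ _ (fun t => expR (lam * t)) _ _ _ _ _); [by ctn|by ctn| |by []].
  by move=> s s0; drv.
rewrite /E1 /E2 -!primZ -?primB -?primD; try by ctn.
apply: prim_eq => s _.
have -> : - (lam * (t - s)) = lam * s - lam * t by ring.
by rewrite expRD expRN; field; rewrite expR_eq0.
Qed.

(* The drift cancels: the right-hand side depends on the noise only, and its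
   second term is negligible. *)
Lemma energy_decomposition t : 0 <= t ->
  x t ^+ 2 + v t = W1 t + expR (- (lam * t)) * (b t + x0) ^+ 2.
Proof.
move=> t0; have h1 := e_m t0; have h2 := e_v t0; have h3 := W1E t0.
have e0 : expR (lam * t) != 0 by rewrite expR_eq0.
have xb : x t = b t - m t by rewrite mE//; ring.
have LE1 : lam * E1 t = expR (lam * t) * m t + x0 by rewrite h1; ring.
apply: (mulfI e0); rewrite mulrDr h2 xb mulrDr h3.
rewrite expRN mulVKf//.
have -> : 2 * b t * lam * E1 t = 2 * b t * (lam * E1 t) by ring.
by rewrite LE1; ring.
Qed.

Lemma continuous_memory_energy : continuous v.
Proof. by rewrite /v; ctn. Qed.

Lemma memory_energy_eq T : 0 <= T -> v T = lam * prim (fun t => x t ^+ 2 - v t) T.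
Proof.
have cv := continuous_memory_energy.
move=> T0; rewrite -primZ; last by ctn.
rewrite (_ : prim _ T = v T - v 0).
  by rewrite {3}/v prim0; ring.
refine (@prim_of_derive _ _ v _ _ _ _ _); [by ctn|by ctn| |by []].
move=> s s0; rewrite /v.
have ? : is_derive s 1 (prim (fun s => expR (lam * s) * x s ^+ 2))
    (expR (lam * s) * x s ^+ 2) by apply: is_derive_prim => //; ctn.
apply: is_derive_eq; rewrite /GRing.scale /= expRN.
by field; rewrite expR_eq0.
Qed.

Lemma memory_energy_ge0 t : 0 <= v t.
Proof.
rewrite /v !mulr_ge0 ?(ltW lam0) ?expR_ge0//; apply: prim_ge0 => s _.
by rewrite mulr_ge0 ?expR_ge0 ?sqr_ge0.
Qed.

Definition total_energy t := x t ^+ 2 + v t.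
Notation W := total_energy.

Lemma continuous_total_energy : continuous W.
Proof. by have cv := continuous_memory_energy; rewrite /W; ctn. Qed.

Lemma total_energy_ge0 t : 0 <= W t.
Proof. by rewrite addr_ge0 ?sqr_ge0 ?memory_energy_ge0. Qed.

(** By [memory_energy_eq] the integrals of [x ^+ 2] and of [v] differ by [v T / lam], so each is
    half of their sum up to this term. *)
Lemma prim_sqr_path T : 0 <= T ->
  prim (fun t => x t ^+ 2) T = 2^-1 * (prim W T + v T / lam).
Proof.
have cv := continuous_memory_energy.
move=> T0; have := memory_energy_eq T0; rewrite primB; [|by ctn..] => ->.
by rewrite /W primD; [field; rewrite gt_eqF|ctn..].
Qed.

(** For [s] in [[T - 1, T]], [v T] exceeds [v s] by at most [lam] times the integral of [W] over the
    window, and [v s <= W s]; averaging over [s] concludes. Convergence of the averages of [W]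
    thereby forces [v T / T] to 0, without any prior bound on [v]. *)
Lemma memory_energy_le T : 1 <= T ->
  v T <= (lam + 1) * (prim W T - prim W (T - 1)).
Proof.
have cv := continuous_memory_energy; have cW := continuous_total_energy.
move=> T1; have T10 : 0 <= T - 1 by rewrite subr_ge0.
have T0 : 0 <= T by lra.
set D := prim W T - prim W (T - 1).
have TE : T = T - 1 + 1 by ring.
have -> : (lam + 1) * D = lam * D + prim (fun r => W (T - 1 + r)) 1.
  by rewrite prim_shift// -TE -/D; ring.
have -> : v T = lam * D + prim (fun=> v T - lam * D) 1.
  by rewrite prim_cst//; ring.
rewrite lerD2l; apply: le_prim; try by ctn.
  by move=> y; apply: (continuous_comp (f := fun t => T - 1 + t)); [apply: ctnD; ctn|exact: cW].
move=> r /andP[r0 r1]; set s := T - 1 + r.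
have s0 : 0 <= s by rewrite addr_ge0.
apply: (@le_trans _ _ (v s)); last by rewrite /W lerDr sqr_ge0.
have vW : forall t, x t ^+ 2 - v t = W t - 2 * v t by move=> t; rewrite /W; ring.
rewrite (memory_energy_eq T0) (memory_energy_eq s0).
suff h : prim (fun t => x t ^+ 2 - v t) T - prim (fun t => x t ^+ 2 - v t) s <= D.
  rewrite -subr_ge0.
  have -> : forall p q : R, lam * q - (lam * p - lam * D) = lam * (D - (p - q)).
    by move=> p q; ring.
  by rewrite mulr_ge0 ?(ltW lam0)// subr_ge0.
have -> : D = (prim W T - prim W s) + (prim W s - prim W (T - 1)) by rewrite /D; ring.
have h1 : prim W (T - 1) <= prim W s.
  by apply: nondecreasing_prim => // [t _|]; [exact: total_energy_ge0|rewrite lerDl].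
have h2 : prim v s <= prim v T.
  apply: nondecreasing_prim => // [t _|]; first exact: memory_energy_ge0.
  by rewrite /s; lra.
have h3 t : prim (fun t => x t ^+ 2 - v t) t = prim W t - 2 * prim v t.
  by rewrite -primZ// -primB; [apply: prim_eq => y _; exact: vW|ctn..].
by rewrite !h3; lra.
Qed.

End langevin_path.

(** * Interpolation of monotone functions between polynomial times *)

Section interpolation.
Context {R : realType}.
Implicit Types (F : R -> R) (T c : R) (K : nat).

Lemma cvg_ratio_succ K : ((n%:R / n.+1%:R) ^+ K : R) @[n --> \oo] --> (1 : R).
Proof.
have h : (n%:R / n.+1%:R : R) @[n --> \oo] --> (1 : R).
  have -> : (fun n => n%:R / n.+1%:R : R) = (fun n => 1 - harmonic n).
    by apply/funext => n; rewrite /harmonic /= -[n.+1]addn1 natrD; field.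
  rewrite -[X in _ --> X]subr0; apply: cvgB => //; [exact: cvg_cst|exact: (@cvg_harmonic R)].
rewrite -[X in _ --> X](expr1n R K).
by apply: (@continuous_cvg _ _ _ _ _ _ (fun y : R => y ^+ K)) => //; exact: exprn_continuous.
Qed.

(** For [n ^ K <= T <= (n + 1) ^ K] monotonicity encloses [F T / T] between the two neighbouring
    ratios, up to factors [(n / (n + 1)) ^ K] that tend to 1. *)
Lemma cvg_interpolation F K c : (0 < K)%N ->
  (forall S T, 0 <= S -> S <= T -> F S <= F T) -> 0 <= F 0 ->
  F (n%:R ^+ K) / n%:R ^+ K @[n --> \oo] --> c ->
  F T / T @[T --> +oo] --> c.
Proof.
move=> K0 ndF F0 Fc.
have F_ge0 T : 0 <= T -> 0 <= F T by move=> T0; apply: le_trans F0 (ndF _ _ _ T0).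
pose N (T : R) := Num.truncn (T `^ K%:R^-1).
have NT T : 0 <= T -> (N T)%:R ^+ K <= T <= (N T).+1%:R ^+ K.
  move=> T0; have /andP[h1 h2] := truncn_itv (powR_ge0 T K%:R^-1).
  have TE : T = (T `^ K%:R^-1) ^+ K.
    by rewrite -powR_mulrn ?powR_ge0// -powRrM mulVf ?powRr1// pnatr_eq0 -lt0n.
  by rewrite {2 3}TE !lerXn2r ?nnegrE ?powR_ge0 ?ler0n// ltW.
have Noo : N T @[T --> +oo] --> \oo.
  apply/cvgnyPge => A; near=> T.
  have T0 : 0 <= T by near: T; apply: nbhs_pinfty_ge; rewrite num_real.
  rewrite /N truncn_ge_nat ?powR_ge0//.
  have -> : (A%:R : R) = (A%:R ^+ K) `^ K%:R^-1.
    rewrite -powR_mulrn// -powRrM divff ?powRr1// pnatr_eq0 -lt0n//.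
  have AT : A%:R ^+ K <= T by near: T; apply: nbhs_pinfty_ge; rewrite num_real.
  by apply: ge0_ler_powR; rewrite ?invr_ge0 ?nnegrE ?exprn_ge0//.
pose lo n : R := F (n%:R ^+ K) / n%:R ^+ K * (n%:R / n.+1%:R) ^+ K.
pose hi n : R := F (n.+1%:R ^+ K) / n.+1%:R ^+ K / (n%:R / n.+1%:R) ^+ K.
have clo : lo n @[n --> \oo] --> c.
  by rewrite -[c]mulr1; apply: cvgM => //; exact: cvg_ratio_succ.
have chi : hi n @[n --> \oo] --> c.
  rewrite -[c]mulr1; apply: cvgM.
    by have := Fc; rewrite -(cvg_shiftS (fun n : nat => F (n%:R ^+ K) / n%:R ^+ K)).
  by rewrite -[X in _ --> X]invr1; apply: cvgV; rewrite ?oner_neq0//; exact: cvg_ratio_succ.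
apply: (@squeeze_cvgr _ _ _ _ (lo \o N) (hi \o N)); first last.
- exact: cvg_comp Noo chi.
- exact: cvg_comp Noo clo.
near=> T.
have T1 : 1 <= T by near: T; apply: nbhs_pinfty_ge; rewrite num_real.
have T0 : 0 < T by apply: lt_le_trans T1.
have /andP[h1 h2] := NT _ (ltW T0).
have N1 : (0 < N T)%N.
  rewrite /N truncn_ge_nat ?powR_ge0//.
  have -> : 1%:R = 1 `^ K%:R^-1 :> R by rewrite powR1.
  by rewrite ge0_ler_powR ?invr_ge0 ?nnegrE// ltW.
have p1 : 0 < (N T)%:R ^+ K :> R by rewrite exprn_gt0// ltr0n.
have p2 : 0 < (N T).+1%:R ^+ K :> R by rewrite exprn_gt0.
rewrite /lo /hi /= !expr_div_n; apply/andP; split.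
  apply: (@le_trans _ _ (F ((N T)%:R ^+ K) / (N T).+1%:R ^+ K)).
    by rewrite le_eqVlt; apply/orP; left; apply/eqP; field; rewrite !gt_eqF.
  apply: ler_pM; rewrite ?invr_ge0 ?F_ge0 ?(ltW p1) ?(ltW p2)//.
    by apply: ndF => //; exact: ltW.
  by rewrite lef_pV2.
apply: (@le_trans _ _ (F ((N T).+1%:R ^+ K) / (N T)%:R ^+ K)).
  apply: ler_pM; rewrite ?invr_ge0 ?F_ge0 ?(ltW T0)//.
    by apply: ndF => //; exact: ltW.
  by rewrite lef_pV2.
by rewrite le_eqVlt; apply/orP; left; apply/eqP; field; rewrite !gt_eqF.
Unshelve. all: by end_near. Qed.

End interpolation.

(** * Limit of the time averages of the squared path *)

Section langevin_limit.
Context {R : realType}.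
Implicit Types (t T : R) (K : nat).

Lemma bounded_ratio_cvg0 (g : R -> R) (C : R) :
  (forall T, 0 <= T -> `|g T| <= C) -> g T / T @[T --> +oo] --> (0 : R).
Proof.
move=> gC; apply/cvgr0Pnorm_le => e e0; near=> T.
have T1 : 1 <= T by near: T; apply: nbhs_pinfty_ge; rewrite num_real.
have T0 : 0 < T by apply: lt_le_trans T1.
have TC : C / e <= T by near: T; apply: nbhs_pinfty_ge; rewrite num_real.
rewrite normrM normfV (gtr0_norm T0) ler_pdivrMr//.
by rewrite (le_trans (gC _ (ltW T0)))// -ler_pdivrMl// mulrC.
Unshelve. all: by end_near. Qed.

Lemma cvg_ratio_pred : (T - 1) / T @[T --> +oo] --> (1 : R).
Proof.
have h : (1 : R) - 1 / T @[T --> +oo] --> (1 : R).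
  rewrite -[X in _ --> X]subr0; apply: cvgB; first exact: cvg_cst.
  by apply: (@bounded_ratio_cvg0 (fun=> 1) 1) => T _; rewrite normr1.
apply: cvg_trans h; apply: near_eq_cvg; near=> T.
have T1 : 1 <= T by near: T; apply: nbhs_pinfty_ge; rewrite num_real.
by field; rewrite gt_eqF// (lt_le_trans _ T1).
Unshelve. all: by end_near. Qed.

Lemma langevin_energy_limit (lam x0 c M : R) (b x : R -> R) K :
  0 < lam -> continuous b -> continuous x ->
  (forall t : R, 0 <= t -> x t = x0 - lam * prim x t + b t) ->
  (forall t : R, 0 <= t -> `|b t| <= M * expR (lam / 4 * t)) -> (0 < K)%N ->
  prim (memory_increment lam b) (n%:R ^+ K) / n%:R ^+ K @[n --> \oo] --> c ->
  prim (fun t => x t ^+ 2) T / T @[T --> +oo] --> c / 2.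
Proof.
move=> lam0 cb cx xE bM K0 limW1.
pose W := total_energy lam x.
have cW : continuous W by exact: continuous_total_energy.
pose eps t := expR (- (lam * t)) * (b t + x0) ^+ 2.
have ceps : continuous eps by rewrite /eps; ctn.
(* [g] is visibly continuous and agrees with [memory_increment lam b] at nonnegative times. *)
pose g t := W t - eps t.
have cg : continuous g by rewrite /g; ctn.
have gE t : 0 <= t -> g t = memory_increment lam b t.
  by move=> t0; rewrite /g /W /total_energy (energy_decomposition cb cx xE t0) addrK.
have g_ge0 t : 0 <= t -> 0 <= g t.
  move=> t0; rewrite gE//; apply: prim_ge0 => s _.
  by rewrite mulr_ge0 ?sqr_ge0// mulr_ge0 ?expR_ge0// ltW.
have primg T : prim (memory_increment lam b) T = prim g T.
  by apply: prim_eq => t /andP[t0 _]; rewrite gE.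
have limg : prim g T / T @[T --> +oo] --> c.
  apply: (cvg_interpolation K0).
  - by move=> S T S0 ST; exact: nondecreasing_prim.
  - by rewrite prim0.
  - by under eq_fun do rewrite -primg.
pose M' := M + `|x0|.
have M0 : 0 <= M.
  by have := bM 0 (lexx _); rewrite mulr0 expR0 mulr1; exact: le_trans.
(* The growth rate [lam / 4] doubles under the square, so half of the decay [expR (- (lam * t))]
   survives and [eps] has a bounded primitive. *)
have eps_le t : 0 <= t -> eps t <= M' ^+ 2 * expR (- (lam / 2 * t)).
  move=> t0; have h : `|b t + x0| <= M' * expR (lam / 4 * t).
    rewrite (le_trans (ler_normD _ _))// mulrDl lerD ?bM// ler_peMr//.
    by rewrite -expR0 ler_expR mulr_ge0// divr_ge0// ltW.
  rewrite /eps -real_normK ?num_real//.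
  apply: (@le_trans _ _ (expR (- (lam * t)) * (M' * expR (lam / 4 * t)) ^+ 2)).
    by rewrite ler_wpM2l ?expR_ge0// lerXn2r ?nnegrE// mulr_ge0 ?expR_ge0// addr_ge0.
  rewrite exprMn mulrCA ler_wpM2l ?sqr_ge0// -expRM_natl -expRD ler_expR.
  by rewrite le_eqVlt; apply/orP; left; apply/eqP; field.
have prim_eps T : 0 <= T -> `|prim eps T| <= M' ^+ 2 * (2 / lam).
  move=> T0; rewrite ger0_norm; last first.
    by apply: prim_ge0 => t _; rewrite mulr_ge0 ?expR_ge0 ?sqr_ge0.
  apply: (@le_trans _ _ (prim (fun t => M' ^+ 2 * expR (- (lam / 2 * t))) T)).
    by apply: le_prim => //; [ctn|move=> t /andP[t0 _]; exact: eps_le].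
  rewrite primZ; last by ctn.
  rewrite ler_wpM2l ?sqr_ge0//.
  have -> : prim (fun t => expR (- (lam / 2 * t))) T =
      - (2 / lam) * expR (- (lam / 2 * T)) - - (2 / lam) * expR (- (lam / 2 * 0)).
    refine (@prim_of_derive _ _ (fun t => - (2 / lam) * expR (- (lam / 2 * t)))
      _ _ _ _ _); [by ctn|by ctn| |by []].
    move=> t t0; apply: is_derive_eq; rewrite /GRing.scale /=.
    by field; rewrite gt_eqF.
  have : 0 <= 2 / lam * expR (- (lam / 2 * T)).
    by rewrite mulr_ge0 ?expR_ge0// divr_ge0// ltW.
  by rewrite mulr0 oppr0 expR0 mulr1 opprK mulNr; lra.
have limW : prim W T / T @[T --> +oo] --> c.
  rewrite -[c]addr0.
  have -> : (fun T => prim W T / T) = (fun T => prim g T / T + prim eps T / T).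
    apply/funext => T; rewrite -mulrDl -primD//; congr (_ / _).
    by apply: prim_eq => t _; rewrite /g subrK.
  by apply: cvgD => //; exact: bounded_ratio_cvg0 prim_eps.
(* The averages of [W] over [[0, T]] and over [[0, T - 1]] have the same limit, so the last unit
   window is negligible. *)
have limv : memory_energy lam x T / T @[T --> +oo] --> (0 : R).
  have limD : (lam + 1) * (prim W T / T - prim W (T - 1) / T) @[T --> +oo] --> (0 : R).
    have -> : (0 : R) = (lam + 1) * (c - c * 1) by rewrite mulr1 subrr mulr0.
    apply: cvgM; first exact: cvg_cst.
    apply: cvgB => //.
    have h : prim W (T - 1) / (T - 1) * ((T - 1) / T) @[T --> +oo] --> c * 1.
      apply: cvgM; last exact: cvg_ratio_pred.
      by apply: (cvg_comp _ _ _ limW); exact: cvg_addrr.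
    apply: cvg_trans h; apply: near_eq_cvg; near=> T.
    have T1 : 2 <= T by near: T; apply: nbhs_pinfty_ge; rewrite num_real.
    by field; apply/andP; split; rewrite gt_eqF//; lra.
  apply: (@squeeze_cvgr _ _ _ _ (fun=> 0) _ _ _ _ (cvg_cst _) limD).
  near=> T.
  have T1 : 1 <= T by near: T; apply: nbhs_pinfty_ge; rewrite num_real.
  have T0 : 0 < T by apply: lt_le_trans T1.
  rewrite divr_ge0 ?memory_energy_ge0 ?(ltW T0)//=.
  by rewrite -mulrBl mulrA ler_pM2r ?invr_gt0// (memory_energy_le lam0 cx).
have h : 2^-1 * (prim W T / T + memory_energy lam x T / T / lam) @[T --> +oo] --> c / 2.
  have -> : c / 2 = 2^-1 * (c + 0 / lam) by rewrite mul0r addr0 mulrC.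
  apply: cvgM; first exact: cvg_cst.
  by apply: cvgD => //; apply: cvgM => //; exact: cvg_cst.
apply: cvg_trans h; apply: near_eq_cvg; near=> T.
have T1 : 1 <= T by near: T; apply: nbhs_pinfty_ge; rewrite num_real.
rewrite (prim_sqr_path lam0 cx) ?(le_trans _ T1)// -/W.
by field; rewrite !gt_eqF// (lt_le_trans _ T1).
Unshelve. all: by end_near. Qed.

End langevin_limit.

(** * The explosive Langevin equation along a path *)

Section explosive_path.
Context {R : realType}.
Variables (th x0 M : R) (b x : R -> R).
Hypotheses (th0 : 0 < th) (cb : continuous b) (cx : continuous x).
Implicit Types t T s : R.
Hypothesis xE : forall t, 0 <= t -> x t = x0 + th * prim x t + b t.
Hypothesis bM : forall t, 0 <= t -> `|b t| <= M * expR (th / 2 * t).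

Lemma norm_prim_le (f g : R -> R) T : continuous f -> continuous g ->
  (forall t, 0 <= t <= T -> `|f t| <= g t) -> `|prim f T| <= prim g T.
Proof.
move=> cf cg fg; rewrite ler_norml; apply/andP; split.
  rewrite -[X in X <= _]mulN1r -primZ//; apply: le_prim => //; first by ctn.
  by move=> t /fg; rewrite mulN1r ler_norml => /andP[].
by apply: le_prim => // t /fg; rewrite ler_norml => /andP[].
Qed.

Lemma expRN_cvg0 (k : R) : 0 < k -> expR (- (k * T)) @[T --> +oo] --> (0 : R).
Proof.
move=> k0; apply: (@cvg_comp _ _ _ (fun T => k * T) (fun y => expR (- y)) _ (pinfty_nbhs R)).
  exact: gt0_cvgMry.
exact: cvgr_expR.
Qed.

Lemma prim_expR (k : R) T : k != 0 -> 0 <= T ->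
  prim (fun t => expR (k * t)) T = (expR (k * T) - 1) / k.
Proof.
move=> k0 T0.
have -> : prim (fun t => expR (k * t)) T =
    k^-1 * expR (k * T) - k^-1 * expR (k * 0).
  refine (@prim_of_derive _ _ (fun t => k^-1 * expR (k * t)) _ _ _ _ _); [by ctn|by ctn| |by []].
  by move=> t t0; apply: is_derive_eq; rewrite /GRing.scale /=; field.
by rewrite mulr0 expR0; field.
Qed.

Definition discounted_noise T := x0 + th * prim (fun s => expR (- (th * s)) * b s) T.
Notation eta := discounted_noise.
Let M0 : 0 <= M.
Proof. by have := bM (lexx 0); rewrite mulr0 expR0 mulr1; exact: le_trans. Qed.

Let bound s : 0 <= s ->
  `|expR (- (th * s)) * b s| <= M * expR (- (th / 2) * s).
Proof.
move=> s0; rewrite normrM ger0_norm ?expR_ge0//.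
apply: (le_trans (ler_wpM2l (expR_ge0 _) (bM s0))).
rewrite mulrCA ler_wpM2l// -expRD ler_expR.
by rewrite le_eqVlt; apply/orP; left; apply/eqP; field.
Qed.

Let prim_bound T : 0 <= T -> prim (fun s => M * expR (- (th / 2) * s)) T <= M * (2 / th).
Proof.
move=> T0; rewrite primZ; last by ctn.
rewrite prim_expR ?oppr_eq0 ?mulf_neq0 ?invr_neq0 ?gt_eqF// ler_wpM2l//.
have := expR_ge0 (- (th / 2) * T); set e := expR _ => e0.
have -> : (e - 1) / - (th / 2) = 2 / th - e * (2 / th).
  by field; rewrite gt_eqF.
by rewrite gerBl mulr_ge0// divr_ge0// ltW.
Qed.

(** Absolute convergence: with [|f| <= g], the primitives of [f + g] and of [g] are monotone and
    bounded, and that of [f] is their difference. *)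
Lemma discounted_noise_cvg : exists xi : R, eta T @[T --> +oo] --> xi.
Proof.
pose f s := expR (- (th * s)) * b s.
pose g s := M * expR (- (th / 2) * s).
have cf : continuous f by rewrite /f; ctn.
have cg : continuous g by rewrite /g; ctn.
have cvg_nd (h : R -> R) : continuous h -> (forall t, 0 <= t -> 0 <= h t) ->
    (forall T, 0 <= T -> prim h T <= 2 * (M * (2 / th))) ->
    exists l : R, prim h T @[T --> +oo] --> l.
  move=> ch h0 hb; exists (sup (range (prim h))).
  apply: nondecreasing_cvgr.
    move=> S T ST; have [S0|S0] := leP 0 S; first exact: nondecreasing_prim.
    by rewrite prim_neg ?(ltW S0)//; apply: prim_ge0.
  exists (2 * (M * (2 / th))) => _ [T _ <-].
  have [/hb//|T0] := leP 0 T; rewrite prim_neg ?(ltW T0)// mulr_ge0// mulr_ge0//.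
  by rewrite divr_ge0// ltW.
have g0 t : 0 <= t -> 0 <= g t by move=> t0; rewrite mulr_ge0 ?expR_ge0.
have K0 : 0 <= M * (2 / th) by rewrite mulr_ge0// divr_ge0// ltW.
have [l hl] : exists l : R, prim (fun s => f s + g s) T @[T --> +oo] --> l.
  apply: cvg_nd; first by ctn.
    by move=> t t0; have := bound t0; rewrite ler_norml -/(f t) -/(g t) => /andP[h _]; lra.
  move=> T T0; rewrite primD//.
  have h1 := prim_bound T0.
  have : prim f T <= prim g T.
    by apply: le_prim => // t /andP[t0 _]; exact: le_trans (ler_norm _) (bound t0).
  by rewrite -/g in h1 *; lra.
have [k hk] : exists k : R, prim g T @[T --> +oo] --> k.
  by apply: cvg_nd => // T T0; have h1 := prim_bound T0; rewrite -/g in h1 *; lra.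
exists (x0 + th * (l - k)).
rewrite /eta -/f; apply: cvgD; first exact: cvg_cst.
apply: cvgM; first exact: cvg_cst.
have -> : prim f = (fun T => prim (fun s => f s + g s) T - prim g T).
  by apply/funext => T; rewrite primD// addrK.
exact: cvgB.
Qed.

Let m t := x0 + th * prim x t.

Let mE t : 0 <= t -> x t = m t + b t.
Proof. by move=> t0; rewrite /m xE//; ring. Qed.

Let cm : continuous m. Proof. by rewrite /m; ctn. Qed.

Let dm t : 0 < t -> is_derive t 1 m (th * x t).
Proof. by move=> t0; have ? := is_derive_prim cx t0; rewrite /m; drv. Qed.

(** The derivative of [expR (- (th * t)) * m t] is [th * expR (- (th * t)) * (x t - m t)], and
    [x - m = b]. *)
Let etaE t : 0 <= t -> eta t = expR (- (th * t)) * m t.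
Proof.
move=> t0; rewrite /eta -primZ; last by ctn.
pose F t := expR (- (th * t)) * m t.
rewrite (_ : prim _ t = F t - F 0).
  by rewrite /F mulr0 oppr0 expR0 /m prim0; ring.
refine (@prim_of_derive _ _ F _ _ _ _ _); [by ctn|by rewrite /F; ctn| |by []].
move=> s s0; have ? := dm s0.
by rewrite /F; apply: is_derive_eq; rewrite /GRing.scale /= (mE (ltW s0)); ring.
Qed.

Let eta_le t : 0 <= t -> `|eta t| <= `|x0| + 2 * M.
Proof.
move=> t0; rewrite /eta (le_trans (ler_normD _ _))// lerD2l.
rewrite normrM gtr0_norm//.
have -> : 2 * M = th * (M * (2 / th)) by field; rewrite gt_eqF.
rewrite ler_pM2l//.
apply: le_trans (prim_bound t0); apply: norm_prim_le; try by ctn.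
by move=> s /andP[s0 _]; exact: bound.
Qed.

Let b_le t : 0 <= t -> `|b t| <= M * expR (th * t).
Proof.
move=> t0; apply: (le_trans (bM t0)); rewrite ler_wpM2l// ler_expR.
by rewrite ler_wpM2r// ler_piMr ?(ltW th0)// invf_le1 ?ler1n.
Qed.

Let x_le t : 0 <= t -> `|x t| <= (`|x0| + 3 * M) * expR (th * t).
Proof.
move=> t0; rewrite mE// (le_trans (ler_normD _ _))//.
have -> : m t = expR (th * t) * eta t by rewrite etaE// mulrA -expRD subrr expR0 mul1r.
have h1 := ler_wpM2l (expR_ge0 (th * t)) (eta_le t0).
have h2 := b_le t0.
rewrite normrM (ger0_norm (expR_ge0 _)).
by move: h1 h2; set e := expR _ => h1 h2; nra.
Qed.

(** [x] grows at most at rate [th] and [b] at rate [th / 2], so the integral of [x * b] is of order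
    [expR (3 * th / 2 * T)], negligible against the order [expR (2 * th * T)] of the integral of
    [x ^+ 2]. *)
Let cross_term T : 0 <= T ->
  `|expR (- (2 * th * T)) * prim (fun t => x t * b t) T| <=
  (`|x0| + 3 * M) * M * (2 / (3 * th)) * expR (- (th / 2 * T)).
Proof.
move=> T0; rewrite normrM ger0_norm ?expR_ge0//.
have C0 : 0 <= (`|x0| + 3 * M) * M by rewrite mulr_ge0 ?addr_ge0 ?mulr_ge0.
have h : `|prim (fun t => x t * b t) T| <=
    prim (fun t => (`|x0| + 3 * M) * M * expR (3 * th / 2 * t)) T.
  apply: norm_prim_le; try by ctn.
  move=> t /andP[t0 _]; rewrite normrM.
  apply: le_trans (ler_pM _ _ (x_le t0) (bM t0)) _ => //.
  rewrite mulrACA -expRD ler_wpM2l// ler_expR.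
  by rewrite le_eqVlt; apply/orP; left; apply/eqP; field.
apply: (le_trans (ler_wpM2l (expR_ge0 _) h)).
have k0 : 3 * th / 2 != 0 by rewrite gt_eqF// divr_gt0// mulr_gt0.
rewrite primZ; last by ctn.
rewrite prim_expR// mulrCA -[leRHS]mulrA ler_wpM2l//.
have -> : 2 / (3 * th) * expR (- (th / 2 * T)) =
    expR (- (2 * th * T)) * (expR (3 * th / 2 * T) / (3 * th / 2)).
  rewrite mulrA -expRD mulrC invf_div; congr (expR _ * _).
  by field.
rewrite ler_wpM2l ?expR_ge0// ler_wpM2r ?invr_ge0 ?divr_ge0 ?mulr_ge0 ?(ltW th0)//.
by rewrite lerBlDr lerDl.
Qed.

(** After discounting, the numerator tends to [xi ^+ 2] and the integral to [xi ^+ 2 / (2 * th)]. *)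
Lemma explosive_ratio_limit xi : eta T @[T --> +oo] --> xi -> xi != 0 ->
  x T ^+ 2 / (2 * prim (fun t => x t ^+ 2) T) @[T --> +oo] --> th.
Proof.
move=> eta_xi xi0.
pose X T := expR (- (th * T)) * x T.
pose D T := expR (- (2 * th * T)) * prim (fun t => x t ^+ 2) T.
have limX : X T @[T --> +oo] --> xi.
  have h : eta T + expR (- (th * T)) * b T @[T --> +oo] --> xi.
    rewrite -[xi]addr0; apply: cvgD => //.
    have h1 : M * expR (- (th / 2 * T)) @[T --> +oo] --> (0 : R).
      rewrite -[X in _ --> X](mulr0 M); apply: cvgM; first exact: cvg_cst.
      by apply: expRN_cvg0; rewrite divr_gt0.
    apply/cvgr0Pnorm_le => e e0; move/cvgr0Pnorm_le : h1 => /(_ _ e0) h1.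
    near=> T.
    have T0 : 0 <= T by near: T; apply: nbhs_pinfty_ge; rewrite num_real.
    apply: (le_trans (bound T0)).
    apply: (@le_trans _ _ `|M * expR (- (th / 2 * T))|).
      by rewrite mulNr ler_norm.
    by near: T.
  apply: cvg_trans h; apply: near_eq_cvg; near=> T.
  have T0 : 0 <= T by near: T; apply: nbhs_pinfty_ge; rewrite num_real.
  by rewrite /X (mE T0) (etaE T0) -mulrDr.
(* Here [x ^+ 2 = m * x + x * b], and [m * x] is the derivative of [m ^+ 2 / (2 * th)]. *)
have sqrE T : 0 <= T -> prim (fun t => x t ^+ 2) T =
    (m T ^+ 2 - x0 ^+ 2) / (2 * th) + prim (fun t => x t * b t) T.
  move=> T0; apply/eqP; rewrite -subr_eq -primB; [|by ctn..]; apply/eqP.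
  pose F t := (2 * th)^-1 * m t ^+ 2.
  have -> : (m T ^+ 2 - x0 ^+ 2) / (2 * th) = F T - F 0.
    by rewrite /F /m prim0 mulr0 addr0 -mulrBr mulrC.
  refine (@prim_of_derive _ _ F _ _ _ _ _); [by ctn|by rewrite /F; ctn| |by []].
  move=> t t0; have ? := dm t0; rewrite /F.
  apply: is_derive_eq; rewrite /GRing.scale /= mE ?(ltW t0)//.
  by field; rewrite gt_eqF.
have limD : D T @[T --> +oo] --> xi ^+ 2 / (2 * th).
  have h : (eta T * eta T - x0 ^+ 2 * expR (- (2 * th * T))) / (2 * th) +
      expR (- (2 * th * T)) * prim (fun t => x t * b t) T @[T --> +oo] -->
      (xi * xi - x0 ^+ 2 * 0) / (2 * th) + 0.
    apply: cvgD.
      apply: cvgM; last exact: cvg_cst.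
      apply: cvgB; first exact: cvgM.
      apply: cvgM; first exact: cvg_cst.
      by apply: expRN_cvg0; rewrite mulr_gt0.
    set C := (`|x0| + 3 * M) * M * (2 / (3 * th)).
    have h1 : C * expR (- (th / 2 * T)) @[T --> +oo] --> (0 : R).
      rewrite -[X in _ --> X](mulr0 C); apply: cvgM; first exact: cvg_cst.
      by apply: expRN_cvg0; rewrite divr_gt0.
    apply/cvgr0Pnorm_le => e e0; move/cvgr0Pnorm_le : h1 => /(_ _ e0) h1.
    near=> T.
    have T0 : 0 <= T by near: T; apply: nbhs_pinfty_ge; rewrite num_real.
    apply: (le_trans (cross_term T0)).
    apply: (@le_trans _ _ `|C * expR (- (th / 2 * T))|); first exact: ler_norm.
    by near: T.
  rewrite mulr0 subr0 addr0 -expr2 in h.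
  apply: cvg_trans h; apply: near_eq_cvg; near=> T.
  have T0 : 0 <= T by near: T; apply: nbhs_pinfty_ge; rewrite num_real.
  rewrite /D (sqrE _ T0) [RHS]mulrDr; congr (_ + _).
  have -> : 2 * th * T = th * T + th * T by ring.
  by rewrite etaE// opprD expRD; ring.
have h : X T * X T / (2 * D T) @[T --> +oo] --> xi * xi / (2 * (xi ^+ 2 / (2 * th))).
  apply: cvgM; first exact: cvgM.
  apply: cvgV.
    by rewrite mulf_neq0 ?pnatr_eq0 ?mulf_neq0 ?expf_neq0 ?invr_neq0 ?mulf_neq0 ?pnatr_eq0 ?(gt_eqF th0).
  by apply: cvgM => //; exact: cvg_cst.
have thE : th = xi * xi / (2 * (xi ^+ 2 / (2 * th))).
  by field; rewrite xi0 gt_eqF.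
rewrite [X in _ --> X]thE.
apply: cvg_trans h; apply: near_eq_cvg; near=> T.
rewrite /X /D; set e2 := expR (- (2 * th * T)).
have -> : expR (- (th * T)) * x T * (expR (- (th * T)) * x T) = e2 * x T ^+ 2.
  have -> : e2 = expR (- (th * T)) * expR (- (th * T)).
    by rewrite /e2 -expRD; congr expR; ring.
  by ring.
rewrite (mulrCA 2 e2) (invfM e2) mulrACA divff ?mul1r// gt_eqF//.
exact: expR_gt0.
Unshelve. all: by end_near. Qed.

End explosive_path.

(** * Gaussian moments and small balls *)

Section density.
Context {R : realType}.
Notation mu := (@lebesgue_measure R).
Local Open Scope ereal_scope.
Variables (nu : {measure set (measurableTypeR R) -> \bar R}) (p : measurableTypeR R -> R).
Hypotheses (p0 : forall x, (0 <= p x)%R) (mp : measurable_fun setT p).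
Hypothesis nuE : forall A, measurable A -> nu A = \int[mu]_(x in A) (p x)%:E.

Import HBNNSimple.

Let integral_density_nnsfun (h : {nnsfun measurableTypeR R >-> R}) :
  \int[nu]_x (h x)%:E = \int[mu]_x ((h x)%:E * (p x)%:E).
Proof.
under [LHS]eq_integral do rewrite fimfunE -fsumEFin//.
rewrite [LHS]ge0_integral_fsum//; last 2 first.
  - by move=> r; exact/measurable_EFinP/measurableT_comp.
  - by move=> n x _; rewrite EFinM nnfun_muleindic_ge0.
under [RHS]eq_integral.
  move=> x _; rewrite fimfunE -fsumEFin// ge0_mule_fsuml; last first.
    by move=> r; exact: nnfun_muleindic_ge0.
  over.
have mpE : measurable_fun setT (EFin \o p) by exact/measurable_EFinP.
rewrite [RHS]ge0_integral_fsum//; last 2 first.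
  - move=> r; apply: emeasurable_funM => //.
    by apply/measurable_EFinP; do 2 apply/measurableT_comp => //.
  - by move=> r x _; apply: mule_ge0; [exact: nnfun_muleindic_ge0|rewrite lee_fin].
apply: eq_fsbigr => r _; rewrite integralZl_indic_nnsfun// integral_indic//= setIT.
rewrite nuE//.
have [r0|r0] := leP 0%R r; last first.
  rewrite (_ : h @^-1` [set r] = set0) ?integral_set0 ?mule0; last first.
    by apply/seteqP; split => // x /= hx; have : (0 <= h x)%R by []; rewrite leNgt hx r0.
  by rewrite integral0_eq// => x _; rewrite indic0 mulr0 mul0e.
rewrite -ge0_integralZl//; last 2 first.
  - exact: measurable_funTS.
  - by move=> x _; rewrite lee_fin.
rewrite [LHS]integral_mkcond; apply: eq_integral => x _.
rewrite patchE indicE; case: ifPn => _; first by rewrite mulr1.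
by rewrite mulr0 mul0e.
Qed.

(** Simple functions, then monotone convergence on both sides. *)
Lemma ge0_integral_density (f : measurableTypeR R -> \bar R) :
  measurable_fun setT f -> (forall x, 0 <= f x) ->
  \int[nu]_x f x = \int[mu]_x (f x * (p x)%:E).
Proof.
move=> mf f0.
pose h := nnsfun_approx measurableT mf.
have mpE : measurable_fun setT (EFin \o p) by exact/measurable_EFinP.
have mh n : measurable_fun setT (fun x => (h n x)%:E) by exact/measurable_EFinP.
have hcvg x : (h n x)%:E @[n --> \oo] --> f x by exact: cvg_nnsfun_approx.
have hnd x : {homo (fun n => (h n x)%:E) : m n / (m <= n)%N >-> m <= n}.
  by move=> m n mn; rewrite lee_fin; exact/lefP/nd_nnsfun_approx.
transitivity (lim (\int[nu]_x (h n x)%:E @[n --> \oo])).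
  rewrite -monotone_convergence//=.
  - by apply: eq_integral => x _; apply/esym/cvg_lim.
  - by move=> n x _; rewrite lee_fin.
rewrite (_ : (fun n => _) = fun n => \int[mu]_x ((h n x)%:E * (p x)%:E)); last first.
  by apply/funext => n; exact: integral_density_nnsfun.
rewrite -monotone_convergence//=.
- apply: eq_integral => x _; apply/cvg_lim => //.
  by apply: cvgeZr => //; exact: hcvg.
- by move=> n; apply: emeasurable_funM => //; exact: mh.
- by move=> n x _; apply: mule_ge0; rewrite lee_fin.
- by move=> x _ m n mn; apply: lee_wpmul2r; [rewrite lee_fin|exact: hnd].
Qed.

End density.

(** From [y / k <= expR (y / k)], raised to the power [k]. *)
Lemma exprn_le_expR {R : realType} (k : nat) (y : R) : 0 <= y ->
  y ^+ k <= k%:R ^+ k * expR y.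
Proof.
case: k => [|k] y0; first by rewrite !expr0 mul1r -expR0 ler_expR.
set K := k.+1.
have K0 : 0 < K%:R :> R by rewrite ltr0n.
have h : y / K%:R <= expR (y / K%:R).
  by apply: le_trans (expR_ge1Dx _); rewrite lerDr.
have {h} : (y / K%:R) ^+ K <= expR y.
  have -> : expR y = expR (y / K%:R) ^+ K.
    by rewrite -expRM_natl; congr expR; field; rewrite gt_eqF.
  by rewrite lerXn2r ?nnegrE ?expR_ge0// divr_ge0// ltW.
by rewrite expr_div_n ler_pdivrMr ?exprn_gt0// mulrC.
Qed.

Lemma is_derive_shiftX {R : realType} (m x : R) n :
  is_derive x (1 : R) (fun y => (y - m) ^+ n) (n%:R * (x - m) ^+ n.-1).
Proof.
have -> : (fun y : R => (y - m) ^+ n) = (fun y => y - m) ^+ n.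
  by apply/funext => y; rewrite exprfctE.
by apply: is_derive_eq; rewrite /GRing.scale /= subr0 !mulr1.
Qed.

Section integral_of_derivative.
Context {R : realType}.
Notation mu := (@lebesgue_measure R).

(** The fundamental theorem on [[m - n, m + n]] and dominated convergence. This is integration by
    parts on the line, in the form that yields the recursion for Gaussian moments. *)
Lemma integral_derive_eq0 (f F : R -> R) (m : R) :
  continuous f -> (forall x : R, is_derive x 1 F (f x)) ->
  mu.-integrable setT (EFin \o f) ->
  F (m + n%:R) @[n --> \oo] --> (0 : R) -> F (m - n%:R) @[n --> \oo] --> (0 : R) ->
  (\int[mu]_x (f x)%:E = 0)%E.
Proof.
move=> cf dF intf F1 F2.
pose D (n : nat) := `[m - n%:R, m + n%:R]%classic.
have mf : measurable_fun setT (EFin \o f) := measurable_int _ intf.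
have mfn n : measurable_fun setT ((EFin \o f) \_ (D n)).
  apply/(measurable_restrictT _ _).1; [exact: measurable_itv|exact: measurable_funTS].
have f_f x : [set: measurableTypeR R] x ->
    ((EFin \o f) \_ (D n)) x @[n --> \oo] --> (EFin \o f) x.
  move=> _; apply: cvg_near_cst; near=> n.
  rewrite /= patchE ifT// inE /D/= in_itv/=.
  have : `|x - m| <= n%:R by near: n; exact: nbhs_infty_ger.
  by rewrite ler_norml => /andP[h1 h2]; apply/andP; split; lra.
have f_g x n : [set: measurableTypeR R] x ->
    (`|((EFin \o f) \_ (D n)) x| <= `|(EFin \o f) x|)%E.
  move=> _; rewrite patchE; case: ifPn => // _.
  by rewrite abse0 abse_ge0.
have [_ _ g] := @dominated_convergence _ (measurableTypeR R) R mu setT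
  measurableT _ _ _ mfn mf (aeW _ f_f) (integrable_abse intf) (aeW _ f_g).
have h : (\int[mu]_x ((EFin \o f) \_ (D n)) x)%E @[n --> \oo] --> (0 : R)%:E.
  have -> : (fun n => \int[mu]_x ((EFin \o f) \_ (D n)) x)%E =
      (fun n => (F (m + n%:R) - F (m - n%:R))%:E).
    apply/funext => n; rewrite -integral_mkcond /D.
    have [->|n0] := eqVneq n 0%N.
      by rewrite subr0 addr0 subrr set_itv1 integral_set1.
    have mn : m - n%:R < m + n%:R.
      have : 0 < n%:R :> R by rewrite ltr0n lt0n.
      by lra.
    rewrite (continuous_FTC2 (F := F) mn).
    - by rewrite EFinB.
    - exact: continuous_subspaceT.
    - have cF : continuous F.
        move=> x; apply: differentiable_continuous; apply/derivable1_diffP.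
        by have [] := dF x.
      split.
      + by move=> x _; have [] := dF x.
      + by apply: cvg_at_right_filter; exact: cF.
      + by apply: cvg_at_left_filter; exact: cF.
    - by move=> x _; rewrite derive1E; have [] := dF x.
  apply: cvg_EFin; first exact: nearW.
  by rewrite -[X in _ --> X](subrr (0 : R)); exact: cvgB.
exact: (cvg_unique _ g h).
Unshelve. all: by end_near. Qed.

End integral_of_derivative.

(** * Moments of the normal law *)

Section normal_moments.
Context {R : realType}.
Notation mu := (@lebesgue_measure R).
Variables (m s : R).
Hypothesis s0 : 0 < s.
Implicit Types (x : R) (k p : nat).

Let q := 4 * s ^+ 2.
Let q0 : 0 < q. Proof. by rewrite mulr_gt0// exprn_gt0. Qed.
Let phi x := normal_peak s * expR (- (x - m) ^+ 2 / (s ^+ 2 *+ 2)).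

Let phiE : normal_pdf m s = phi.
Proof. by rewrite normal_pdfE ?gt_eqF. Qed.

Let phi_ge0 x : 0 <= phi x.
Proof. by rewrite mulr_ge0 ?normal_peak_ge0 ?expR_ge0. Qed.

(** With [q = 4 * s ^+ 2] the Gaussian factor is the square of [expR (- ((x - m) ^+ 2 / q))]: one
    copy absorbs the even powers, the other is kept. Arbitrary powers follow from
    [|z| <= 1 + z ^+ 2]. *)
Let moment_bound k : exists2 C, 0 <= C &
  forall x, `|(x - m) ^+ k * phi x| <= C * expR (- ((x - m) ^+ 2 / q)).
Proof.
pose C (j : nat) := normal_peak s * (q ^+ j * j%:R ^+ j).
have C0 j : 0 <= C j.
  by rewrite !mulr_ge0 ?normal_peak_ge0 ?exprn_ge0// ltW.
have h j x : (x - m) ^+ (2 * j) * phi x <= C j * expR (- ((x - m) ^+ 2 / q)).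
  set y := x - m.
  have y2 : 0 <= y ^+ 2 / q by rewrite divr_ge0 ?sqr_ge0// ltW.
  have yE : y ^+ (2 * j) = q ^+ j * (y ^+ 2 / q) ^+ j.
    by rewrite exprM -exprMn mulrCA divff ?mulr1// gt_eqF.
  have -> : phi x = normal_peak s * (expR (- (y ^+ 2 / q)) * expR (- (y ^+ 2 / q))).
    rewrite /phi -/y -expRD; congr (_ * expR _).
    by rewrite /q -mulr_natr; field; rewrite gt_eqF.
  set e := expR (- (y ^+ 2 / q)).
  have e1 : expR (y ^+ 2 / q) * e = 1 by rewrite -expRD subrr expR0.
  have -> : C j * e = normal_peak s * e * (q ^+ j * (j%:R ^+ j * (expR (y ^+ 2 / q) * e))).
    by rewrite e1 /C; ring.
  rewrite yE.
  have -> : q ^+ j * (y ^+ 2 / q) ^+ j * (normal_peak s * (e * e)) =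
      normal_peak s * e * (q ^+ j * ((y ^+ 2 / q) ^+ j * e)) by ring.
  rewrite ler_wpM2l ?mulr_ge0 ?normal_peak_ge0 ?expR_ge0//.
  rewrite ler_wpM2l ?exprn_ge0 ?(ltW q0)// mulrA ler_wpM2r ?expR_ge0//.
  exact: exprn_le_expR.
exists (C 0%N + C k); first by rewrite addr_ge0.
move=> x; rewrite normrM (ger0_norm (phi_ge0 x)) mulrDl.
apply: le_trans (lerD (h 0%N x) (h k x)).
rewrite -mulrDl ler_wpM2r// muln0 expr0 mulnC exprM.
by have := sqr_ge0 (`|(x - m) ^+ k| - 1); rewrite -(real_normK (num_real ((x - m) ^+ k))); nra.
Qed.

Let cphi : continuous phi.
Proof. by rewrite /phi; ctn. Qed.

Lemma integrable_normal_moment k :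
  mu.-integrable setT (fun x => ((x - m) ^+ k * normal_pdf m s x)%:E).
Proof.
rewrite phiE; have [C C0 hC] := moment_bound k.
(* The bound of [moment_bound] is a multiple of the normal density with standard deviation
   [Num.sqrt 2 * s]. *)
have s2 : Num.sqrt 2 * s != 0 by rewrite gt_eqF// mulr_gt0// sqrtr_gt0.
pose C' := C / normal_peak (Num.sqrt 2 * s).
apply: (@le_integrable _ _ _ mu _ measurableT _
  (fun x => (C' * normal_pdf m (Num.sqrt 2 * s) x)%:E)).
- apply/measurable_EFinP; apply: continuous_measurable_fun.
  by ctn.
- move=> x _; rewrite /= lee_fin (le_trans (hC x))// ger0_norm; last first.
    by rewrite mulr_ge0 ?normal_pdf_ge0// divr_ge0// normal_peak_ge0.
  rewrite normal_pdfE// /C' mulrA divfK; last by rewrite gt_eqF// normal_peak_gt0.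
  rewrite le_eqVlt; apply/orP; left; apply/eqP; congr (_ * expR _).
  rewrite exprMn sqr_sqrtr// /q -mulr_natr; field; rewrite gt_eqF//.
- under eq_fun do rewrite EFinM.
  apply: integrableZl => //; exact: integrable_normal_pdf.
Qed.

Let tail k (u : nat -> R) : (forall n, `|u n - m| = n%:R) ->
  (u n - m) ^+ k * phi (u n) @[n --> \oo] --> (0 : R).
Proof.
move=> un; have [C C0 hC] := moment_bound k.
have h : C * expR (- (q^-1 * n%:R)) @[n --> \oo] --> (0 : R).
  rewrite -[X in _ --> X](mulr0 C); apply: cvgM; first exact: cvg_cst.
  apply: (@cvg_comp _ _ _ (fun n : nat => n%:R : R) (fun t => expR (- (q^-1 * t))) _ (pinfty_nbhs R)).
    exact: cvgr_idn.
  by apply: expRN_cvg0; rewrite invr_gt0.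
apply/cvgr0Pnorm_le => e e0; move/cvgr0Pnorm_le : h => /(_ _ e0); apply: filterS => n h.
apply: (le_trans (hC _)); apply: le_trans h; rewrite ger0_norm; last first.
  by rewrite mulr_ge0 ?expR_ge0.
rewrite ler_wpM2l// ler_expR lerN2 mulrC ler_pM2r ?invr_gt0//.
rewrite -real_normK ?num_real// un -natrX ler_nat.
by case: n => // n; rewrite expnS expn1 leq_pmulr.
Qed.

Let phi_derive x : is_derive x 1 phi (- ((x - m) / s ^+ 2) * phi x).
Proof.
rewrite /phi; apply: is_derive_eq; rewrite /GRing.scale /= -mulr_natr.
by field; rewrite gt_eqF.
Qed.

Lemma normal_centered_mean :
  (\int[mu]_x ((x - m) * normal_pdf m s x)%:E = 0)%E.
Proof.
rewrite phiE.
apply: (@integral_derive_eq0 R (fun x => (x - m) * phi x)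
  (fun x => - (s ^+ 2) * phi x) m).
- by ctn.
- move=> x; have ? := phi_derive x.
  apply: is_derive_eq; rewrite /GRing.scale /= ?expr0.
  by field; rewrite gt_eqF.
- have := integrable_normal_moment 1; rewrite phiE.
  by under eq_fun do rewrite expr1.
- rewrite -(mulr0 (- s ^+ 2)); apply: cvgM; first exact: cvg_cst.
  have := @tail 0%N (fun n => m + n%:R) _.
  under eq_fun do rewrite expr0 mul1r.
  by apply => n; rewrite addrAC subrr add0r ger0_norm.
- rewrite -(mulr0 (- s ^+ 2)); apply: cvgM; first exact: cvg_cst.
  have := @tail 0%N (fun n => m - n%:R) _.
  under eq_fun do rewrite expr0 mul1r.
  by apply => n; rewrite addrAC subrr add0r normrN ger0_norm.
Qed.

(** The double factorial [(2p - 1)!!]. *)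
Definition gauss_coef p : R := \prod_(i < p) (2 * i + 1)%:R.

(** The derivative of [- s ^+ 2 * ((x - m) ^+ (2 * p).+1 * phi x)] has integral 0, which makes each
    even moment [(2 * p + 1) * s ^+ 2] times the preceding one. *)
Lemma normal_even_moment p :
  (\int[mu]_x ((x - m) ^+ (2 * p) * normal_pdf m s x)%:E =
   (gauss_coef p * (s ^+ 2) ^+ p)%:E)%E.
Proof.
elim: p => [|p IHp].
  under eq_integral do rewrite muln0 expr0 mul1r.
  by rewrite integral_normal_pdf /gauss_coef big_ord0 expr0 mulr1.
have i1 := integrable_normal_moment (2 * p.+1).
have i2 := integrable_normal_moment (2 * p).
pose f x := (x - m) ^+ (2 * p.+1) * phi x -
  (2 * p + 1)%:R * s ^+ 2 * ((x - m) ^+ (2 * p) * phi x).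
have i3 : mu.-integrable setT
    (fun x => (((2 * p + 1)%:R * s ^+ 2)%:E * ((x - m) ^+ (2 * p) * phi x)%:E))%E.
  by apply: integrableZl => //; rewrite -phiE.
have h : (\int[mu]_x (f x)%:E = 0)%E.
  apply: (@integral_derive_eq0 R f
    (fun x => - (s ^+ 2) * ((x - m) ^+ (2 * p).+1 * phi x)) m).
  - by rewrite /f; ctn.
  - move=> x; have ? := phi_derive x; have ? := is_derive_shiftX m x (2 * p).+1.
    apply: is_derive_eq; rewrite /GRing.scale /= /f.
    have -> : (2 * p.+1 = (2 * p).+2)%N by rewrite mulnS.
    rewrite addn1; generalize (2 * p)%N => N; rewrite !exprS.
    by field; rewrite gt_eqF.
  - have -> : EFin \o f = (fun x => ((x - m) ^+ (2 * p.+1) * phi x)%:E -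
        (((2 * p + 1)%:R * s ^+ 2)%:E * ((x - m) ^+ (2 * p) * phi x)%:E))%E by [].
    by apply: integrableB => //; rewrite -phiE.
  - rewrite -(mulr0 (- s ^+ 2)); apply: cvgM; first exact: cvg_cst.
    by apply: tail => n; rewrite addrAC subrr add0r ger0_norm.
  - rewrite -(mulr0 (- s ^+ 2)); apply: cvgM; first exact: cvg_cst.
    by apply: tail => n; rewrite addrAC subrr add0r normrN ger0_norm.
have if_ : mu.-integrable setT (EFin \o f).
  have -> : EFin \o f = (fun x => ((x - m) ^+ (2 * p.+1) * phi x)%:E -
      (((2 * p + 1)%:R * s ^+ 2)%:E * ((x - m) ^+ (2 * p) * phi x)%:E))%E by [].
  by apply: integrableB => //; rewrite -phiE.
rewrite phiE in IHp i2 *.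
transitivity (\int[mu]_x ((f x)%:E +
    ((2 * p + 1)%:R * s ^+ 2)%:E * ((x - m) ^+ (2 * p) * phi x)%:E))%E.
  by apply: eq_integral => x _; rewrite -EFinM -EFinD /f subrK.
rewrite integralD// h add0e integralZl// IHp -EFinM.
by congr EFin; rewrite /gauss_coef big_ord_recr/= [in RHS](exprSr _ p); ring.
Qed.

End normal_moments.

(** * Moments and small balls of a centered Gaussian variable *)

Section gaussian_law_moments.
Context {R : realType} (d : measure_display) (Omega : measurableType d)
  (P : probability Omega R).
Notation mu := (@lebesgue_measure R).
Variables (Z : Omega -> R) (v : R).
Hypotheses (mZ : measurable_fun setT Z) (iZ : P.-integrable setT (EFin \o Z)).
Hypotheses (EZ : (\int[P]_w (Z w)%:E = 0)%E)
  (EZ2 : (\int[P]_w (Z w ^+ 2)%:E = v%:E)%E).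
Hypothesis gZ : gaussian_law (pushforward P Z).

Let integral_dirac_law (m : R) (f : measurableTypeR R -> \bar R) :
  (forall A, measurable A -> pushforward P Z A = \d_m A) ->
  measurable_fun setT f -> (forall x, 0 <= f x)%E ->
  (\int[P]_w f (Z w) = f m)%E.
Proof.
move=> hZ mf f0.
have <- : (\int[pushforward P Z]_x f x = \int[P]_w f (Z w))%E.
  by rewrite (ge0_integral_pushforward mZ).
rewrite (eq_measure_integral (dirac m)) => [|A mA _]; last exact: hZ.
by rewrite integral_dirac// diracT mul1e.
Qed.

Let integral_normal_law (m s : R) (f : measurableTypeR R -> \bar R) :
  (forall A, measurable A -> pushforward P Z A = normal_prob m s A) ->
  measurable_fun setT f -> (forall x, 0 <= f x)%E ->
  (\int[P]_w f (Z w) = \int[mu]_x (f x * (normal_pdf m s x)%:E))%E.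
Proof.
move=> hZ mf f0.
have mZ' : @measurable_fun _ _ Omega (measurableTypeR R) setT Z by [].
pose X : {mfun Omega >-> measurableTypeR R} :=
  @mfun_Sub _ _ Omega (measurableTypeR R) Z (mem_set mZ').
transitivity (\int[distribution P X]_x f x)%E.
  by rewrite ge0_integral_distribution.
apply: ge0_integral_density => //.
  by move=> x; exact: normal_pdf_ge0.
exact: measurable_normal_pdf.
Qed.

Let normal_second_moment (m s a : R) : 0 < s ->
  (\int[mu]_x (((x - a) ^+ 2)%:E * (normal_pdf m s x)%:E) =
   (s ^+ 2 + (m - a) ^+ 2)%:E)%E.
Proof.
move=> s0.
have i1 := integrable_normal_moment m s0 1.
have i2 := integrable_normal_moment m s0 2.
have i0 := integrable_normal_pdf m s.
transitivity (\int[mu]_x (((x - m) ^+ 2 * normal_pdf m s x)%:E +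
  ((2 * (m - a))%:E * ((x - m) ^+ 1 * normal_pdf m s x)%:E +
   ((m - a) ^+ 2)%:E * (normal_pdf m s x)%:E)))%E.
  apply: eq_integral => x _; rewrite -!EFinM -!EFinD; congr EFin.
  by ring.
rewrite integralD//; last by apply: integrableD => //; exact: integrableZl.
rewrite integralD//; [|exact: integrableZl|exact: integrableZl].
rewrite !integralZl// integral_normal_pdf mule1.
under [X in (_ + (_ * X + _))%E]eq_integral do rewrite expr1.
rewrite normal_centered_mean// mule0 add0e.
rewrite (normal_even_moment m s0 1) /gauss_coef big_ord1 expr1.
by rewrite -EFinD muln0 add0n mul1r.
Qed.

Let measurable_sqrB (a : R) :
  measurable_fun setT (fun x : measurableTypeR R => ((x - a) ^+ 2)%:E).
Proof.
apply/measurable_EFinP; apply: continuous_measurable_fun.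
by ctn.
Qed.

Let second_moment_shift (a : R) :
  (\int[P]_w ((Z w - a) ^+ 2)%:E = (v + a ^+ 2)%:E)%E.
Proof.
have i2 : P.-integrable setT (fun w => (Z w ^+ 2)%:E).
  apply/integrableP; split; first exact/measurable_EFinP/measurable_funX.
  under eq_integral do rewrite gee0_abs ?lee_fin ?sqr_ge0//.
  by rewrite EZ2 ltry.
have ia : P.-integrable setT (fun=> (a ^+ 2)%:E) by exact: finite_measure_integrable_cst.
transitivity (\int[P]_w ((Z w ^+ 2)%:E + ((- (2 * a))%:E * (Z w)%:E + (a ^+ 2)%:E)))%E.
  by apply: eq_integral => w _; rewrite -EFinM -!EFinD; congr EFin; ring.
rewrite integralD//; last by apply: integrableD => //; exact: integrableZl.
rewrite integralD//; last exact: integrableZl.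
rewrite integralZl// EZ mule0 add0e EZ2 integral_cst//= probability_setT mule1.
by rewrite -EFinD.
Qed.

(** Integrals are transferred to the law for nonnegative integrands only, so the mean is read off
    from the shifted squares: [v + a ^+ 2 = s ^+ 2 + (m - a) ^+ 2] at [a = 0] and [a = -1]. *)
Let normal_law_parameters (m s : R) : 0 < s ->
  (forall A, measurable A -> pushforward P Z A = normal_prob m s A) ->
  m = 0 /\ v = s ^+ 2.
Proof.
move=> s0 hZ.
have h a : v + a ^+ 2 = s ^+ 2 + (m - a) ^+ 2.
  apply: EFin_inj; rewrite -second_moment_shift -normal_second_moment//.
  by rewrite (integral_normal_law (f := fun x => ((x - a) ^+ 2)%:E) hZ)// => x; rewrite lee_fin sqr_ge0.
have := h 0; have := h (-1); rewrite subr0 opprK sqrrD expr0n addr0 => h1 h2.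
by split; nra.
Qed.

Lemma gaussian_even_moment p :
  (\int[P]_w (Z w ^+ (2 * p))%:E = (gauss_coef p * v ^+ p)%:E)%E.
Proof.
have mX : measurable_fun setT (fun x : measurableTypeR R => (x ^+ (2 * p))%:E).
  apply/measurable_EFinP; apply: continuous_measurable_fun.
  exact: exprn_continuous.
have X0 (x : measurableTypeR R) : (0 <= (x ^+ (2 * p))%:E)%E.
  by rewrite lee_fin exprM exprn_ge0 ?sqr_ge0.
case: gZ => [[m hZ]|[m [s [s0 hZ]]]].
  have h a : v + a ^+ 2 = (m - a) ^+ 2.
    apply: EFin_inj; rewrite -second_moment_shift.
    by rewrite (integral_dirac_law (f := fun x => ((x - a) ^+ 2)%:E) hZ)// => x; rewrite lee_fin sqr_ge0.
  have := h 0; have := h (-1); rewrite subr0 opprK sqrrD expr0n addr0 => h1 h2.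
  have m0 : m = 0 by nra.
  have v0 : v = 0 by rewrite h2 m0 expr0n.
  rewrite (integral_dirac_law (f := fun x => (x ^+ (2 * p))%:E) hZ)//.
  rewrite m0 v0 !expr0n muln_eq0 /=.
  by case: p {mX X0} => [|p]; rewrite /gauss_coef ?big_ord0 ?mulr1 ?mulr0.
have [m0 v0] := normal_law_parameters s0 hZ.
rewrite (integral_normal_law (f := fun x => (x ^+ (2 * p))%:E) hZ)//.
rewrite v0 -(normal_even_moment m s0).
by apply: eq_integral => x _; rewrite -EFinM m0 subr0.
Qed.

(** A point mass is excluded by the positive variance, and a normal density of variance at least
    [v0] is at most [1 / Num.sqrt v0]. Separating [v0] from [v] makes the bound uniform over a
    family of variables. *)
Lemma gaussian_small_ball (v0 x e : R) : 0 < v0 -> v0 <= v -> 0 <= e ->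
  (P [set w | (`|Z w - x| <= e)%R] <= (2 * e / Num.sqrt v0)%:E)%E.
Proof.
move=> v00 v0v e0.
have v_gt0 : 0 < v by exact: lt_le_trans v0v.
pose I : set R := `[x - e, x + e]%classic.
have mI : measurable I by exact: measurable_itv.
have ballE : [set w | `|Z w - x| <= e] = Z @^-1` I.
  by rewrite /I; apply/seteqP; split => w /=; rewrite in_itv/= ler_norml;
     move=> /andP[h1 h2]; apply/andP; split; lra.
rewrite ballE -[X in (X <= _)%E]/(pushforward P Z _).
case: gZ => [[m hZ]|[m [s [s0 hZ]]]].
  have h a : v + a ^+ 2 = (m - a) ^+ 2.
    apply: EFin_inj; rewrite -second_moment_shift.
    by rewrite (integral_dirac_law (f := fun x => ((x - a) ^+ 2)%:E) hZ)// => y; rewrite lee_fin sqr_ge0.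
  have := h 0; have := h (-1); rewrite subr0 opprK sqrrD expr0n addr0 => h1 h2.
  have m0 : m = 0 by nra.
  by move: v_gt0; rewrite h2 m0 expr0n ltxx.
have [m0 vE] := normal_law_parameters s0 hZ.
rewrite hZ//=.
rewrite /normal_prob.
apply: (@le_trans _ _ (\int[mu]_(y in I) ((Num.sqrt v0)^-1)%:E))%E.
  apply: ge0_le_integral => //.
  - by move=> y _; rewrite lee_fin normal_pdf_ge0.
  - by apply/measurable_EFinP/measurable_funTS; exact: measurable_normal_pdf.
  - move=> y _; rewrite lee_fin.
    have sn0 : s != 0 by rewrite gt_eqF.
    apply: (le_trans (normal_pdf_ub m y sn0)).
    rewrite /normal_peak lef_pV2 ?posrE ?sqrtr_gt0//; last first.
      by rewrite pmulrn_lgt0// mulr_gt0 ?pi_gt0// exprn_gt0.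
    rewrite ler_sqrt; last first.
      by rewrite pmulrn_lge0// mulr_ge0 ?pi_ge0// sqr_ge0.
    rewrite -vE (le_trans v0v)// -mulr_natr -mulrA ler_peMr ?(ltW v_gt0)//.
    by have := @pi_ge2 R; nra.
rewrite integral_cst//= /I lebesgue_measure_itv/= lte_fin.
case: ltP => h; last by rewrite mule0 lee_fin divr_ge0 ?mulr_ge0 ?sqrtr_ge0.
rewrite -EFinB -EFinM lee_fin.
by rewrite le_eqVlt; apply/orP; left; apply/eqP; ring.
Qed.

End gaussian_law_moments.

(** * Gaussian combinations of fractional Brownian motion *)

Section linear_combinations.
Context {R : realType} (d : measure_display) (Omega : measurableType d)
  (P : probability Omega R).
Variables (H : R) (B : R -> {RV P >-> R}).
Hypothesis fB : fractional_brownian_motion H B.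
Implicit Types (t s : R) (n : nat).

Definition fbm_cov (H t s : R) : R :=
  2^-1 * (`|t| `^ (2 * H) + `|s| `^ (2 * H) - `|t - s| `^ (2 * H)).

Definition comb_var (H : R) n (a t : 'I_n -> R) : R :=
  \sum_(i < n) \sum_(j < n) a i * a j * fbm_cov H (t i) (t j).

Let EBB t s : (\int[P]_w (B t w * B s w)%:E = (fbm_cov H t s)%:E)%E.
Proof. by case: fB => _ _ h _; have := h t s; rewrite unlock. Qed.

Let mB t : measurable_fun setT (B t).
Proof. exact: measurable_funPT. Qed.

Let iBsqr t : P.-integrable setT (fun w => (B t w ^+ 2)%:E).
Proof.
apply/integrableP; split; first exact/measurable_EFinP/measurable_funX.
under eq_integral do rewrite gee0_abs ?lee_fin ?sqr_ge0// expr2.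
by rewrite EBB ltry.
Qed.

Let iB t : P.-integrable setT (fun w => (B t w)%:E).
Proof.
apply: (@le_integrable _ _ _ P _ measurableT _ (fun w => 1%:E + (B t w ^+ 2)%:E)%E).
- exact/measurable_EFinP.
- move=> w _; rewrite /= lee_fin [leRHS]ger0_norm ?addr_ge0 ?sqr_ge0//.
  have := normr_ge0 (B t w); have := sqr_ge0 (`|B t w| - 1).
  rewrite -(real_normK (num_real (B t w))); nra.
- by apply: integrableD => //; exact: finite_measure_integrable_cst.
Qed.

Let iBB t s : P.-integrable setT (fun w => (B t w * B s w)%:E).
Proof.
apply: (@le_integrable _ _ _ P _ measurableT _
  (fun w => (B t w ^+ 2)%:E + (B s w ^+ 2)%:E)%E).
- exact/measurable_EFinP/measurable_funM.
- move=> w _; rewrite /= lee_fin [leRHS]ger0_norm ?addr_ge0 ?sqr_ge0//.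
  rewrite normrM; have := sqr_ge0 (`|B t w| - `|B s w|).
  rewrite -(real_normK (num_real (B t w))) -(real_normK (num_real (B s w))).
  by have := normr_ge0 (B t w); have := normr_ge0 (B s w); nra.
- exact: integrableD.
Qed.

Let EB t : (\int[P]_w (B t w)%:E = 0)%E.
Proof. by case: fB => _ h _ _; have := h t; rewrite unlock. Qed.

Variables (n : nat) (a t : 'I_n -> R).
Let Z w := \sum_(i < n) a i * B (t i) w.

Let mZ : measurable_fun setT Z.
Proof. by apply: measurable_sum => i; apply: measurable_funM. Qed.

Let iZ : P.-integrable setT (EFin \o Z).
Proof.
have -> : EFin \o Z = (fun w => \sum_(i < n) (a i)%:E * (B (t i) w)%:E)%E.
  by apply/funext => w; rewrite /= -sumEFin.
by apply: integrable_sum => // i _; exact: integrableZl.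
Qed.

Let EZ : (\int[P]_w (Z w)%:E = 0)%E.
Proof.
transitivity (\int[P]_w \sum_(i < n) (a i)%:E * (B (t i) w)%:E)%E.
  by apply: eq_integral => w _; rewrite /Z -sumEFin.
rewrite integral_sum//; last by move=> i; exact: integrableZl.
by rewrite big1// => i _; rewrite integralZl// EB mule0.
Qed.

Let EZ2 : (\int[P]_w (Z w ^+ 2)%:E = (comb_var H a t)%:E)%E.
Proof.
transitivity (\int[P]_w \sum_(i < n) \sum_(j < n)
    (a i * a j)%:E * (B (t i) w * B (t j) w)%:E)%E.
  apply: eq_integral => w _; rewrite expr2 /Z big_distrlr/= -sumEFin.
  apply: eq_bigr => i _; rewrite -sumEFin; apply: eq_bigr => j _.
  by rewrite -EFinM; congr EFin; ring.
have i1 i j : P.-integrable setT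
    (fun w => (a i * a j)%:E * (B (t i) w * B (t j) w)%:E)%E by exact: integrableZl.
rewrite integral_sum//; last by move=> i; apply: integrable_sum => // j _.
rewrite /comb_var -sumEFin; apply: eq_bigr => i _.
rewrite integral_sum// -sumEFin; apply: eq_bigr => j _.
by rewrite integralZl// EBB EFinM.
Qed.

Lemma fbm_even_moment p : (\int[P]_w ((\sum_(i < n) a i * B (t i) w) ^+ (2 * p))%:E =
  (gauss_coef p * comb_var H a t ^+ p)%:E)%E.
Proof.
by case: fB => g _ _ _; exact: (gaussian_even_moment mZ iZ EZ EZ2 (g n t a) p).
Qed.

Lemma fbm_small_ball (v0 x e : R) : 0 < v0 -> v0 <= comb_var H a t -> 0 <= e ->
  (P [set w | (`|(\sum_(i < n) a i * B (t i) w) - x| <= e)%R] <=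
   (2 * e / Num.sqrt v0)%:E)%E.
Proof.
by case: fB => g _ _ _; exact: (gaussian_small_ball mZ iZ EZ EZ2 (g n t a)).
Qed.

End linear_combinations.

(** * Joint measurability of continuous random paths *)

Section caratheodory.
Context {R : realType} (d : measure_display) (Omega : measurableType d).
Variable b : R -> Omega -> R.
Hypotheses (mb : forall t, measurable_fun setT (b t))
  (cb : forall w, continuous (fun t => b t w)).

Let cell (n : nat) (t : R) : R := (Num.floor (t * n.+1%:R))%:~R / n.+1%:R.

Let cell_cvg t : cell n t @[n --> \oo] --> t.
Proof.
apply: (@squeeze_cvgr _ _ _ _ (fun n => t - harmonic n) (fun=> t)).
- apply: nearW => n; have n0 : 0 < n.+1%:R :> R by [].
  have /andP[h1 h2] := mem_rg1_floor (t * n.+1%:R).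
  rewrite /cell /harmonic /= ler_pdivrMr// h1 andbT ler_pdivlMr// mulrBl mulVf ?gt_eqF//.
  by rewrite lerBlDr ltW// (le_lt_trans _ h2)//.
- rewrite -[X in _ --> X]subr0; apply: cvgB; first exact: cvg_cst.
  exact: (@cvg_harmonic R).
- exact: cvg_cst.
Qed.

Let measurable_step n : measurable_fun setT (fun z : Omega * R => b (cell n z.2) z.1).
Proof.
move=> _ Y mY; rewrite setTI.
have n0 : 0 < n.+1%:R :> R by [].
pose I (k : int) : set R := `[k%:~R / n.+1%:R, (k%:~R + 1) / n.+1%:R[%classic.
have -> : (fun z : Omega * R => b (cell n z.2) z.1) @^-1` Y =
    \bigcup_k ((b (k%:~R / n.+1%:R) @^-1` Y) `*` I k).
  apply/seteqP; split => [[w t] /= Yw|[w t] [k _ [/= Yw]]].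
    exists (Num.floor (t * n.+1%:R)) => //; split => //=.
    have /andP[h1 h2] := mem_rg1_floor (t * n.+1%:R).
    by rewrite /I/= in_itv/= ler_pdivrMr// ltr_pdivlMr// h1.
  rewrite /I/= in_itv/= ler_pdivrMr// ltr_pdivlMr// => /andP[h1 h2].
  suff -> : cell n t = k%:~R / n.+1%:R by [].
  rewrite /cell; congr (_%:~R / _); apply: floor_def.
  by rewrite h1 intrD1.
apply: countable_bigcupT_measurable => // k.
apply: measurableX; last exact: measurable_itv.
by rewrite -[X in measurable X]setTI; exact: mb.
Qed.

(** Rounding the time down to the grid of step [1 / n.+1] gives functions whose preimages are
    countable unions of measurable rectangles; by continuity of the paths they converge
    pointwise. *)
Lemma measurable_caratheodory : measurable_fun setT (fun z : Omega * R => b z.2 z.1).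
Proof.
apply: (measurable_fun_cvg measurable_step) => -[w t] _ /=.
apply: (@continuous_cvg _ _ _ _ _ _ (fun t => b t w)); first exact: cb.
exact: cell_cvg.
Qed.

End caratheodory.

(* Joint measurability in time and outcome, which Tonelli's theorem requires,
   needs all paths to be continuous and not merely almost all of them. *)
Lemma fbm_continuous_modification {R : realType} (d : measure_display)
    (Omega : measurableType d) (P : probability Omega R) (H : R)
    (B : R -> {RV P >-> R}) : fractional_brownian_motion H B ->
  exists b : R -> Omega -> R,
    [/\ forall w, continuous (fun t => b t w), forall t, measurable_fun setT (b t) &
        \forall w \ae P, forall t, b t w = B t w].
Proof.
move=> [_ _ _ hae].
have hneg : P.-negligible (~` [set w | continuous (fun t => B t w)]) by exact: hae.
case: hneg => N [mN PN hN].
exists (fun (t : R) (w : Omega) => if w \in ~` N then B t w else 0); split.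
- move=> w; have [|_] := boolP (w \in ~` N); last exact: cst_continuous.
  rewrite in_setC => /negP wN.
  have : ~ (~` [set w | continuous (fun t => B t w)]) w.
    by move=> /hN /mem_set.
  by move/contrapT.
- move=> t; have -> : (fun w : Omega => if w \in ~` N then B t w else 0) = (B t : Omega -> R) \_ (~` N).
    by apply/funext => w; rewrite patchE.
  apply/(measurable_restrictT _ _).1; first exact: measurableC.
  exact: measurable_funTS.
- exists N; split => // w /= h; apply: contrapT => wN; apply: h => t.
  by rewrite ifT// in_setC; apply/negP => /set_mem.
Qed.

(** * Moments of one and of two increments *)

Section increments.
Context {R : realType} (d : measure_display) (Omega : measurableType d)
  (P : probability Omega R).
Variables (H : R) (B : R -> {RV P >-> R}).
Hypotheses (H0 : 0 < H) (fB : fractional_brownian_motion H B).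
Implicit Types (t s : R) (p : nat).

Definition increment_cov t1 s1 t2 s2 : R := 2^-1 *
  (`|t1 - s2| `^ (2 * H) + `|s1 - t2| `^ (2 * H)
   - `|t1 - t2| `^ (2 * H) - `|s1 - s2| `^ (2 * H)).

Let pow0 : 0 `^ (2 * H) = 0 :> R.
Proof. by rewrite powR0// mulf_neq0// gt_eqF. Qed.

Lemma fbm_increment_moment p t s :
  (\int[P]_w ((B t w - B s w) ^+ (2 * p))%:E =
   (gauss_coef p * (`|t - s| `^ (2 * H)) ^+ p)%:E)%E.
Proof.
have := fbm_even_moment fB (fun i : 'I_2 => nth 0 [:: 1; -1] i)
  (fun i : 'I_2 => nth 0 [:: t; s] i) p.
rewrite /comb_var; under eq_integral do rewrite !big_ord_recl big_ord0 /= mul1r mulN1r addr0.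
rewrite !big_ord_recl !big_ord0 /fbm_cov /= !subrr !normr0 pow0 (distrC s t) => ->.
by congr (_ * _ ^+ _)%:E; field.
Qed.

(** The free coefficients prepare polarization: the sum, the difference and each increment alone are
    instances. *)
Lemma fbm_increments_moment p (al be : R) t1 s1 t2 s2 :
  (\int[P]_w ((al * (B t1 w - B s1 w) + be * (B t2 w - B s2 w)) ^+ (2 * p))%:E =
   (gauss_coef p * (al ^+ 2 * `|t1 - s1| `^ (2 * H) + be ^+ 2 * `|t2 - s2| `^ (2 * H)
      + 2 * al * be * increment_cov t1 s1 t2 s2) ^+ p)%:E)%E.
Proof.
have := fbm_even_moment fB (fun i : 'I_4 => nth 0 [:: al; - al; be; - be] i)
  (fun i : 'I_4 => nth 0 [:: t1; s1; t2; s2] i) p.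
rewrite /comb_var.
under eq_integral.
  move=> w _; rewrite !big_ord_recl big_ord0 /=.
  have -> : al * B t1 w + (- al * B s1 w + (be * B t2 w + (- be * B s2 w + 0))) =
    al * (B t1 w - B s1 w) + be * (B t2 w - B s2 w) by ring.
  over.
rewrite !big_ord_recl !big_ord0 /fbm_cov /= !subrr !normr0 pow0 => ->.
rewrite (distrC s1 t1) (distrC t2 t1) (distrC s2 t1) (distrC t2 s1) (distrC s2 s1)
  (distrC s2 t2) /increment_cov.
by congr (_ * _ ^+ _)%:E; field.
Qed.

End increments.

(** * Growth of the paths *)

Section ae_summable.
Context {R : realType} (d : measure_display) (Omega : measurableType d)
  (P : probability Omega R).

(** The sum of the series has finite expectation, hence is finite almost surely. This is the form in
    which Borel-Cantelli is used: one random [M] bounds all partial sums. *)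
Lemma ae_summable_ereal (Y : nat -> Omega -> \bar R) (u : nat -> R) (C : R) :
  (forall k, measurable_fun setT (Y k)) -> (forall k w, (0 <= Y k w)%E) ->
  (forall k, (\int[P]_w Y k w <= (u k)%:E)%E) ->
  (forall n, \sum_(k < n) u k <= C) ->
  \forall w \ae P, exists M : R, forall n, (\sum_(k < n) Y k w <= M%:E)%E.
Proof.
move=> mY Y0 Yu uC.
pose S w := (\sum_(k <oo) Y k w)%E.
have mS : measurable_fun setT S.
  apply: (emeasurable_fun_cvg (fun n w => \sum_(0 <= k < n) Y k w)%E).
    by move=> n; exact: emeasurable_sum.
  by move=> w _; apply: is_cvg_nneseries.
have S0 w : (0 <= S w)%E by exact: nneseries_ge0.
have iS : P.-integrable setT S.
  apply/integrableP; split => //.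
  under eq_integral do rewrite gee0_abs//.
  rewrite integral_nneseries//.
  apply: (@le_lt_trans _ _ C%:E); last exact: ltry.
  apply: lime_le.
    by apply: is_cvg_nneseries => k _ _; exact: integral_ge0.
  apply: nearW => n; rewrite (le_trans (lee_sum _ (fun k _ => Yu k)))//.
  by rewrite sumEFin lee_fin big_mkord.
apply: filterS (integrable_ae measurableT iS) => w /(_ I) Sfin.
exists (fine (S w)) => n; rewrite fineK//.
rewrite -(big_mkord xpredT (fun k => Y k w)).
exact: nneseries_lim_ge.
Qed.

Lemma ae_summable (Y : nat -> Omega -> R) (u : nat -> R) (C : R) :
  (forall k, measurable_fun setT (Y k)) -> (forall k w, 0 <= Y k w) ->
  (forall k, (\int[P]_w (Y k w)%:E <= (u k)%:E)%E) ->
  (forall n, \sum_(k < n) u k <= C) ->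
  \forall w \ae P, exists M, forall n, \sum_(k < n) Y k w <= M.
Proof.
move=> mY Y0 Yu uC.
have mYE k : measurable_fun setT (EFin \o Y k) by exact/measurable_EFinP.
have Y0E k w : (0 <= (EFin \o Y k) w)%E by rewrite lee_fin.
apply: filterS (ae_summable_ereal mYE Y0E Yu uC) => w [M hM].
by exists M => n; rewrite -lee_fin -sumEFin; exact: hM.
Qed.

End ae_summable.

(** * Dyadic chaining *)

Section chaining.
Context {R : realType}.
Implicit Types (f : R -> R) (a t A q : R).

(** A point of level [j + 1] with even index already has level [j]; one with odd index is a single
    increment of level [j + 1] away from its even left neighbour. A dyadic point thus costs at most
    one increment per level, a geometric sum, and continuity reaches the other points. *)
Lemma dyadic_chaining f a A q : continuous f -> 0 <= A -> 0 <= q < 1 ->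
  (forall j i, (i < 2 ^ j)%N ->
     `|f (a + i.+1%:R / 2 ^+ j) - f (a + i%:R / 2 ^+ j)| <= A * q ^+ j) ->
  forall t, a <= t <= a + 1 -> `|f t - f a| <= A / (1 - q).
Proof.
move=> cf A0 /andP[q0 q1] hA t /andP[at1 at2].
have dyadic j i : (i <= 2 ^ j)%N ->
    `|f (a + i%:R / 2 ^+ j) - f a| <= \sum_(k < j.+1) A * q ^+ k.
  elim: j i => [|j IHj] i.
    rewrite expn0 big_ord1; case: i => [|[|//]] _.
      by rewrite mul0r addr0 subrr normr0 mulr_ge0 ?exprn_ge0.
    by have := hA 0%N 0%N isT; rewrite !mul0r addr0.
  have p2 : 2 ^+ j != 0 :> R by rewrite expf_neq0.
  have even_case m : (m <= 2 ^ j)%N ->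
      `|f (a + m.*2%:R / 2 ^+ j.+1) - f a| <= \sum_(k < j.+1) A * q ^+ k.
    move=> mj; have -> : m.*2%:R / 2 ^+ j.+1 = m%:R / 2 ^+ j :> R.
      by rewrite -muln2 natrM exprS; field.
    exact: IHj.
  rewrite big_ord_recr /= -(odd_double_half i); case: (odd i) => /= hi.
    apply: (@le_trans _ _ (`|f (a + i./2.*2%:R / 2 ^+ j.+1) - f a| +
      `|f (a + i./2.*2.+1%:R / 2 ^+ j.+1) - f (a + i./2.*2%:R / 2 ^+ j.+1)|)).
      apply: le_trans (ler_normD _ _); rewrite le_eqVlt; apply/orP; left.
      by apply/eqP; congr (`|_|); ring.
    apply: lerD; last by apply: hA.
    apply: even_case; rewrite -leq_double -[X in (_ <= X)%N]mul2n -expnS.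
    exact: ltnW.
  rewrite add0n in hi *; rewrite (le_trans (even_case _ _))//.
    by rewrite -leq_double -[X in (_ <= X)%N]mul2n -expnS.
  by rewrite lerDl mulr_ge0// exprn_ge0.
have geo n : \sum_(k < n) A * q ^+ k <= A / (1 - q).
  have q1' : 0 < 1 - q by rewrite subr_gt0.
  rewrite ler_pdivlMr// -big_distrr /= -mulrA ler_piMr//.
  have -> : (\sum_(i < n) q ^+ i) * (1 - q) = 1 - q ^+ n.
    rewrite mulrC -opprB mulNr -subrX1 opprB; congr (_ - _).
  by rewrite lerBlDr lerDl exprn_ge0.
pose i j := Num.truncn ((t - a) * 2 ^+ j).
pose u j : R := a + (i j)%:R / 2 ^+ j.
have ta0 : 0 <= t - a by rewrite subr_ge0.
have i_itv j : (i j)%:R <= (t - a) * 2 ^+ j < (i j).+1%:R.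
  by apply: truncn_itv; rewrite mulr_ge0 ?exprn_ge0.
have cu : u j @[j --> \oo] --> t.
  have h : t - 2^-1 ^+ j @[j --> \oo] --> t.
    rewrite -[X in _ --> X]subr0; apply: cvgB; first exact: cvg_cst.
    by apply: cvg_expr; rewrite ger0_norm ?invr_ge0// invf_lt1// ltr1n.
  apply: (@squeeze_cvgr _ _ _ _ (fun j => t - 2^-1 ^+ j) (fun=> t)) => //; last exact: cvg_cst.
  apply: nearW => j; have /andP[h1 h2] := i_itv j.
  have p2 : 0 < 2 ^+ j :> R by rewrite exprn_gt0.
  rewrite /u exprVn; apply/andP; split.
    have : t - a < (i j).+1%:R / 2 ^+ j by rewrite ltr_pdivlMr.
    by rewrite -natr1 mulrDl mul1r; set e := (2 ^+ j)^-1; lra.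
  by rewrite -lerBrDl ler_pdivrMr.
have cfu : `|f (u j) - f a| @[j --> \oo] --> `|f t - f a|.
  apply: cvg_norm; apply: cvgB; last exact: cvg_cst.
  by apply: (@continuous_cvg _ _ _ _ _ _ f) => //; exact: cf.
rewrite -(cvg_lim _ cfu)//; apply: limr_le; first by apply/cvg_ex; exists (`|f t - f a|).
apply: nearW => j; apply: le_trans (geo j.+1); apply: dyadic.
rewrite -(ler_nat R) natrX; have /andP[h1 _] := i_itv j.
by rewrite (le_trans h1)// ler_piMl ?exprn_ge0// lerBlDl.
Qed.

Lemma exponential_growth f M q kap : continuous f -> 0 <= M -> 0 <= q < 1 -> 0 < kap ->
  (forall n j i, (i < 2 ^ j)%N ->
     `|f (n%:R + i.+1%:R / 2 ^+ j) - f (n%:R + i%:R / 2 ^+ j)|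
       <= M * expR (kap * n%:R) * q ^+ j) ->
  exists M', forall t, 0 <= t -> `|f t| <= M' * expR (kap * t).
Proof.
move=> cf M0 q01 k0 hf.
have ek1 : 1 < expR kap by rewrite -expR0 ltr_expR.
have /andP[q0 q1] := q01.
pose D := M / (1 - q).
have D0 : 0 <= D by rewrite divr_ge0// subr_ge0 ltW.
have step n t : n%:R <= t <= n%:R + 1 -> `|f t - f n%:R| <= D * expR (kap * n%:R).
  move=> nt; have := @dyadic_chaining f n%:R (M * expR (kap * n%:R)) q cf _ q01 (hf n) t nt.
  by rewrite mulr_ge0 ?expR_ge0// => /(_ isT) h; rewrite /D mulrAC.
(* [D'] solves [D' * expR kap = D' + D], so the bound at integers reproduces itself under one step
   of cost [D * expR (kap * n%:R)]. *)
pose D' := D / (expR kap - 1).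
have D'0 : 0 <= D' by rewrite divr_ge0// subr_ge0 ltW.
have D'E : D' * expR kap = D' + D.
  by rewrite /D'; field; rewrite subr_eq0 gt_eqF.
have fn n : `|f n%:R| <= `|f 0| + D' * expR (kap * n%:R).
  elim: n => [|n IHn]; first by rewrite lerDl mulr_ge0 ?expR_ge0.
  have -> : f n.+1%:R = f n%:R + (f n.+1%:R - f n%:R) by rewrite addrC subrK.
  rewrite (le_trans (ler_normD _ _))//.
  have h : `|f n.+1%:R - f n%:R| <= D * expR (kap * n%:R).
    by apply: step; rewrite natr1 lexx andbT ler_nat.
  rewrite (le_trans (lerD IHn h))// -addrA -mulrDl -D'E.
  rewrite lerD2l -mulrA -expRD ler_wpM2l// ler_expR -natr1.
  by rewrite mulrDr mulr1 addrC.
exists (`|f 0| + D' + D) => t t0.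
pose n := Num.truncn t.
have /andP[n1 n2] := truncn_itv t0.
have h : `|f t - f n%:R| <= D * expR (kap * n%:R).
  by apply: step; rewrite n1 natr1 ltW.
have -> : f t = f n%:R + (f t - f n%:R) by rewrite addrC subrK.
rewrite (le_trans (ler_normD _ _))// (le_trans (lerD (fn n) h))//.
have e1 : expR (kap * n%:R) <= expR (kap * t) by rewrite ler_expR ler_wpM2l// ltW.
have e2 : 1 <= expR (kap * t) by rewrite -expR0 ler_expR mulr_ge0// ltW.
rewrite -addrA -mulrDl -addrA [in leRHS]mulrDl lerD ?ler_peMr//.
by rewrite ler_wpM2l// addr_ge0.
Qed.

End chaining.

(** * Exponential bounds for the fractional Brownian paths *)

Section fbm_growth.
Context {R : realType} (d : measure_display) (Omega : measurableType d)
  (P : probability Omega R).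
Variables (H : R) (B : R -> {RV P >-> R}).
Hypotheses (H0 : 0 < H) (fB : fractional_brownian_motion H B).

Lemma gauss_coef_ge0 p : 0 <= gauss_coef p :> R.
Proof. by rewrite /gauss_coef prodr_ge0. Qed.

Lemma le_add1_even_power (y M : R) (p : nat) : (0 < p)%N -> 0 <= M ->
  y ^+ (2 * p) <= M -> `|y| <= 1 + M.
Proof.
move=> p0 M0 yM; have [y1|y1] := leP `|y| 1; first by rewrite (le_trans y1)// lerDl.
rewrite (@le_trans _ _ M) ?lerDr// (le_trans _ yM)//.
rewrite exprM -real_normK ?num_real// -exprM.
by rewrite -[leLHS]expr1 ler_weXn2l ?(ltW y1)// muln_gt0.
Qed.

Lemma fbm_growth (kap : R) : 0 < kap ->
  \forall w \ae P, exists M, forall t, 0 <= t -> `|B t w| <= M * expR (kap * t).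
Proof.
move=> k0.
(* Moments of order 2p with 3 <= H p outweigh the 2^j increments of the j-th
   dyadic level; 1 <= kap p makes the sum over the unit intervals converge. *)
have [p [p0 pH pk]] : exists p : nat, [/\ (0 < p)%N, 3 <= H * p%:R & 1 <= kap * p%:R].
  pose p := maxn (Num.truncn (3 / H)).+1 (Num.truncn kap^-1).+1.
  exists p; split.
  - by rewrite leq_max.
  - rewrite -ler_pdivrMl// mulrC; apply/ltW.
    have /andP[_ h] := @truncn_itv _ (3 / H) (divr_ge0 (ler0n _ 3) (ltW H0)).
    by apply: (lt_le_trans h); rewrite ler_nat leq_maxl.
  - rewrite -ler_pdivrMl// mulr1; apply/ltW.
    have h0 : 0 <= kap^-1 by rewrite invr_ge0 ltW.
    have /andP[_ h] := truncn_itv h0.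
    by apply: (lt_le_trans h); rewrite ler_nat leq_maxr.
pose h : R := 2 `^ (- H).
have h0 : 0 < h by rewrite powR_gt0.
have h1 : h < 1.
  rewrite /h powRN invf_lt1 ?powR_gt0//.
  have : 1 `^ H < 2 `^ H by rewrite gt0_ltr_powR ?nnegrE ?ltr1n.
  by rewrite powR1.
(* Increments of level [j] have standard deviation [h ^+ j]. The paths are only asked for [q ^+ j],
   half of the exponent, and the other half makes the normalized moments decay. *)
pose q := Num.sqrt h.
have q0 : 0 < q by rewrite sqrtr_gt0.
have q1 : q < 1 by rewrite /q -sqrtr1 ltr_sqrt.
have hp : h ^+ p <= 8^-1.
  rewrite /h -powR_mulrn ?powR_ge0// -powRrM mulNr powRN lef_pV2 ?posrE ?powR_gt0//.
  rewrite [leLHS](_ : 8 = 2 `^ 3%:R); last by rewrite powR_mulrn// -natrX.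
  by rewrite ler_powR// ler1n.
have ekp : expR (- (kap * p%:R)) ^+ 2 <= 4^-1.
  rewrite expRN exprVn lef_pV2 ?posrE ?exprn_gt0 ?expR_gt0//.
  have : 2 <= expR (kap * p%:R) by apply: le_trans (expR_ge1Dx _); lra.
  by move=> e2; nra.
pose D (n j i : nat) (w : Omega) : R :=
  B (n%:R + i.+1%:R / 2 ^+ j) w - B (n%:R + i%:R / 2 ^+ j) w.
pose sc (n j : nat) : R := expR (kap * n%:R) * q ^+ j.
have sc0 n j : 0 < sc n j by rewrite mulr_gt0 ?expR_gt0// exprn_gt0.
(* Grouping by [N = n + j], the unit interval plus the dyadic level, lets a single series control
   all increments. *)
pose Y N w := \sum_(n < N.+1) \sum_(i < 2 ^ (N - n)) (D n (N - n)%N i w / sc n (N - n)%N) ^+ (2 * p).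
have even0 (y : R) : 0 <= y ^+ (2 * p) by rewrite exprM exprn_ge0 ?sqr_ge0.
have mD n j i : measurable_fun setT (fun w => (D n j i w / sc n j) ^+ (2 * p)).
  apply: measurable_funX; apply: measurable_funM => //.
  by apply: measurable_funB; exact: measurable_funPT.
have ED n j i : (\int[P]_w ((D n j i w / sc n j) ^+ (2 * p))%:E =
    (gauss_coef p * ((h ^+ p) ^+ j * (expR (- (kap * p%:R)) ^+ 2) ^+ n))%:E)%E.
  transitivity (\int[P]_w (((sc n j)^-1 ^+ (2 * p))%:E * (D n j i w ^+ (2 * p))%:E))%E.
    by apply: eq_integral => w _; rewrite -EFinM exprMn mulrC.
  rewrite ge0_integralZl//; last 3 first.
  - apply/measurable_EFinP/measurable_funX.
    by apply: measurable_funB; exact: measurable_funPT.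
  - by move=> w _; rewrite lee_fin.
  - by rewrite lee_fin.
  rewrite (fbm_increment_moment H0 fB) -EFinM; congr EFin.
  have -> : n%:R + i.+1%:R / 2 ^+ j - (n%:R + i%:R / 2 ^+ j) = (2 ^+ j)^-1 :> R.
    by rewrite -natr1; ring.
  have -> : `|(2 ^+ j)^-1| `^ (2 * H) = (h ^+ j) ^+ 2 :> R.
    rewrite ger0_norm ?invr_ge0 ?exprn_ge0// -!powR_mulrn ?powR_ge0// -powRN.
    by rewrite -!powRrM; congr (_ `^ _); ring.
  rewrite mulrCA; congr (_ * _).
  rewrite /sc invfM exprMn -mulrA mulrC; congr (_ * _); last first.
    by rewrite -expRN -mulrN -!expRM_natl; congr expR; rewrite natrM; ring.
  have q2 : q ^+ 2 = h by rewrite sqr_sqrtr// ltW.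
  rewrite exprVn -[in X in X^-1]exprM (_ : j * (2 * p) = 2 * (p * j))%N; last by ring.
  rewrite (exprM q) q2 -!(exprM h) (_ : j * 2 * p = p * j + p * j)%N; last by ring.
  by rewrite exprD mulKf// expf_neq0// gt_eqF.
have Y0 N w : 0 <= Y N w by apply: sumr_ge0 => n _; apply: sumr_ge0.
have mY N : measurable_fun setT (Y N).
  by apply: measurable_sum => n; apply: measurable_sum.
have EY N : (\int[P]_w (Y N w)%:E <= (gauss_coef p * 2^-1 ^+ N)%:E)%E.
  have -> : (\int[P]_w (Y N w)%:E = \sum_(n < N.+1) \sum_(i < 2 ^ (N - n))
      (\int[P]_w ((D n (N - n)%N i w / sc n (N - n)%N) ^+ (2 * p))%:E))%E.
    transitivity (\int[P]_w (\sum_(n < N.+1) \sum_(i < 2 ^ (N - n))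
        ((D n (N - n)%N i w / sc n (N - n)%N) ^+ (2 * p))%:E))%E.
      apply: eq_integral => w _; rewrite -sumEFin; apply: eq_bigr => n _.
      by rewrite sumEFin.
    rewrite ge0_integral_sum//; last 2 first.
    - by move=> n; apply: emeasurable_sum => i; apply/measurable_EFinP.
    - by move=> n w _; apply: sume_ge0 => i _; rewrite lee_fin.
    apply: eq_bigr => n _; rewrite ge0_integral_sum//.
    - by move=> i; apply/measurable_EFinP.
    - by move=> i w _; rewrite lee_fin.
  (* Level [j] has [2 ^ j] increments, each with factor at most [8 ^ (- j)], and interval [n]
     contributes at most [4 ^ (- n)]: each of the [N + 1] terms is at most [4 ^ (- N)] up to
     [gauss_coef p], and [N + 1 <= 2 ^ N]. *)
  apply: (@le_trans _ _ (\sum_(n < N.+1) (gauss_coef p * 4^-1 ^+ N)%:E)%E).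
    apply: lee_sum => n _.
    under eq_bigr do rewrite ED.
    rewrite sumEFin lee_fin sumr_const card_ord -[leLHS]mulr_natl natrX mulrCA.
    rewrite ler_wpM2l ?gauss_coef_ge0//.
    have nN : (n <= N)%N by rewrite -ltnS.
    rewrite -[in leRHS](subnK nN) exprD mulrA.
    apply: ler_pM; rewrite ?mulr_ge0 ?exprn_ge0 ?sqr_ge0 ?(ltW h0)//.
    - rewrite -exprMn lerXn2r ?nnegrE ?mulr_ge0 ?exprn_ge0 ?invr_ge0 ?(ltW h0)//.
      by lra.
    - by rewrite lerXn2r ?nnegrE ?sqr_ge0 ?invr_ge0.
  rewrite sumEFin lee_fin sumr_const card_ord -[leLHS]mulr_natl mulrCA.
  rewrite ler_wpM2l ?gauss_coef_ge0//.
  have -> : 4^-1 = 2^-1 * 2^-1 :> R by field.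
  rewrite exprMn mulrA ler_piMl ?exprn_ge0 ?invr_ge0//.
  by rewrite exprVn ler_pdivrMr ?exprn_gt0// mul1r -natrX ler_nat ltn_expl.
have sumY N : \sum_(k < N) gauss_coef p * 2^-1 ^+ k <= gauss_coef p * 2 :> R.
  rewrite -big_distrr /= ler_wpM2l ?gauss_coef_ge0//.
  have : (2^-1 - 1) * (\sum_(i < N) 2^-1 ^+ i) = 2^-1 ^+ N - 1 :> R by rewrite -subrX1.
  have : 0 <= 2^-1 ^+ N :> R by rewrite exprn_ge0 ?invr_ge0.
  by lra.
case: fB => _ _ _ cB.
have := ae_summable mY Y0 EY sumY.
apply: filter_app; apply: filterS cB => w cw [M hM].
have M0 : 0 <= M by have := hM 0%N; rewrite big_ord0.
apply: (@exponential_growth _ (fun t => B t w) (1 + M) q kap cw) => //.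
- by rewrite addr_ge0.
- by rewrite (ltW q0).
- move=> n j i ij.
  have : `|D n j i w / sc n j| <= 1 + M.
    apply: (le_add1_even_power p0 M0); apply: le_trans (hM (n + j).+1).
    rewrite big_ord_recr /=; apply: ler_wpDl; first by apply: sumr_ge0.
    have nN : (n < (n + j).+1)%N by rewrite ltnS leq_addr.
    rewrite /Y (bigD1 (Ordinal nN))//=; apply: ler_wpDr.
      by apply: sumr_ge0 => k _; apply: sumr_ge0.
    have nj : (n + j - n = j)%N by rewrite addKn.
    have ij' : (i < 2 ^ (n + j - n))%N by rewrite nj.
    rewrite (bigD1 (Ordinal ij'))//=; apply: ler_wpDr; first by apply: sumr_ge0.
    by rewrite nj.
  rewrite normrM normfV (gtr0_norm (sc0 n j)) ler_pdivrMr//.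
  by rewrite /sc mulrA.
Qed.

End fbm_growth.

(** * Variance of sums of squared increments *)

Section lag_bounds.
Context {R : realType}.
Implicit Types (a g u z tau : R).

(** The mean value theorem twice. For [z <= 1/2] the second intermediate point stays above [1/2], so
    its power [a - 2] is at most 4; the factor [a * |a - 1|] is at most 2, and [2 * xi * z] at most
    [2 * z ^+ 2]. *)
Lemma powR_second_difference a z : 0 < a < 2 -> 0 <= z <= 2^-1 ->
  `|(1 + z) `^ a + (1 - z) `^ a - 2| <= 16 * z ^+ 2.
Proof.
move=> /andP[a0 a2] /andP[]; rewrite le_eqVlt => /predU1P[<- _|z0 z2].
  rewrite addr0 subr0 powR1 (_ : 1 + 1 - 2 = 0); last by ring.
  by rewrite normr0 mulr_ge0 ?sqr_ge0.
pose f (y : R) : R := (1 + y) `^ a + (1 - y) `^ a.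
pose df (y : R) : R := a * (1 + y) `^ (a - 1) - a * (1 - y) `^ (a - 1).
have dadd (y : R) : is_derive y 1 (fun y : R => 1 + y) 1 by apply: is_derive_eq; ring.
have dsub (y : R) : is_derive y 1 (fun y : R => 1 - y) (-1) by apply: is_derive_eq; ring.
have dfP (y : R) : y < 1 -> -1 < y -> is_derive y 1 f (df y).
  move=> y1 y2.
  have p1 : is_derive (1 + y) 1 (fun x : R => x `^ a) (a * (1 + y) `^ (a - 1)).
    by apply: is_derive1_powR; lra.
  have p2 : is_derive (1 - y) 1 (fun x : R => x `^ a) (a * (1 - y) `^ (a - 1)).
    by apply: is_derive1_powR; lra.
  have c1 := @is_derive1_comp R (fun x : R => x `^ a) (fun y => 1 + y) y _ _ p1 (dadd y).
  have c2 := @is_derive1_comp R (fun x : R => x `^ a) (fun y => 1 - y) y _ _ p2 (dsub y).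
  have c3 := @is_deriveD R R R _ _ _ _ _ _ c1 c2.
  by apply: is_derive_eq c3 _; rewrite /df; ring.
have [||xi] := @MVT R f df 0 z z0.
- by move=> y; rewrite in_itv/= => /andP[y1 y2]; apply: dfP; lra.
- apply: derivable_within_continuous => y; rewrite in_itv/= => /andP[y1 y2].
  have hy : y < 1 by lra.
  have hy' : -1 < y by lra.
  by have [] := dfP y hy hy'.
rewrite in_itv/= subr0 => /andP[xi0 xiz] fE.
have f0 : f 0 = 2 by rewrite /f addr0 subr0 powR1; ring.
rewrite -f0 -/(f z) fE.
pose g (y : R) : R := y `^ (a - 1).
have dg (y : R) : 0 < y -> is_derive y 1 g ((a - 1) * y `^ (a - 1 - 1)).
  by move=> y0; exact: is_derive1_powR.
have xi_lt : 1 - xi < 1 + xi by lra.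
have [||ze] := @MVT R g (fun y => (a - 1) * y `^ (a - 1 - 1)) _ _ xi_lt.
- by move=> y; rewrite in_itv/= => /andP[y1 y2]; apply: dg; lra.
- apply: derivable_within_continuous => y; rewrite in_itv/= => /andP[y1 y2].
  have hy : 0 < y by lra.
  by have [] := dg y hy.
rewrite in_itv/= => /andP[ze1 ze2] gE.
have -> : df xi = a * ((a - 1) * ze `^ (a - 1 - 1) * (2 * xi)).
  by rewrite /df -mulrBr -/(g _) -/(g _) gE; congr (_ * (_ * _)); ring.
have zep : 0 <= ze `^ (a - 1 - 1) <= 4.
  rewrite powR_ge0 /=.
  have -> : a - 1 - 1 = - (2 - a) by ring.
  rewrite powRN -[leRHS]invrK lef_pV2 ?posrE ?powR_gt0 ?invr_gt0//; last by lra.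
  apply: (@le_trans _ _ (2^-1 `^ (2 - a))); last first.
    by apply: ge0_ler_powR; rewrite ?nnegrE; lra.
  apply: (@le_trans _ _ (2^-1 `^ 2)); last by apply: ger_powR; lra.
  by rewrite (powR_mulrn 2)//; lra.
have /andP[w0 w4] := zep; move: w0 w4; set w := ze `^ _ => w0 w4.
have h1 : `|a - 1| <= 1 by rewrite ler_norml; apply/andP; split; lra.
rewrite !normrM (gtr0_norm a0) (gtr0_norm xi0) (gtr0_norm z0) (ger0_norm w0) normr_nat.
have n0 := normr_ge0 (a - 1).
have e1 : `|a - 1| * w <= 4.
  by apply: (@le_trans _ _ (1 * w)); [rewrite ler_wpM2r|rewrite mul1r].
have e2 : a * (`|a - 1| * w) <= 8.
  by have : 0 <= `|a - 1| * w by [exact: mulr_ge0]; nra.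
have -> : a * (`|a - 1| * w * (2 * xi)) * z = a * (`|a - 1| * w) * (2 * xi * z) by ring.
have e3 : 0 <= 2 * xi * z by rewrite !mulr_ge0// ltW.
apply: (le_trans (ler_wpM2r e3 e2)).
by have : xi * z <= z * z by [rewrite ler_wpM2r// ltW]; rewrite expr2; lra.
Qed.

(** For [a = 2 * H], the covariance of two increments of length [u] at times [tau] apart: half a
    second difference of [|.| ^ a]. *)
Definition lag_cov a u tau : R :=
  2^-1 * (`|tau + u| `^ a + `|tau - u| `^ a - 2 * `|tau| `^ a).

Lemma lag_cov_le a u tau : 0 < a < 2 -> 0 <= u -> 0 < tau ->
  `|lag_cov a u tau| <= u `^ a ->
  `|lag_cov a u tau| <= 16 * u ^+ 2 * tau `^ (a - 2).
Proof.
move=> a02 u0 tau0 Ku; have /andP[a0 a2] := a02.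
have taua : tau ^+ 2 * tau `^ (a - 2) = tau `^ a.
  rewrite -powR_mulrn ?ltW// -powRD; first by congr (_ `^ _); ring.
  by apply/implyP => _; rewrite gt_eqF.
have [ut|ut] := leP u (tau / 2).
  pose z := u / tau.
  have uE : u = tau * z by rewrite /z mulrC divfK// gt_eqF.
  have z02 : 0 <= z <= 2^-1.
    by rewrite /z divr_ge0 ?(ltW tau0)//= ler_pdivrMr// mulrC.
  have := powR_second_difference a02 z02; have /andP[z0 z2] := z02 => h.
  have -> : lag_cov a u tau = 2^-1 * tau `^ a * ((1 + z) `^ a + (1 - z) `^ a - 2).
    rewrite /lag_cov uE (_ : tau + tau * z = tau * (1 + z)); last by ring.
    rewrite (_ : tau - tau * z = tau * (1 - z)); last by ring.
    rewrite !ger0_norm ?(ltW tau0) ?mulr_ge0 ?(ltW tau0)//; try lra.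
    by rewrite !powRM ?(ltW tau0)//; try lra; ring.
  rewrite normrM ger0_norm ?mulr_ge0 ?powR_ge0//.
  have t0 := powR_ge0 tau a.
  apply: (le_trans (ler_wpM2l _ h)); first by rewrite mulr_ge0.
  rewrite uE [in leRHS]exprMn -taua.
  have : 0 <= tau ^+ 2 * tau `^ (a - 2) * z ^+ 2 by rewrite taua mulr_ge0 ?sqr_ge0.
  by lra.
apply: (le_trans Ku).
have u_gt0 : 0 < u by apply: le_lt_trans ut; rewrite divr_ge0// ltW.
have -> : u `^ a = u ^+ 2 * u `^ (a - 2).
  rewrite -powR_mulrn ?ltW// -powRD; first by congr (_ `^ _); ring.
  by apply/implyP => _; rewrite gt_eqF.
rewrite (mulrC 16) -[leRHS]mulrA ler_wpM2l ?sqr_ge0//.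
have -> : a - 2 = - (2 - a) by ring.
rewrite !powRN.
have hb : tau `^ (2 - a) <= 4 * u `^ (2 - a).
  apply: (@le_trans _ _ ((2 * u) `^ (2 - a))).
    by apply: ge0_ler_powR; rewrite ?nnegrE; lra.
  rewrite powRM// ler_wpM2r ?powR_ge0//.
  apply: (@le_trans _ _ (2 `^ 2)); first by apply: ler_powR; lra.
  by rewrite (powR_mulrn 2)//; lra.
have p1 := powR_gt0 (2 - a) tau0; have p2 := powR_gt0 (2 - a) u_gt0.
rewrite -[leLHS]mul1r ler_pdivrMr// mulrAC ler_pdivlMr//.
by move: hb p1 p2; set A := tau `^ _; set C := u `^ _; lra.
Qed.

Lemma sum_inv_sqrt_le N : \sum_(j < N) (j.+1%:R : R) `^ (- 2^-1) <= 2 * Num.sqrt N%:R.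
Proof.
elim: N => [|N IHN]; first by rewrite big_ord0 sqrtr0 mulr0.
rewrite big_ord_recr /= (le_trans (lerD IHN (lexx _)))//.
rewrite powRN powR12_sqrt//.
have s0 : 0 < Num.sqrt (N.+1%:R : R) by rewrite sqrtr_gt0.
have s2 : Num.sqrt (N.+1%:R : R) ^+ 2 = N%:R + 1 by rewrite sqr_sqrtr// natr1.
have r2 : Num.sqrt (N%:R : R) ^+ 2 = N%:R by rewrite sqr_sqrtr.
move: s0 s2 r2; set s := Num.sqrt _; set r := Num.sqrt _ => s0 s2 r2.
rewrite -(ler_pM2r s0) mulrDl mulVf ?gt_eqF//.
by have := sqr_ge0 (s - r); nra.
Qed.

(** Reduction to the exponent [1/2], since [j ^ (1/2 - g) <= N ^ (1/2 - g)] for [j <= N]. *)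
Lemma sum_inv_powR_le g N : 0 < g <= 2^-1 ->
  \sum_(j < N) (j.+1%:R : R) `^ (- g) <= 2 * N%:R `^ (1 - g).
Proof.
move=> /andP[g0 g2]; case: N => [|N].
  by rewrite big_ord0 mulr_ge0 ?powR_ge0.
apply: (@le_trans _ _ (\sum_(j < N.+1) N.+1%:R `^ (2^-1 - g) * j.+1%:R `^ (- 2^-1))).
  apply: ler_sum => j _.
  rewrite [in leLHS](_ : - g = (2^-1 - g) + (- 2^-1)); last by ring.
  rewrite powRD; last by apply/implyP => _; rewrite pnatr_eq0.
  rewrite ler_wpM2r ?powR_ge0//; apply: ge0_ler_powR; rewrite ?nnegrE//; first by lra.
  by rewrite ler_nat ltnS -ltnS.
rewrite -big_distrr /=; apply: (le_trans (ler_wpM2l (powR_ge0 _ _) (sum_inv_sqrt_le _))).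
rewrite mulrCA ler_wpM2l// -powR12_sqrt// -powRD; last by apply/implyP => _; rewrite pnatr_eq0.
by rewrite (_ : 2^-1 - g + 2^-1 = 1 - g)//; field.
Qed.

(** Each value of the distance [|k - l|], written [maxn k l - minn k l], is taken by at most [2 * N]
    pairs. *)
Lemma double_sum_lag_le (f : nat -> R) N : (forall j, 0 <= f j) ->
  \sum_(k < N) \sum_(l < N) f (maxn k l - minn k l)%N <= 2 * N%:R * \sum_(j < N) f j.
Proof.
move=> f0; elim: N => [|N IHN]; first by rewrite !big_ord0 mulr0.
rewrite big_ord_recr /=.
under eq_bigr do rewrite big_ord_recr /=.
rewrite big_split /= big_ord_recr /= maxnn minnn subnn.
have e1 : \sum_(i < N) f (maxn i N - minn i N)%N = \sum_(i < N) f i.+1.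
  rewrite (reindex_inj rev_ord_inj) /=; apply: eq_bigr => i _; congr (f _).
  have h : (N - i.+1 <= N)%N by rewrite leq_subr.
  by rewrite (maxn_idPr h) (minn_idPl h) subKn.
have e2 : \sum_(i < N) f (maxn N i - minn N i)%N = \sum_(i < N) f i.+1.
  by rewrite -e1; apply: eq_bigr => i _; rewrite maxnC minnC.
rewrite e1 e2.
have e3 : f 0%N + \sum_(i < N) f i.+1 = \sum_(j < N.+1) f j.
  by rewrite [in RHS]big_ord_recl.
have e4 : \sum_(j < N) f j <= \sum_(j < N.+1) f j.
  by rewrite big_ord_recr /= lerDl.
have := f0 0%N; rewrite -natr1.
have N0 : 0 <= N%:R :> R by [].
have := ler_wpM2l N0 e4.
by move: IHN; rewrite -e3; set A := \sum_(k < N) _; set S := \sum_(i < N) f i.+1; lra.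
Qed.

(* A crude constant, not an optimal one. *)
Definition lag_const : R := 1024.

Lemma lag_const_ge1 : 1 <= lag_const.
Proof. by rewrite /lag_const; lra. Qed.

(** The square decays like [j ^ (2 * a - 4)], which [g <= 4 - 2 * a] weakens to [j ^ (- g)]. At
    [j = 0] only the variance bound is available, and the shift to [j.+1] keeps the power meaningful
    there. *)
Lemma lag_cov_sqr_le a g u (j : nat) : 0 < a < 2 -> 0 < g <= 2^-1 -> g <= 4 - 2 * a ->
  0 <= u -> `|lag_cov a u j%:R| <= u `^ a ->
  lag_cov a u j%:R ^+ 2 <= lag_const * (1 + u ^+ 2) ^+ 2 * j.+1%:R `^ (- g).
Proof.
move=> a02 /andP[g0 g2] ga u0 Ku; have /andP[a0 a2] := a02.
have u2 := sqr_ge0 u.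
rewrite -real_normK ?num_real// /lag_const.
case: j Ku => [|j] Ku.
  rewrite powR1 mulr1.
  have ua : u `^ a <= 1 + u ^+ 2.
    have [u1|u1] := leP u 1.
      apply: (@le_trans _ _ (1 `^ a)); first by apply: ge0_ler_powR; rewrite ?nnegrE//; lra.
      by rewrite powR1; lra.
    apply: (@le_trans _ _ (u `^ 2)); first by apply: ler_powR; lra.
    by rewrite (powR_mulrn 2)//; lra.
  apply: (@le_trans _ _ ((1 + u ^+ 2) ^+ 2)).
    by rewrite lerXn2r ?nnegrE ?addr_ge0// (le_trans Ku).
  by have := sqr_ge0 (1 + u ^+ 2); lra.
have t0 : 0 < j.+1%:R :> R by rewrite ltr0n.
have h := lag_cov_le a02 u0 t0 Ku.
apply: (@le_trans _ _ ((16 * u ^+ 2 * j.+1%:R `^ (a - 2)) ^+ 2)).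
  by rewrite lerXn2r ?nnegrE ?mulr_ge0 ?powR_ge0.
rewrite exprMn.
have e1 : (j.+1%:R `^ (a - 2)) ^+ 2 <= 2 * j.+2%:R `^ (- g) :> R.
  rewrite -powR_mulrn ?powR_ge0// -powRrM.
  apply: (@le_trans _ _ (j.+1%:R `^ (- g))).
    by apply: ler_powR; [rewrite ler1n|lra].
  rewrite !powRN.
  have hb : j.+2%:R `^ g <= 2 * j.+1%:R `^ g :> R.
    apply: (@le_trans _ _ ((2 * j.+1%:R) `^ g)).
      apply: ge0_ler_powR; rewrite ?nnegrE ?mulr_ge0//; first exact: ltW.
      by rewrite -natrM ler_nat mul2n -addnn addSnnS leq_addl.
    rewrite powRM// ler_wpM2r ?powR_ge0//.
    apply: (@le_trans _ _ (2 `^ 1)); first by apply: ler_powR; lra.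
    by rewrite powRr1.
  have p1 := powR_gt0 g t0.
  have p2 : 0 < j.+2%:R `^ g :> R by rewrite powR_gt0.
  by rewrite -[leLHS]mul1r ler_pdivrMr// mulrAC ler_pdivlMr// mul1r.
have p0 := powR_ge0 (j.+2%:R : R) (- g).
apply: (le_trans (ler_wpM2l (sqr_ge0 _) e1)).
move: p0; set w := _ `^ (- g) => w0.
have -> : (16 * u ^+ 2) ^+ 2 * (2 * w) = 512 * (u ^+ 2) ^+ 2 * w by ring.
rewrite ler_wpM2r//.
by move: u2; set y := u ^+ 2 => y0; nra.
Qed.

End lag_bounds.

(** * Covariances of squared increments *)

Section quadratic_variation_variance.
Context {R : realType} (d : measure_display) (Omega : measurableType d)
  (P : probability Omega R).
Variables (H : R) (B : R -> {RV P >-> R}).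
Hypotheses (H01 : 0 < H < 1) (fB : fractional_brownian_motion H B).
Variable u : R.
Hypothesis u0 : 0 <= u.
Implicit Types t s : R.

Let H0 : 0 < H. Proof. by have /andP[] := H01. Qed.
Let a := 2 * H.
Let m := u `^ a.
Let Inc t w := B t w - B (t - u) w.

Let mInc t : measurable_fun setT (Inc t).
Proof. by apply: measurable_funB; exact: measurable_funPT. Qed.

Lemma increment_covE t s : increment_cov H t (t - u) s (s - u) = lag_cov a u (t - s).
Proof.
rewrite /increment_cov /lag_cov /a; congr (_ * _).
have -> : t - (s - u) = t - s + u by ring.
have -> : t - u - s = t - s - u by ring.
have -> : t - u - (s - u) = t - s by ring.
by ring.
Qed.

Lemma lag_covN tau : lag_cov a u (- tau) = lag_cov a u tau.
Proof.
rewrite /lag_cov normrN -(normrN (- tau + u)) -(normrN (- tau - u)).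
by rewrite !opprD !opprK; ring.
Qed.

Let tBu t : `|t - (t - u)| `^ (2 * H) = m.
Proof. by rewrite opprB addrC subrK ger0_norm. Qed.

Let gauss1 : gauss_coef 1 = 1 :> R.
Proof. by rewrite /gauss_coef big_ord1 muln0. Qed.

Let gauss2 : gauss_coef 2 = 3 :> R.
Proof. by rewrite /gauss_coef !big_ord_recl big_ord0 /= muln0 add0n !mul1r mulr1. Qed.

(** The second moments of the sum and of the difference of two increments are nonnegative. *)
Lemma lag_cov_le_variance t s : `|lag_cov a u (t - s)| <= m.
Proof.
have h (e : R) : e ^+ 2 = 1 -> 0 <= 2 * m + 2 * e * lag_cov a u (t - s).
  move=> e2; have := fbm_increments_moment H0 fB 1 1 e t (t - u) s (s - u).
  rewrite gauss1 increment_covE !tBu expr1 expr1n e2 !mul1r mulr1 => h.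
  rewrite -lee_fin (_ : 2 * m + _ = m + m + 2 * e * lag_cov a u (t - s)); last by ring.
  rewrite -h; apply: integral_ge0 => w _.
  by rewrite lee_fin exprM exprn_ge0 ?sqr_ge0.
have h1 := h 1 (expr1n _ _).
have h2 := h (-1) (etrans (sqrrN 1) (expr1n _ _)).
by rewrite ler_norml; apply/andP; split; lra.
Qed.

Let E4 (al be : R) t s : (\int[P]_w ((al * Inc t w + be * Inc s w) ^+ 4)%:E =
  (3 * (al ^+ 2 * m + be ^+ 2 * m + 2 * al * be * lag_cov a u (t - s)) ^+ 2)%:E)%E.
Proof.
have := fbm_increments_moment H0 fB 2 al be t (t - u) s (s - u).
by rewrite gauss2 increment_covE !tBu.
Qed.

Let comb4 (al be : R) t s : P.-integrable setT (fun w => ((al * Inc t w + be * Inc s w) ^+ 4)%:E).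
Proof.
apply/integrableP; split.
  apply/measurable_EFinP/measurable_funX.
  by apply: measurable_funD; apply: measurable_funM.
under eq_integral do rewrite gee0_abs ?lee_fin ?exprn_even_ge0//.
by rewrite E4 ltry.
Qed.

Let E2 t : (\int[P]_w (Inc t w ^+ 2)%:E = m%:E)%E.
Proof.
have := fbm_increment_moment H0 fB 1 t (t - u).
by rewrite gauss1 tBu mul1r expr1.
Qed.

Let i2 t : P.-integrable setT (fun w => (Inc t w ^+ 2)%:E).
Proof.
apply/integrableP; split; first exact/measurable_EFinP/measurable_funX.
by under eq_integral do rewrite gee0_abs ?lee_fin ?sqr_ge0//; rewrite E2 ltry.
Qed.

Let polarize t s w : Inc t w ^+ 2 * Inc s w ^+ 2 =
  12^-1 * ((1 * Inc t w + 1 * Inc s w) ^+ 4 + (1 * Inc t w + (-1) * Inc s w) ^+ 4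
    - 2 * (1 * Inc t w + 0 * Inc s w) ^+ 4 - 2 * (0 * Inc t w + 1 * Inc s w) ^+ 4).
Proof. by field. Qed.

Let i22 t s : P.-integrable setT (fun w => (Inc t w ^+ 2 * Inc s w ^+ 2)%:E).
Proof.
have -> : (fun w => (Inc t w ^+ 2 * Inc s w ^+ 2)%:E) = (fun w => (12^-1)%:E *
  (((1 * Inc t w + 1 * Inc s w) ^+ 4)%:E + ((1 * Inc t w + (-1) * Inc s w) ^+ 4)%:E
    - 2%:E * ((1 * Inc t w + 0 * Inc s w) ^+ 4)%:E
    - 2%:E * ((0 * Inc t w + 1 * Inc s w) ^+ 4)%:E))%E.
  by apply/funext => w; rewrite polarize.
apply: integrableZl => //; apply: integrableB => //; last exact: integrableZl.
by apply: integrableB => //; [exact: integrableD|exact: integrableZl].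
Qed.

(* Polarization: x^2 y^2 is a combination of fourth powers of x + y, x - y, x
   and y, whose Gaussian moments are explicit. *)
Let E22 t s : (\int[P]_w (Inc t w ^+ 2 * Inc s w ^+ 2)%:E =
  (m ^+ 2 + 2 * lag_cov a u (t - s) ^+ 2)%:E)%E.
Proof.
transitivity (\int[P]_w ((12^-1)%:E *
  (((1 * Inc t w + 1 * Inc s w) ^+ 4)%:E + ((1 * Inc t w + (-1) * Inc s w) ^+ 4)%:E
    - 2%:E * ((1 * Inc t w + 0 * Inc s w) ^+ 4)%:E
    - 2%:E * ((0 * Inc t w + 1 * Inc s w) ^+ 4)%:E)))%E.
  by apply: eq_integral => w _; rewrite polarize.
have j1 := comb4 1 1 t s; have j2 := comb4 1 (-1) t s.
have j3 : P.-integrable setT (fun w => 2%:E * ((1 * Inc t w + 0 * Inc s w) ^+ 4)%:E)%E by exact: integrableZl.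
have j4 : P.-integrable setT (fun w => 2%:E * ((0 * Inc t w + 1 * Inc s w) ^+ 4)%:E)%E by exact: integrableZl.
have j5 := integrableD measurableT j1 j2.
have j6 := integrableB measurableT j5 j3.
have j7 := integrableB measurableT j6 j4.
rewrite integralZl// integralB// integralB// integralD//.
rewrite !integralZl// !E4.
set K := lag_cov _ _ _.
pose x (al be : R) := 3 * (al ^+ 2 * m + be ^+ 2 * m + 2 * al * be * K) ^+ 2.
rewrite -[LHS]/((12^-1 * (x 1 1 + x 1 (-1) - 2 * x 1 0 - 2 * x 0 1))%:E).
by congr EFin; rewrite /x; field.
Qed.

Let Dev t w := Inc t w ^+ 2 - m.

Let iDD t s : P.-integrable setT (fun w => (Dev t w * Dev s w)%:E).
Proof.
have -> : (fun w => (Dev t w * Dev s w)%:E) = (fun w =>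
  (Inc t w ^+ 2 * Inc s w ^+ 2)%:E - m%:E * (Inc t w ^+ 2)%:E
    - m%:E * (Inc s w ^+ 2)%:E + (m ^+ 2)%:E)%E.
  by apply/funext => w; rewrite -!EFinM -!EFinB -!EFinD /Dev; congr EFin; ring.
apply: integrableD => //; last exact: finite_measure_integrable_cst.
by apply: integrableB => //; [apply: integrableB => //|]; exact: integrableZl.
Qed.

Let EDD t s : (\int[P]_w (Dev t w * Dev s w)%:E =
  (2 * lag_cov a u (t - s) ^+ 2)%:E)%E.
Proof.
transitivity (\int[P]_w ((Inc t w ^+ 2 * Inc s w ^+ 2)%:E - m%:E * (Inc t w ^+ 2)%:E
    - m%:E * (Inc s w ^+ 2)%:E + (m ^+ 2)%:E))%E.
  by apply: eq_integral => w _; rewrite -!EFinM -!EFinB -!EFinD /Dev; congr EFin; ring.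
have j1 := i22 t s.
have j2 : P.-integrable setT (fun w => m%:E * (Inc t w ^+ 2)%:E)%E by exact: integrableZl.
have j3 : P.-integrable setT (fun w => m%:E * (Inc s w ^+ 2)%:E)%E by exact: integrableZl.
have j4 : P.-integrable setT (fun=> (m ^+ 2)%:E) by exact: finite_measure_integrable_cst.
have j5 := integrableB measurableT j1 j2.
have j6 := integrableB measurableT j5 j3.
rewrite integralD// integralB// integralB// !integralZl// E22 !E2 integral_cst//=.
rewrite probability_setT mule1; set K := lag_cov _ _ _.
rewrite -[LHS]/((m ^+ 2 + 2 * K ^+ 2 - m * m - m * m + m ^+ 2)%:E).
by congr EFin; ring.
Qed.

(** Two centered squares have covariance [2 * lag_cov ^+ 2]. It is nonnegative, so weights in
    [[0, 1]], later the indicators of admissible lags, can only lower the double sum. *)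
Lemma weighted_square_variance N (c t : 'I_N -> R) (C : R) :
  (forall k, 0 <= c k <= 1) ->
  \sum_(k < N) \sum_(l < N) lag_cov a u (t k - t l) ^+ 2 <= C ->
  (\int[P]_w ((\sum_(k < N) c k * (Inc (t k) w ^+ 2 - m)) ^+ 2)%:E <= (2 * C)%:E)%E.
Proof.
move=> c01 hC.
have j k l : P.-integrable setT
    (fun w => (c k * c l)%:E * (Dev (t k) w * Dev (t l) w)%:E)%E by exact: integrableZl.
have -> : (\int[P]_w ((\sum_(k < N) c k * (Inc (t k) w ^+ 2 - m)) ^+ 2)%:E =
    \int[P]_w \sum_(k < N) \sum_(l < N) (c k * c l)%:E * (Dev (t k) w * Dev (t l) w)%:E)%E.
  apply: eq_integral => w _; rewrite expr2 big_distrlr/= -sumEFin.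
  apply: eq_bigr => k _; rewrite -sumEFin; apply: eq_bigr => l _.
  by rewrite -EFinM; congr EFin; rewrite /Dev; ring.
rewrite integral_sum//; last by move=> k; exact: integrable_sum.
under eq_bigr => k _.
  rewrite integral_sum//.
  under eq_bigr do rewrite integralZl// EDD -EFinM.
  rewrite sumEFin; over.
rewrite sumEFin lee_fin (le_trans _ (ler_wpM2l (ler0n _ 2) hC))//.
rewrite big_distrr /=; apply: ler_sum => k _; rewrite big_distrr /=; apply: ler_sum => l _.
have /andP[k0 k1] := c01 k; have /andP[l0 l1] := c01 l.
have K0 : 0 <= 2 * lag_cov a u (t k - t l) ^+ 2 by apply: mulr_ge0 => //; exact: sqr_ge0.
by rewrite ler_piMl// mulr_ile1.
Qed.

End quadratic_variation_variance.

(** * Squared increments sampled at unit steps *)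

Section sampled_energy.
Context {R : realType} (d : measure_display) (Omega : measurableType d)
  (P : probability Omega R).
Variables (H : R) (B : R -> {RV P >-> R}).
Hypotheses (H01 : 0 < H < 1) (fB : fractional_brownian_motion H B).

(* The indicator discards the lags that reach back before time 0. *)
Definition sampled_energy (b : R -> R) (N : nat) (r u : R) : R :=
  \sum_(k < N) (u <= k%:R + r)%R%:R *
    (b (k%:R + r) - b (k%:R + r - u)) ^+ 2.

(** Only indices [k < u] can contribute: the last term vanishes once [u <= N], and otherwise the
    number of terms is itself below [u + 1]. *)
Lemma missing_terms_le (N : nat) (r u : R) : 0 <= r -> 0 <= u ->
  \sum_(k < N) (1 - (u <= k%:R + r)%R%:R) <= u + 1.
Proof.
move=> r0 u0.
have h01 (e : bool) : 0 <= 1 - e%:R :> R /\ 1 - e%:R <= 1 :> R.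
  by case: e; split; rewrite /= ?subrr ?subr0.
have hN M : \sum_(k < M) (1 - (u <= k%:R + r)%R%:R) <= M%:R :> R.
  rewrite -[leRHS]mulr1 mulr_natl -[X in _ *+ X]card_ord -sumr_const.
  by apply: ler_sum => k _; have [] := h01 (u <= k%:R + r).
elim: N => [|N IHN]; first by rewrite big_ord0 addr_ge0.
have [uN|Nu] := leP u N%:R.
  rewrite big_ord_recr /= (le_trans uN) ?lerDl//=.
  by rewrite subrr addr0.
by rewrite (le_trans (hN _))// -natr1 lerD2r ltW.
Qed.

(** The deviation is a centered sum minus the bias [m * D] of the discarded lags. With
    [m <= (1 + u) ^+ 2] and [D <= u + 1] the squared bias is at most [(1 + u) ^+ 6], a polynomial
    that the exponential weight integrates. *)
Lemma sampled_energy_variance (g : R) (N : nat) (r u : R) :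
  0 < g <= 2^-1 -> g <= 4 - 4 * H -> 0 <= r -> 0 <= u -> (0 < N)%N ->
  (\int[P]_w ((sampled_energy (fun t => B t w) N r u - N%:R * u `^ (2 * H)) ^+ 2)%:E
   <= (20 * lag_const * (1 + u) ^+ 6 * N%:R `^ (2 - g))%:E)%E.
Proof.
move=> g02 gH r0 u0 N0; have /andP[H0 H1] := H01; have /andP[g0 g2] := g02.
have a02 : 0 < 2 * H < 2 by apply/andP; split; lra.
set m := u `^ (2 * H).
pose c (k : 'I_N) : R := (u <= k%:R + r)%R%:R.
pose t (k : 'I_N) : R := k%:R + r.
have c01 k : 0 <= c k <= 1.
  by rewrite /c; case: (u <= _)%R; rewrite /= ?lexx ?ler01.
have N1 : 1 <= N%:R :> R by rewrite ler1n.
pose f (j : nat) : R := lag_const * (1 + u ^+ 2) ^+ 2 * j.+1%:R `^ (- g).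
have L1 := @lag_const_ge1 R.
have L0 : 0 <= lag_const :> R by exact: le_trans L1.
have f0 j : 0 <= f j by rewrite mulr_ge0 ?powR_ge0// mulr_ge0 ?sqr_ge0.
have u2 := sqr_ge0 u.
have sumK : \sum_(k < N) \sum_(l < N) lag_cov (2 * H) u (t k - t l) ^+ 2 <=
    4 * lag_const * (1 + u ^+ 2) ^+ 2 * N%:R `^ (2 - g).
  apply: (@le_trans _ _ (\sum_(k < N) \sum_(l < N) f (maxn k l - minn k l)%N)).
    apply: ler_sum => k _; apply: ler_sum => l _.
    have -> : lag_cov (2 * H) u (t k - t l) = lag_cov (2 * H) u (maxn k l - minn k l)%:R.
      have -> : t k - t l = k%:R - l%:R by rewrite /t; ring.
      have [kl|lk] := leqP k l.
        by rewrite natrB// -(lag_covN H) opprB.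
      by rewrite natrB// ltnW.
    apply: lag_cov_sqr_le => //; first by lra.
    by have := lag_cov_le_variance H01 fB u0 (maxn k l - minn k l)%:R 0; rewrite subr0.
  apply: (le_trans (double_sum_lag_le N f0)).
  rewrite /f -big_distrr /=.
  have s := sum_inv_powR_le N g02.
  have C0 : 0 <= 2 * N%:R * (lag_const * (1 + u ^+ 2) ^+ 2) :> R by rewrite mulr_ge0// mulr_ge0 ?sqr_ge0.
  rewrite mulrA; apply: (le_trans (ler_wpM2l C0 s)).
  have -> : N%:R `^ (2 - g) = N%:R * N%:R `^ (1 - g) :> R.
    rewrite -{2}(@powRr1 _ N%:R)// -powRD; last by apply/implyP => _; rewrite pnatr_eq0 -lt0n.
    by congr (_ `^ _); ring.
  by rewrite le_eqVlt; apply/orP; left; apply/eqP; ring.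
have V := weighted_square_variance H01 fB u0 c01 sumK.
pose X w := \sum_(k < N) c k * ((B (t k) w - B (t k - u) w) ^+ 2 - m).
pose D := \sum_(k < N) (1 - c k).
have D0 : 0 <= D by apply: sumr_ge0 => k _; have /andP[_] := c01 k; rewrite subr_ge0.
have Du : D <= u + 1 by exact: missing_terms_le.
have m0 : 0 <= m by exact: powR_ge0.
have SE w : sampled_energy (fun t => B t w) N r u - N%:R * m = X w - m * D.
  have -> : N%:R * m = \sum_(k < N) m by rewrite sumr_const card_ord mulr_natl.
  rewrite /X /D /sampled_energy mulr_sumr -!sumrB; apply: eq_bigr => k _.
  by rewrite /c /t; ring.
have mX : measurable_fun setT X.
  apply: measurable_sum => k; apply: measurable_funM => //.
  apply: measurable_funB => //; apply: measurable_funX.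
  by apply: measurable_funB; exact: measurable_funPT.
apply: (@le_trans _ _ (\int[P]_w (2%:E * (X w ^+ 2)%:E + (2 * (m * D) ^+ 2)%:E))%E).
  apply: ge0_le_integral => //.
  - by move=> w _; rewrite lee_fin sqr_ge0.
  - apply/measurable_EFinP/measurable_funX.
    under eq_fun do rewrite SE.
    by apply: measurable_funB.
  - apply: emeasurable_funD => //; apply: emeasurable_funM => //.
    exact/measurable_EFinP/measurable_funX.
  - move=> w _; rewrite -EFinM -EFinD lee_fin SE.
    by have := sqr_ge0 (X w + m * D); nra.
rewrite ge0_integralD//; last 3 first.
- by move=> w _; rewrite mule_ge0// lee_fin sqr_ge0.
- by apply: emeasurable_funM => //; exact/measurable_EFinP/measurable_funX.
- by move=> w _; rewrite lee_fin mulr_ge0 ?sqr_ge0.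
rewrite ge0_integralZl//; last 2 first.
- exact/measurable_EFinP/measurable_funX.
- by move=> w _; rewrite lee_fin sqr_ge0.
rewrite integral_cst//= probability_setT mule1.
apply: (@le_trans _ _ (2%:E * (2 * (4 * lag_const * (1 + u ^+ 2) ^+ 2 * N%:R `^ (2 - g)))%:E
   + (2 * (m * D) ^+ 2)%:E)%E).
  by rewrite leeD2r// lee_wpmul2l.
rewrite -EFinM -EFinD lee_fin.
have n1 : 1 <= N%:R `^ (2 - g) :> R.
  rewrite -[leLHS](powRr0 N%:R); apply: ler_powR => //.
  by lra.
have mle : m <= (1 + u) ^+ 2.
  rewrite /m; have [u1|u1] := leP u 1.
    apply: (@le_trans _ _ (1 `^ (2 * H))); first by apply: ge0_ler_powR; rewrite ?nnegrE//; lra.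
    by rewrite powR1; nra.
  apply: (@le_trans _ _ (u `^ 2)); first by apply: ler_powR; lra.
  by rewrite (powR_mulrn 2)//; nra.
have u1 : 1 <= 1 + u by lra.
have e1 : (1 + u ^+ 2) ^+ 2 <= (1 + u) ^+ 6.
  apply: (@le_trans _ _ ((1 + u) ^+ 4)); last by rewrite ler_weXn2l.
  have -> : (1 + u) ^+ 4 = (1 + u) ^+ 2 ^+ 2 by rewrite -exprM.
  rewrite lerXn2r ?nnegrE ?addr_ge0 ?sqr_ge0//.
  by nra.
have e2 : (m * D) ^+ 2 <= (1 + u) ^+ 6.
  have -> : (1 + u) ^+ 6 = (1 + u) ^+ 3 ^+ 2 by rewrite -exprM.
  rewrite lerXn2r ?nnegrE ?mulr_ge0 ?exprn_ge0 ?addr_ge0//.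
  rewrite exprSr; apply: ler_pM => //.
  by rewrite addrC.
have q0 : 0 <= (1 + u) ^+ 6 by rewrite exprn_ge0// addr_ge0.
move: e1 e2 q0 n1; set x := (1 + u ^+ 2) ^+ 2; set y := (m * D) ^+ 2.
set z := (1 + u) ^+ 6; set n := _ `^ (2 - g) => e1 e2 q0 n1.
have h1 : x * n <= z * n by rewrite ler_wpM2r// (le_trans _ n1).
have h2 : z <= z * n by rewrite ler_peMr.
have -> : 2 * (2 * (4 * lag_const * x * n)) = 16 * (lag_const * (x * n)) by ring.
have h3 := ler_wpM2l L0 h1.
have h4 : z * n <= lag_const * (z * n) by rewrite ler_peMl// (le_trans q0).
have -> : 20 * lag_const * z * n = 20 * (lag_const * (z * n)) by ring.
by lra.
Qed.

End sampled_energy.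

(** * Ergodic averages *)

Lemma ctn_comp {R : realType} (f g : R -> R) :
  continuous f -> continuous g -> continuous (fun x => g (f x)).
Proof. by move=> cf cg x; apply: continuous_comp; [exact: cf|exact: cg]. Qed.

Section integral_lemmas.
Context {R : realType} (d : measure_display) (T : measurableType d).

Lemma measurable_ler_nat (f g : T -> R) : measurable_fun setT f ->
  measurable_fun setT g -> measurable_fun setT (fun z => (f z <= g z)%R%:R : R).
Proof.
move=> mf mg; have -> : (fun z => (f z <= g z)%R%:R : R) =
    (fun z => if (f z <= g z)%R then 1 else 0).
  by apply/funext => z; case: ifP.
by apply: measurable_fun_ifT => //; exact: measurable_fun_ler.
Qed.

Lemma le_integral_ge0r (mu : {measure set T -> \bar R}) (D : set T)
    (g h : T -> \bar R) : measurable D -> mu.-integrable D g ->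
  measurable_fun D h -> (forall x, D x -> (0 <= h x)%E) ->
  (forall x, D x -> (g x <= h x)%E) ->
  (\int[mu]_(x in D) g x <= \int[mu]_(x in D) h x)%E.
Proof.
move=> mD ig mh h0 gh.
have [hoo|] := ltP (\int[mu]_(x in D) h x)%E +oo%E; last first.
  by rewrite leye_eq => /eqP ->; rewrite leey.
apply: le_integral => //; last by move=> x /set_mem; exact: gh.
apply/integrableP; split => //; rewrite (eq_integral h)// => x /set_mem Dx.
by rewrite gee0_abs// h0.
Qed.

End integral_lemmas.

(** * The exponential weight on the lags *)

Section exponential_weight.
Context {R : realType}.
Notation mu := (@lebesgue_measure R).
Variable lam : R.
Hypothesis lam0 : 0 < lam.
Implicit Types (u t : R) (f : R -> R).

Definition exp_weight u : R := lam * expR (- (lam * u)).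
Notation w := exp_weight.
Notation D := (`[0, +oo[%classic : set R).

Lemma exp_weight_ge0 u : 0 <= w u.
Proof. by rewrite mulr_ge0 ?expR_ge0// ltW. Qed.

Lemma continuous_exp_weight : continuous w.
Proof. by rewrite /w; ctn. Qed.

Lemma exp_weight_pdfE u : 0 <= u -> exponential_pdf lam u = w u.
Proof. by move=> u0; rewrite exponential_pdfE// mulNr. Qed.

Lemma integrable_exp_weight : mu.-integrable D (EFin \o w).
Proof.
have i : mu.-integrable D (EFin \o exponential_pdf lam).
  exact: (integrableS _ _ _ (integrable_exponential_pdf lam0)).
apply: eq_integrable i => // u; rewrite inE/= in_itv/= andbT => u0.
by rewrite exp_weight_pdfE.
Qed.

Lemma integral_exp_weight : (\int[mu]_(u in D) (w u)%:E = 1)%E.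
Proof.
rewrite -(integral_exponential_pdf lam0) [LHS]integral_mkcond/=.
apply: eq_integral => u _; rewrite patchE; case: ifPn => [|uD].
  by rewrite inE/= in_itv/= andbT => u0; rewrite exp_weight_pdfE.
rewrite lt0_exponential_pdf// ltNge; apply: contra uD => u0.
by rewrite inE/= in_itv/= andbT.
Qed.

End exponential_weight.

Section polynomial_moments.
Context {R : realType}.
Notation mu := (@lebesgue_measure R).
Variable lam : R.
Hypothesis lam0 : 0 < lam.
Notation D := (`[0, +oo[%classic : set R).

(** Half of the exponential rate absorbs the polynomial, by [exprn_le_expR] at
    [lam / 2 * (1 + u)]. *)
Lemma exp_weight_poly (n : nat) : exists2 C, 0 <= C & forall u, 0 <= u ->
  exp_weight lam u * (1 + u) ^+ n <= C * exp_weight (lam / 2) u.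
Proof.
pose C := 2 * ((2 / lam) ^+ n * (n%:R ^+ n * expR (lam / 2))).
have l2 : 0 < lam / 2 by rewrite divr_gt0.
have p0 : 0 <= (2 / lam) ^+ n by rewrite exprn_ge0// divr_ge0// ltW.
have C0 : 0 <= C by rewrite mulr_ge0// mulr_ge0// mulr_ge0 ?expR_ge0// exprn_ge0.
exists C => // u u0.
have y0 : 0 <= lam / 2 * (1 + u) by rewrite mulr_ge0 ?addr_ge0// ltW.
have h := exprn_le_expR n y0.
have -> : (1 + u) ^+ n = (2 / lam) ^+ n * (lam / 2 * (1 + u)) ^+ n.
  by rewrite -exprMn; congr (_ ^+ _); field; rewrite gt_eqF.
have -> : C * exp_weight (lam / 2) u = exp_weight lam u *
    ((2 / lam) ^+ n * (n%:R ^+ n * expR (lam / 2 * (1 + u)))).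
  rewrite /C /exp_weight.
  have -> : - (lam / 2 * u) = lam / 2 * u - lam * u by field.
  by rewrite mulrDr mulr1 !expRD; field.
by rewrite ler_wpM2l ?exp_weight_ge0// ler_wpM2l.
Qed.

Lemma integrable_exp_weight_poly (n : nat) :
  mu.-integrable D (fun u => (exp_weight lam u * (1 + u) ^+ n)%:E).
Proof.
have [C C0 hC] := exp_weight_poly n.
have l2 : 0 < lam / 2 by rewrite divr_gt0.
apply: (@le_integrable _ _ _ mu _ (measurable_itv _) _
  (fun u => C%:E * (exp_weight (lam / 2) u)%:E)%E).
- apply/measurable_EFinP; apply: measurable_funTS; apply: continuous_measurable_fun.
  by have := @continuous_exp_weight R lam => ?; ctn.
- move=> u; rewrite /= in_itv/= andbT => u0; rewrite lee_fin !ger0_norm ?hC//.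
    by rewrite mulr_ge0// exp_weight_ge0.
  by rewrite mulr_ge0 ?exprn_ge0 ?exp_weight_ge0// addr_ge0.
- by apply: integrableZl => //; exact: integrable_exp_weight.
Qed.

Lemma integrable_exp_weightM (n : nat) (f : R -> R) (C : R) :
  measurable_fun setT f -> (forall u, 0 <= u -> `|f u| <= C * (1 + u) ^+ n) ->
  mu.-integrable D (fun u => (exp_weight lam u * f u)%:E).
Proof.
move=> mf fC.
apply: (@le_integrable _ _ _ mu _ (measurable_itv _) _
  (fun u => C%:E * (exp_weight lam u * (1 + u) ^+ n)%:E)%E).
- apply/measurable_EFinP; apply: measurable_funTS; apply: measurable_funM => //.
  by apply: continuous_measurable_fun; exact: continuous_exp_weight.
- move=> u; rewrite /= in_itv/= andbT => u0.
  rewrite lee_fin normrM (ger0_norm (exp_weight_ge0 lam0 u)) mulrCA.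
  apply: le_trans (ler_norm _); rewrite ler_wpM2l ?exp_weight_ge0//.
  exact: fC.
- by apply: integrableZl => //; exact: integrable_exp_weight_poly.
Qed.

Lemma powR_le_poly (a u : R) : 0 < a < 2 -> 0 <= u -> u `^ a <= (1 + u) ^+ 2.
Proof.
move=> /andP[a0 a2] u0; have [u1|u1] := leP u 1.
  apply: (@le_trans _ _ (1 `^ a)); first by apply: ge0_ler_powR; rewrite ?nnegrE//; lra.
  by rewrite powR1; nra.
apply: (@le_trans _ _ (u `^ 2)); first by apply: ler_powR; lra.
by rewrite (powR_mulrn 2)//; nra.
Qed.

Lemma integrable_exp_weight_powR (a : R) : 0 < a < 2 ->
  mu.-integrable D (fun u => (exp_weight lam u * u `^ a)%:E).
Proof.
move=> a02; apply: (@integrable_exp_weightM 2 _ 1); first exact: measurable_powR.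
by move=> u u0; rewrite ger0_norm ?powR_ge0// mul1r powR_le_poly.
Qed.

End polynomial_moments.

(** * The time average as a mean over shifts and lags *)

Section energy_jensen.
Context {R : realType}.
Notation mu := (@lebesgue_measure R).
Variables (lam a : R) (b : R -> R) (N : nat).
Hypotheses (lam0 : 0 < lam) (a02 : 0 < a < 2) (cb : continuous b) (N0 : (0 < N)%N).
Implicit Types (u t r : R).
Notation D := (`[0, +oo[%classic : set R).
Notation w := (exp_weight lam).
Notation W1 := (memory_increment lam b).

Definition powR_mean (lam a : R) : R := \int[mu]_(u in D) (exp_weight lam u * u `^ a).

(** Expanding the square separates [t] from [s], which reduces the continuity of an integral with a
    parameter to that of primitives. *)
Lemma memory_incrementE t : W1 t = lam * expR (- (lam * t)) *
  (b t ^+ 2 * prim (fun s => expR (lam * s)) t -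
   2 * b t * prim (fun s => expR (lam * s) * b s) t +
   prim (fun s => expR (lam * s) * b s ^+ 2) t).
Proof.
rewrite -!primZ -?primB -?primD -?primZ; try by ctn.
apply: prim_eq => s _.
have -> : - (lam * (t - s)) = lam * s - lam * t by ring.
by rewrite expRD; ring.
Qed.

Lemma continuous_memory_increment : continuous W1.
Proof.
have -> : W1 = (fun t => lam * expR (- (lam * t)) *
  (b t ^+ 2 * prim (fun s => expR (lam * s)) t -
   2 * b t * prim (fun s => expR (lam * s) * b s) t +
   prim (fun s => expR (lam * s) * b s ^+ 2) t)).
  by apply/funext => t; exact: memory_incrementE.
by ctn.
Qed.

Let h t u := w u * (b t - b (t - u)) ^+ 2.

Let ch t : continuous (h t).
Proof.
have cbt : continuous (fun u => b (t - u)).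
  by apply: (@ctn_comp _ (fun u => t - u)) => //; ctn.
have cw := @continuous_exp_weight R lam.
by rewrite /h; ctn.
Qed.

Let itvE t : D `&` `]-oo, t]%classic = `[0, t]%classic.
Proof.
apply/seteqP; split => u /=; rewrite !in_itv/= ?andbT.
  by move=> [-> ->].
by move=> /andP[-> ->].
Qed.

Let hE t u : ((u <= t)%R%:R * h t u)%:E = ((EFin \o h t) \_ `]-oo, t]%classic) u.
Proof.
rewrite patchE; case: ifPn; rewrite ?inE ?notin_setE/= in_itv/=.
  by move=> ->; rewrite mul1r.
by move=> /negP/negbTE ->; rewrite mul0r.
Qed.

Let truncated_integrable t : mu.-integrable D (fun u => ((u <= t)%R%:R * h t u)%:E).
Proof.
have -> : (fun u => ((u <= t)%R%:R * h t u)%:E) = (EFin \o h t) \_ `]-oo, t]%classic.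
  by apply/funext => u; exact: hE.
apply/integrable_restrict; [exact: measurable_itv|exact: measurable_itv|].
by rewrite itvE; apply: continuous_integrable; exact: ch.
Qed.

(** The substitution [s = t - u] turns past times into lags; the indicator extends the integral to
    all lags. *)
Let truncated_integral t : 0 <= t ->
  (\int[mu]_(u in D) ((u <= t)%R%:R * h t u)%:E = (W1 t)%:E)%E.
Proof.
move=> t0.
have -> : (fun u => ((u <= t)%R%:R * h t u)%:E) = (EFin \o h t) \_ `]-oo, t]%classic.
  by apply/funext => u; exact: hE.
rewrite -integral_mkcondr itvE /=.
have -> : W1 t = prim (h t) t.
  rewrite /memory_increment -(prim_rev (f := fun s => _))//; last first.
    by ctn.
  by apply: prim_eq => s _; rewrite /h /exp_weight subKr.
rewrite /prim /Rintegral fineK//.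
by apply: integrable_fin_num => //; apply: continuous_integrable; exact: ch.
Qed.

Let S r u := sampled_energy b N r u.

Let wSE r u : (w u * S r u)%:E =
  (\sum_(k < N) ((u <= k%:R + r)%R%:R * h (k%:R + r) u)%:E)%E.
Proof.
rewrite /S /sampled_energy mulr_sumr -sumEFin; apply: eq_bigr => k _.
by rewrite /h; congr EFin; ring.
Qed.

Let wS_integrable r : mu.-integrable D (fun u => (w u * S r u)%:E).
Proof.
have -> : (fun u => (w u * S r u)%:E) =
    (fun u => \sum_(k < N) ((u <= k%:R + r)%R%:R * h (k%:R + r) u)%:E)%E.
  by apply/funext => u; exact: wSE.
by apply: integrable_sum => // k _; exact: truncated_integrable.
Qed.

Let wS_integral r : 0 <= r ->
  (\int[mu]_(u in D) (w u * S r u)%:E = (\sum_(k < N) W1 (k%:R + r))%:E)%E.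
Proof.
move=> r0.
have -> : (fun u => (w u * S r u)%:E) =
    (fun u => \sum_(k < N) ((u <= k%:R + r)%R%:R * h (k%:R + r) u)%:E)%E.
  by apply/funext => u; exact: wSE.
rewrite integral_sum//.
rewrite -sumEFin; apply: eq_bigr => k _; rewrite truncated_integral//.
by rewrite addr_ge0.
Qed.

(** The windows [[k, k + 1]] tile [[0, n]]. *)
Let telescope_aux n : continuous (fun r => \sum_(k < n) W1 (k%:R + r)) /\
  prim (fun r => \sum_(k < n) W1 (k%:R + r)) 1 = prim W1 n%:R.
Proof.
have cW := continuous_memory_increment.
have cWk (k : nat) : continuous (fun r => W1 (k%:R + r)).
  by apply: (@ctn_comp _ (fun r => k%:R + r)) => //; ctn.
elim: n => [|n [cn IHn]].
  have -> : (fun r : R => \sum_(k < 0) W1 (k%:R + r)) = (fun=> 0).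
    by apply/funext => r; rewrite big_ord0.
  by split; [ctn|rewrite prim0 prim_cst ?mul0r].
have -> : (fun r : R => \sum_(k < n.+1) W1 (k%:R + r)) =
    (fun r => \sum_(k < n) W1 (k%:R + r) + W1 (n%:R + r)).
  by apply/funext => r; rewrite big_ord_recr.
split; first exact: ctnD.
by rewrite primD// IHn prim_shift// natr1 addrC subrK.
Qed.

Let telescope : prim (fun r => \sum_(k < N) W1 (k%:R + r)) 1 = prim W1 N%:R.
Proof. by have [] := telescope_aux N. Qed.

Let csum : continuous (fun r => \sum_(k < N) W1 (k%:R + r)).
Proof. by have [] := telescope_aux N. Qed.

Let measurable_S r : measurable_fun setT (S r).
Proof.
apply: measurable_sum => k; apply: measurable_funM.
  by apply: measurable_ler_nat => //.
apply: measurable_funX; apply: measurable_funB => //.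
apply: continuous_measurable_fun.
by apply: (@ctn_comp _ (fun u => k%:R + r - u)) => //; ctn.
Qed.

Definition energy_deviation r : \bar R :=
  (\int[mu]_(u in D) (w u * (S r u / N%:R - u `^ a) ^+ 2)%:E)%E.

Hypothesis measurable_energy_deviation : measurable_fun setT energy_deviation.

(** Under the probability measure [dr] times [w u du] on shifts and lags, the mean of
    [S r u / N - u ^ a] is exactly the deviation on the left. *)
Lemma energy_jensen :
  (((prim W1 N%:R / N%:R - powR_mean lam a) ^+ 2)%:E <=
   \int[mu]_(r in `[0%R, 1%R]) energy_deviation r)%E.
Proof.
set c := powR_mean lam a; set M := prim W1 N%:R / N%:R - c.
have n0 : N%:R != 0 :> R by rewrite pnatr_eq0 -lt0n.
pose G r := \sum_(k < N) W1 (k%:R + r).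
have ia := integrable_exp_weight_powR lam0 a02.
(* Jensen's inequality in tangent form, [y ^+ 2 >= 2 * M * y - M ^+ 2], which
   needs no integrability of the right-hand side. *)
have inner r : 0 <= r -> ((2 * M * (G r / N%:R - c) - M ^+ 2)%:E <= energy_deviation r)%E.
  move=> r0.
  have i1 : mu.-integrable D (fun u => (2 * M / N%:R)%:E * (w u * S r u)%:E)%E.
    by apply: integrableZl.
  have i2 : mu.-integrable D (fun u => (2 * M)%:E * (w u * u `^ a)%:E)%E.
    by apply: integrableZl.
  have i3 : mu.-integrable D (fun u => (M ^+ 2)%:E * (w u)%:E)%E.
    by apply: integrableZl => //; exact: integrable_exp_weight.
  have mD : @measurable _ (measurableTypeR R) D by exact: measurable_itv.
  have i12 := integrableB mD i1 i2.
  have i123 := integrableB mD i12 i3.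
  have <- : (\int[mu]_(u in D) ((2 * M / N%:R)%:E * (w u * S r u)%:E -
      (2 * M)%:E * (w u * u `^ a)%:E - (M ^+ 2)%:E * (w u)%:E) =
      (2 * M * (G r / N%:R - c) - M ^+ 2)%:E)%E.
    rewrite integralB// integralB//.
    rewrite !integralZl//; try exact: integrable_exp_weight.
    rewrite wS_integral// integral_exp_weight// mule1.
    have -> : (\int[mu]_(u in D) (w u * u `^ a)%:E = c%:E)%E.
      by rewrite /c /powR_mean /Rintegral fineK//; exact: (integrable_fin_num _ ia).
    rewrite -/(G r) -[LHS]/((2 * M / N%:R * G r - 2 * M * c - M ^+ 2)%:E).
    by congr EFin; field.
  apply: le_integral_ge0r => //.
  - apply/measurable_EFinP; apply: measurable_funTS; apply: measurable_funM.
      by apply: continuous_measurable_fun; exact: continuous_exp_weight.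
    apply: measurable_funX; apply: measurable_funB; last exact: measurable_powR.
    by apply: measurable_funM => //; exact: measurable_S.
  - by move=> u _; rewrite lee_fin mulr_ge0 ?sqr_ge0 ?exp_weight_ge0.
  - move=> u _; rewrite -!EFinM -!EFinB lee_fin.
    set y := S r u / N%:R - u `^ a.
    have -> : 2 * M / N%:R * (w u * S r u) - 2 * M * (w u * u `^ a) - M ^+ 2 * w u =
        w u * (2 * M * y - M ^+ 2) by rewrite /y; ring.
    rewrite ler_wpM2l ?exp_weight_ge0//.
    by have := sqr_ge0 (y - M); nra.
have cg : continuous (fun r => 2 * M * (G r / N%:R - c) - M ^+ 2).
  by have cG : continuous G := csum; ctn.
have e : (\int[mu]_(r in `[0%R, 1%R]) (2 * M * (G r / N%:R - c) - M ^+ 2)%:E = (M ^+ 2)%:E)%E.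
  have -> : (\int[mu]_(r in `[0%R, 1%R]) (2 * M * (G r / N%:R - c) - M ^+ 2)%:E =
      (prim (fun r => 2 * M * (G r / N%:R - c) - M ^+ 2) 1)%:E)%E.
    rewrite /prim /Rintegral fineK//.
    exact: (integrable_fin_num _ (continuous_integrable _ _ cg)).
  have cG : continuous G := csum.
  congr EFin; rewrite primB; [|by ctn..].
  rewrite primZ; last by ctn.
  rewrite primB; [|by ctn..].
  have -> : prim (fun r => G r / N%:R) 1 = prim W1 N%:R / N%:R.
    under eq_fun do rewrite mulrC.
    by rewrite primZ// telescope mulrC.
  by rewrite !prim_cst// !mulr1 -/M; ring.
rewrite -e; apply: le_integral_ge0r => //.
- exact: continuous_integrable.
- exact: measurable_funTS.
- move=> r _; apply: integral_ge0 => u _.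
  by rewrite lee_fin mulr_ge0 ?sqr_ge0 ?exp_weight_ge0.
- by move=> r; rewrite /= in_itv/= => /andP[r0 _]; exact: inner.
Qed.

End energy_jensen.

(** * Convergence along polynomial times *)

Section ergodic.
Context {R : realType} (d : measure_display) (Omega : measurableType d)
  (P : probability Omega R).
Notation mu := (@lebesgue_measure R).
Variables (H lam : R) (B : R -> {RV P >-> R}) (b : R -> Omega -> R).
Hypotheses (H01 : 0 < H < 1) (lam0 : 0 < lam)
  (fB : fractional_brownian_motion H B).
Hypotheses (cb : forall w, continuous (fun t => b t w))
  (mb : forall t, measurable_fun setT (b t))
  (hb : \forall w \ae P, forall t, b t w = B t w).
Notation D := (`[0, +oo[%classic : set R).
Let a := 2 * H.
Let a02 : 0 < a < 2.
Proof. by have /andP[H0 H1] := H01; rewrite /a; apply/andP; split; lra. Qed.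

(** The variables are nested as [((w, r), u)], so that Tonelli's theorem integrates out the lag and
    then the shift. *)
Let integrand N (z : (Omega * R) * R) : R := exp_weight lam z.2 *
  (sampled_energy (fun t => b t z.1.1) N z.1.2 z.2 / N%:R - z.2 `^ a) ^+ 2.

Let measurable_integrand N : measurable_fun setT (integrand N).
Proof.
have m1 : measurable_fun setT (fun z : (Omega * R) * R => z.1.1).
  by apply: measurableT_comp => //; exact: measurable_fst.
have m2 : measurable_fun setT (fun z : (Omega * R) * R => z.1.2).
  by apply: measurableT_comp => //; exact: measurable_fst.
have m3 : measurable_fun setT (fun z : (Omega * R) * R => z.2) by exact: measurable_snd.
have mB := measurable_caratheodory mb cb.
have mBat (f : (Omega * R) * R -> R) : measurable_fun setT f ->
    measurable_fun setT (fun z => b (f z) z.1.1).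
  move=> mf; have mp : measurable_fun setT (fun z => (z.1.1, f z)).
    exact: measurable_fun_pair.
  exact: (measurableT_comp mB mp).
apply: measurable_funM.
  have me : measurable_fun setT (exp_weight lam).
    by apply: continuous_measurable_fun; exact: continuous_exp_weight.
  exact: (measurableT_comp me m3).
apply: measurable_funX; apply: measurable_funB; last first.
  exact: (measurableT_comp (measurable_powR a) m3).
apply: measurable_funM => //; apply: measurable_sum => k.
have mt : measurable_fun setT (fun z : (Omega * R) * R => k%:R + z.1.2).
  exact: measurable_funD.
apply: measurable_funM; first exact: measurable_ler_nat.
apply: measurable_funX; apply: measurable_funB; apply: mBat => //.
exact: measurable_funB.
Qed.

Let integrand_ge0 N z : 0 <= integrand N z.
Proof. by rewrite mulr_ge0 ?sqr_ge0 ?exp_weight_ge0. Qed.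

Let F N (z : (Omega * R) * R) : \bar R :=
  if z.2 \in D then (integrand N z)%:E else 0%E.

Let F_ge0 N z : (0 <= F N z)%E.
Proof. by rewrite /F; case: ifP => // _; rewrite lee_fin. Qed.

Let measurable_F N : measurable_fun setT (F N).
Proof.
have -> : F N = (EFin \o integrand N) \_ (snd @^-1` D).
  by apply/funext => z; rewrite patchE /F; congr (if _ then _ else _); apply/idP/idP; rewrite !inE.
apply/(measurable_restrictT _ _).1; last exact/measurable_funTS/measurable_EFinP.
rewrite -[X in measurable X]setTI; apply: measurable_snd => //.
Qed.

Let deviation N (y : Omega * R) : \bar R := (\int[mu]_u F N (y, u))%E.

Let deviationE N w r :
  deviation N (w, r) = energy_deviation lam a (fun t => b t w) N r.
Proof.
rewrite /deviation /energy_deviation [RHS]integral_mkcond.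
by apply: eq_integral => u _; rewrite patchE.
Qed.

Let measurable_deviation N : measurable_fun setT (deviation N).
Proof. exact: (measurable_fun_fubini_tonelli_F (m2 := mu) (F N) (measurable_F N) (F_ge0 N)). Qed.

Let deviation_ge0 N y : (0 <= deviation N y)%E.
Proof. by apply: integral_ge0 => u _. Qed.

Let deviation01 N (y : Omega * R) : \bar R :=
  if y.2 \in (`[0, 1]%classic : set R) then deviation N y else 0%E.

Let measurable_deviation01 N : measurable_fun setT (deviation01 N).
Proof.
have -> : deviation01 N = (deviation N) \_ (snd @^-1` `[0, 1]%classic).
  by apply/funext => z; rewrite patchE /deviation01; congr (if _ then _ else _); apply/idP/idP; rewrite !inE.
apply/(measurable_restrictT _ _).1; last exact: measurable_funTS.
rewrite -[X in measurable X]setTI; apply: measurable_snd => //.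
Qed.

Let deviation01_ge0 N y : (0 <= deviation01 N y)%E.
Proof. by rewrite /deviation01; case: ifP. Qed.

Let Q N w : \bar R := (\int[mu]_r deviation01 N (w, r))%E.

Let QE N w : Q N w =
  (\int[mu]_(r in `[0%R, 1%R]) energy_deviation lam a (fun t => b t w) N r)%E.
Proof.
rewrite /Q [RHS]integral_mkcond; apply: eq_integral => r _.
by rewrite patchE /deviation01 deviationE.
Qed.

Let measurable_Q N : measurable_fun setT (Q N).
Proof. exact: (measurable_fun_fubini_tonelli_F (m2 := mu) (deviation01 N) (measurable_deviation01 N) (deviation01_ge0 N)). Qed.

Let Q_ge0 N w : (0 <= Q N w)%E.
Proof. by apply: integral_ge0 => r _. Qed.

Variable g : R.
Hypotheses (g02 : 0 < g <= 2^-1) (gH : g <= 4 - 4 * H).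

Let expectation_integrand N r u : (0 < N)%N -> 0 <= r -> 0 <= u ->
  (\int[P]_w (integrand N ((w, r), u))%:E <=
   (20 * lag_const * N%:R `^ (- g))%:E * (exp_weight lam u * (1 + u) ^+ 6)%:E)%E.
Proof.
move=> N0 r0 u0.
have n0 : 0 < N%:R :> R by rewrite ltr0n.
(* The modification [b] provides joint measurability and [B] provides the moments; they agree almost
   surely, so they have the same expectations. *)
have -> : (\int[P]_w (integrand N ((w, r), u))%:E =
    (exp_weight lam u / N%:R ^+ 2)%:E *
    \int[P]_w ((sampled_energy (fun t => B t w) N r u - N%:R * u `^ a) ^+ 2)%:E)%E.
  rewrite -ge0_integralZl//; last 3 first.
  - apply/measurable_EFinP/measurable_funX/measurable_funB => //.
    apply: measurable_sum => k; apply: measurable_funM => //.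
    by apply: measurable_funX; apply: measurable_funB; exact: measurable_funPT.
  - by move=> w _; rewrite lee_fin sqr_ge0.
  - by rewrite lee_fin divr_ge0 ?exp_weight_ge0.
  apply: ge0_ae_eq_integral => //.
  - apply/measurable_EFinP.
    by apply: (measurableT_comp (measurable_integrand N) (g := fun w => ((w, r), u))); exact: measurable_fun_pair.
  - apply: emeasurable_funM => //.
    apply/measurable_EFinP/measurable_funX/measurable_funB => //.
    apply: measurable_sum => k; apply: measurable_funM => //.
    by apply: measurable_funX; apply: measurable_funB; exact: measurable_funPT.
  - by move=> w _; rewrite lee_fin.
  - by move=> w _; rewrite mule_ge0// lee_fin ?sqr_ge0// divr_ge0 ?exp_weight_ge0.
  - apply: filterS hb => w hw _; rewrite -EFinM; congr EFin; rewrite /integrand /=.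
    have -> : (fun t => b t w) = (fun t => B t w) by apply/funext.
    by field; rewrite gt_eqF.
have h := sampled_energy_variance H01 fB g02 gH r0 u0 N0.
apply: (le_trans (lee_wpmul2l _ h)); first by rewrite lee_fin divr_ge0 ?exp_weight_ge0.
rewrite -!EFinM lee_fin.
have -> : N%:R `^ (2 - g) = N%:R ^+ 2 * N%:R `^ (- g) :> R.
  rewrite -powR_mulrn ?ltW// -powRD//.
  by apply/implyP => _; rewrite gt_eqF.
by rewrite le_eqVlt; apply/orP; left; apply/eqP; field; rewrite gt_eqF.
Qed.

Let C6 := \int[mu]_(u in D) (exp_weight lam u * (1 + u) ^+ 6).

(** Tonelli's theorem, used twice, brings the expectation inside, to a fixed shift and a fixed lag,
    where [sampled_energy_variance] applies; [C6] is the weighted integral of its polynomial. *)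
Let expectation_Q N : (0 < N)%N ->
  (\int[P]_w Q N w <= (20 * lag_const * C6 * N%:R `^ (- g))%:E)%E.
Proof.
move=> N0.
have i6 := integrable_exp_weight_poly lam0 6.
rewrite /Q (fubini_tonelli (m1 := P) (m2 := mu) (deviation01 N) (measurable_deviation01 N) (deviation01_ge0 N)).
set A := 20 * lag_const * C6 * N%:R `^ (- g).
have A0 : 0 <= A.
  rewrite mulr_ge0 ?powR_ge0// mulr_ge0//.
    by rewrite mulr_ge0// (le_trans _ (@lag_const_ge1 R)).
  apply: Rintegral_ge0 => u /=; rewrite in_itv/= andbT => u0.
  by rewrite mulr_ge0 ?exp_weight_ge0// exprn_ge0// addr_ge0.
apply: (@le_trans _ _ (\int[mu]_(r in `[0%R, 1%R]) A%:E)%E); last first.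
  rewrite integral_cst//=.
  by rewrite lebesgue_measure_itv/= lte01 oppr0 adde0 mule1.
rewrite [leRHS]integral_mkcond; apply: ge0_le_integral => //.
- by move=> r _; apply: integral_ge0 => w _.
- exact: (measurable_fun_fubini_tonelli_G (m1 := P) (deviation01 N)).
- apply/(measurable_restrictT _ _).1; first exact: measurable_itv.
  exact: measurable_cst.
move=> r _; rewrite patchE /deviation01 /=.
case: (boolP (r \in _)) => [|_]; last by rewrite integral0.
rewrite inE/= in_itv/= => /andP[r0 _].
rewrite /deviation (fubini_tonelli (m1 := P) (m2 := mu) (fun z => F N ((z.1, r), z.2)))//; last first.
  have mp : measurable_fun setT (fun z : Omega * R => ((z.1, r), z.2)).
    by apply: measurable_fun_pair => //; apply: measurable_fun_pair.
  exact: (measurableT_comp (measurable_F N) mp).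
apply: (@le_trans _ _ (\int[mu]_(u in D) ((20 * lag_const * N%:R `^ (- g))%:E *
    (exp_weight lam u * (1 + u) ^+ 6)%:E))%E).
  rewrite [leRHS]integral_mkcond; apply: ge0_le_integral => //.
  - by move=> u _; apply: integral_ge0 => w _.
  - have mp : measurable_fun setT (fun z : Omega * R => ((z.1, r), z.2)).
      by apply: measurable_fun_pair => //; apply: measurable_fun_pair.
    exact: (measurable_fun_fubini_tonelli_G (m1 := P) (fun z => F N ((z.1, r), z.2)) (measurableT_comp (measurable_F N) mp) (fun z => F_ge0 N _)).
  - apply/(measurable_restrictT _ _).1; first exact: measurable_itv.
    apply: emeasurable_funM => //; exact: measurable_int i6.
  - move=> u _; rewrite patchE /F /=; case: ifPn => uD; last by rewrite integral0.
    by apply: expectation_integrand => //; move: uD; rewrite inE/= in_itv/= andbT.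
rewrite integralZl//.
have -> : (\int[mu]_(u in D) (exp_weight lam u * (1 + u) ^+ 6)%:E = C6%:E)%E.
  by rewrite /C6 /Rintegral fineK//; apply: integrable_fin_num.
by rewrite -EFinM lee_fin /A le_eqVlt; apply/orP; left; apply/eqP; ring.
Qed.

Let sum_inv_sqr_le n : \sum_(k < n) (k.+1%:R ^+ 2)^-1 <= 2 :> R.
Proof.
case: n => [|n]; first by rewrite big_ord0.
apply: (@le_trans _ _ (2 - n.+1%:R^-1)); last by rewrite lerBlDr lerDl invr_ge0.
elim: n => [|n IHn]; first by rewrite big_ord1 expr1n invr1; lra.
rewrite big_ord_recr /= (le_trans (lerD IHn (lexx _)))//.
have p1 : 0 < n.+1%:R :> R by [].
rewrite -[n.+2%:R]natr1; move: p1; set x := n.+1%:R => x0.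
rewrite -subr_ge0.
have -> : 2 - (x + 1)^-1 - (2 - x^-1 + ((x + 1) ^+ 2)^-1) = (x * (x + 1) ^+ 2)^-1.
  by field; rewrite !gt_eqF// addr_gt0.
by rewrite invr_ge0 mulr_ge0 ?sqr_ge0// ltW.
Qed.

Lemma bounded_series_cvg0 (q : nat -> R) (M : R) : (forall n, 0 <= q n) ->
  (forall n, \sum_(k < n) q k <= M) -> q n @[n --> \oo] --> (0 : R).
Proof.
move=> q0 qM; apply: cvg_series_cvg_0; apply: nondecreasing_is_cvgn.
  by apply/nondecreasing_seqP => n; rewrite /series /= big_nat_recr//= lerDl.
by exists M => _ [n _ <-]; rewrite /series /= big_mkord.
Qed.

Lemma energy_ergodic : exists K, (0 < K)%N /\ \forall w \ae P,
  prim (memory_increment lam (fun t => B t w)) (n%:R ^+ K) / n%:R ^+ K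
    @[n --> \oo] --> powR_mean lam a.
Proof.
have /andP[g0 _] := g02.
(* The mean square deviation at time N is O(N^-g), hence summable along
   N = n^K as soon as K g >= 2. *)
pose K := (Num.truncn (2 / g)).+1.
have Kg : 2 <= K%:R * g.
  rewrite -ler_pdivrMr//; apply/ltW.
  by have /andP[] := @truncn_itv _ (2 / g) (divr_ge0 (ler0n _ 2) (ltW g0)).
exists K; split => //.
(* Starting from 1 keeps the horizon positive; the shift is undone at the end by [cvg_shiftS]. *)
pose N n := (n.+1 ^ K)%N.
have N0 n : (0 < N n)%N by rewrite expn_gt0.
pose A := 20 * lag_const * C6.
have A0 : 0 <= A.
  rewrite mulr_ge0//.
    by rewrite mulr_ge0// (le_trans _ (@lag_const_ge1 R)).
  apply: Rintegral_ge0 => u /=; rewrite in_itv/= andbT => u0.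
  by rewrite mulr_ge0 ?exp_weight_ge0// exprn_ge0// addr_ge0.
have EQ n : (\int[P]_w Q (N n) w <= (A * (n.+1%:R ^+ 2)^-1)%:E)%E.
  apply: (le_trans (expectation_Q (N0 n))); rewrite lee_fin ler_wpM2l//.
  rewrite /N natrX -powR_mulrn// -powRrM -powR_mulrn// -powRN.
  by apply: ler_powR; [rewrite ler1n|rewrite mulrN lerN2].
have sumA n : \sum_(k < n) A * (k.+1%:R ^+ 2)^-1 <= A * 2.
  by rewrite -mulr_sumr ler_wpM2l.
have := ae_summable_ereal (fun n => measurable_Q (N n)) (fun n w => Q_ge0 (N n) w) EQ sumA.
apply: filter_app; apply: filterS hb => w hw [M hM].
have -> : (fun t => B t w) = (fun t => b t w) by apply/funext => t; rewrite hw.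
have QM n : (Q (N n) w <= M%:E)%E.
  apply: le_trans (hM n.+1); rewrite big_ord_recr /=.
  by apply: leeDr; exact: sume_ge0.
have Qfin n : Q (N n) w \is a fin_num.
  by rewrite ge0_fin_numE// (le_lt_trans (QM n)) ?ltry.
have q0 : fine (Q (N n) w) @[n --> \oo] --> (0 : R).
  apply: (@bounded_series_cvg0 _ M) => n; first exact: fine_ge0.
  rewrite -lee_fin -sumEFin (le_trans _ (hM n))//.
  by apply: lee_sum => k _; rewrite fineK.
pose y (n : nat) := prim (memory_increment lam (fun t => b t w)) (n%:R ^+ K) / n%:R ^+ K.
have h : (y n.+1 - powR_mean lam a) ^+ 2 @[n --> \oo] --> (0 : R).
  apply: (@squeeze_cvgr _ _ _ _ (fun=> 0) (fun n => fine (Q (N n) w))) => //; last exact: cvg_cst.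
  apply: nearW => n; rewrite sqr_ge0 /= -lee_fin fineK// QE.
  have cbw : continuous (fun t => b t w) by exact: cb.
  have := @energy_jensen R lam a (fun t => b t w) (N n) lam0 a02 cbw (N0 n).
  rewrite /y /N natrX; apply.
  have mw : measurable_fun setT (fun r : R => (w, r)) by exact: measurable_fun_pair.
  have := measurableT_comp (measurable_deviation (n.+1 ^ K)) mw.
  by apply: eq_measurable_fun => r _; rewrite /= deviationE.
rewrite -(cvg_shiftS y); apply/subr_cvg0; apply: norm_cvg0.
have -> : (fun n => `|y n.+1 - powR_mean lam a|) =
    (fun n => Num.sqrt ((y n.+1 - powR_mean lam a) ^+ 2)).
  by apply/funext => n; rewrite sqrtr_sqr.
rewrite -[X in _ --> X](sqrtr0 R).
by apply: (@continuous_cvg _ _ _ _ _ _ Num.sqrt) => //; exact: sqrt_continuous.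
Qed.

End ergodic.

(** * The Gamma function as a moment *)

Section gamma_moment.
Context {R : realType}.
Notation mu := (@lebesgue_measure R).
Implicit Types a x e b u lam : R.

Lemma continuous_powR_gt0 a x : 0 < x -> {for x, continuous (fun u : R => u `^ a)}.
Proof.
move=> x0; apply: differentiable_continuous; apply/derivable1_diffP.
by apply: derivable_powR; rewrite in_itv/= x0.
Qed.

(** Parts are taken on [[e, b]] with [e > 0], because [u ^ (a - 1)] is singular at 0 when
    [a < 1]. *)
Lemma powR_exp_parts a e b : 0 < e -> e < b ->
  (\int[mu]_(u in `[e, b]) (expR (- u) * (a * u `^ (a - 1)))%:E =
   (expR (- b) * b `^ a - expR (- e) * e `^ a)%:E +
   \int[mu]_(u in `[e, b]) (expR (- u) * u `^ a)%:E)%E.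
Proof.
move=> e0 eb.
have gt0 u : u \in `[e, b] -> 0 < u.
  by rewrite in_itv/= => /andP[eu _]; exact: lt_le_trans eu.
have gt0o u : u \in `]e, b[ -> 0 < u.
  by move=> /subset_itv_oo_cc/gt0.
have cE : continuous (fun u : R => expR (- u)) by ctn.
have cN : continuous (fun u : R => - expR (- u)) by ctn.
have dE u : is_derive u 1 (fun u : R => expR (- u)) (- expR (- u)).
  by apply: is_derive_eq; rewrite /GRing.scale /= mulrN1.
have e_b : (e \in `[e, b]) && (b \in `[e, b]).
  by rewrite !in_itv/= !lexx ltW.
have /andP[ee bb] := e_b.
have := @integration_by_parts R (fun u => expR (- u)) (fun u => u `^ a)
  (fun u => - expR (- u)) (fun u => a * u `^ (a - 1)) e b eb.
move=> ->; last first.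
- by move=> u /gt0o u0; rewrite powR_derive1// in_itv/= u0.
- split.
  + by move=> u /gt0o u0; apply: derivable_powR; rewrite in_itv/= u0.
  + by apply: cvg_at_right_filter; apply: continuous_powR_gt0.
  + by apply: cvg_at_left_filter; apply: continuous_powR_gt0; exact: gt0.
- apply: continuous_in_subspaceT => u /set_mem/= /gt0 u0.
  by apply: cvgM; [exact: cvg_cst|exact: continuous_powR_gt0].
- by move=> u _; rewrite derive1E derive_val.
- split.
  + by move=> u _; exact: ex_derive.
  + by apply: cvg_at_right_filter; exact: cE.
  + by apply: cvg_at_left_filter; exact: cE.
- by apply: continuous_subspaceT.
congr (_ + _)%E; have h0 u : `[e, b]%classic u -> (0 <= (expR (- u) * u `^ a)%:E)%E.
  by move=> _; rewrite lee_fin mulr_ge0 ?expR_ge0 ?powR_ge0.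
have := @integral_ge0N _ _ _ mu _ _ h0; rewrite /= => h.
rewrite -[RHS]oppeK -h; congr (- _)%E.
by apply: eq_integral => u _; rewrite mulNr EFinN.
Qed.

Lemma exp_powR_cvg0 a : 0 < a < 2 ->
  expR (- n.+1%:R) * n.+1%:R `^ a @[n --> \oo] --> (0 : R).
Proof.
move=> a02; have [C C0 hC] := @exp_weight_poly R 1 ltr01 2.
apply: (@squeeze_cvgr _ _ _ _ (fun=> 0) (fun n => C * 2^-1 * expR (- (2^-1 * n.+1%:R)))).
- apply: nearW => n; rewrite mulr_ge0 ?expR_ge0 ?powR_ge0//=.
  have := hC n.+1%:R (ler0n _ _); rewrite /exp_weight !mul1r -mulrA => h; apply: le_trans h.
  by rewrite ler_wpM2l ?expR_ge0// powR_le_poly.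
- exact: cvg_cst.
- rewrite -(mulr0 (C * 2^-1)); apply: cvgMr.
  have h : (2^-1 * T : R) @[T --> +oo] --> +oo by apply: gt0_cvgMry => //; exact: cvg_id.
  have h2 : 2^-1 * n.+1%:R @[n --> \oo] --> (+oo : set_system R).
    rewrite (_ : (fun n : nat => _) = (fun x => 2^-1 * x) \o (fun n : nat => n.+1%:R))//.
    apply: (@cvg_comp _ _ _ _ _ _ (pinfty_nbhs R)) => //.
    rewrite (cvg_shiftS (fun n : nat => n%:R : R)); exact: cvgr_idn.
  exact: (@cvg_comp _ _ _ _ (fun x : R => expR (- x)) _ (pinfty_nbhs R) _ h2 (@cvgr_expR R)).
Qed.

Lemma exp_powR_inv_cvg0 a : 0 < a ->
  expR (- n.+1%:R^-1) * n.+1%:R^-1 `^ a @[n --> \oo] --> (0 : R).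
Proof.
move=> a0; apply: (@squeeze_cvgr _ _ _ _ (fun=> 0) (fun n => n.+1%:R^-1 `^ a)).
- apply: nearW => n; rewrite mulr_ge0 ?expR_ge0 ?powR_ge0//=.
  by rewrite ler_piMl ?powR_ge0// -expR0 ler_expR oppr_le0.
- exact: cvg_cst.
- have /cvg_at_rightP := @powR_cvg0 R a a0.
  by move/(_ (fun n : nat => n.+1%:R^-1)); apply; split => //; exact: cvg_harmonic.
Qed.
Let D (n : nat) : set R := `[n.+1%:R^-1, n.+1%:R].

Let nondecreasing_D : nondecreasing_seq D.
Proof.
move=> m n mn; apply/subsetPset => x; rewrite /D /= !in_itv/= => /andP[mx xm].
apply/andP; split; first by apply: le_trans mx; rewrite lef_pV2 ?posrE// ler_nat ltnS.
by rewrite (le_trans xm)// ler_nat ltnS.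
Qed.

Let bigcup_D : \bigcup_n D n = `]0, +oo[%classic.
Proof.
apply/seteqP; split => [x [n _]|x]; rewrite /D /= !in_itv/= ?andbT.
  by move=> /andP[+ _]; apply: lt_le_trans; rewrite invr_gt0.
move=> x0; exists (maxn (Num.trunc x) (Num.trunc x^-1)) => //=.
rewrite in_itv/=; apply/andP; split.
  rewrite -[leRHS]invrK lef_pV2 ?posrE ?invr_gt0//.
  rewrite (le_trans (ltW (truncnS_gt _)))// ler_nat ltnS leq_maxr//.
by rewrite (le_trans (ltW (truncnS_gt _)))// ler_nat ltnS leq_maxl.
Qed.

Let mD n : measurable (D n). Proof. exact: measurable_itv. Qed.

(** Integration by parts on [[1 / n.+1, n.+1]]: the boundary terms vanish in the limit and both
    integrals converge monotonically. *)
Lemma powR_mean1 a : 0 < a < 2 -> powR_mean 1 a = a * Gamma a.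
Proof.
move=> a02; have /andP[a0 a2] := a02.
pose f u := expR (- u) * u `^ a.
pose g u := u `^ (a - 1) * expR (- u).
have f0 u : 0 <= f u by rewrite mulr_ge0 ?expR_ge0 ?powR_ge0.
have g0 u : 0 <= g u by rewrite mulr_ge0 ?expR_ge0 ?powR_ge0.
have me : measurable_fun setT (fun u : R => expR (- u)).
  by apply: continuous_measurable_fun; ctn.
have mf : measurable_fun setT f by apply: measurable_funM => //; exact: measurable_powR.
have mg : measurable_fun setT g by apply: measurable_funM => //; exact: measurable_powR.
have cvgf : (\int[mu]_(u in D n) (f u)%:E @[n --> \oo] -->
    \int[mu]_(u in `]0%R, +oo[) (f u)%:E)%E.
  rewrite -bigcup_D; apply: ge0_nondecreasing_set_cvg_integral => //.
  - by move=> n; apply/measurable_EFinP; exact: measurable_funTS.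
  - by move=> n u _; rewrite lee_fin.
have cvgg : (\int[mu]_(u in D n) (a * g u)%:E @[n --> \oo] -->
    \int[mu]_(u in `]0%R, +oo[) (a * g u)%:E)%E.
  rewrite -bigcup_D; apply: ge0_nondecreasing_set_cvg_integral => //.
  - move=> n; apply/measurable_EFinP; apply: measurable_funTS.
    exact: measurable_funM.
  - by move=> n u _; rewrite lee_fin mulr_ge0// ltW.
pose r (n : nat) := expR (- n.+1%:R) * n.+1%:R `^ a - expR (- n.+1%:R^-1) * n.+1%:R^-1 `^ a.
have r0 : r n @[n --> \oo] --> (0 : R).
  by rewrite -(subr0 0); apply: cvgB; [exact: exp_powR_cvg0|exact: exp_powR_inv_cvg0].
have E : (\int[mu]_(u in `]0%R, +oo[) (a * g u)%:E = \int[mu]_(u in `]0%R, +oo[) (f u)%:E)%E.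
  have h : (((r n)%:E + \int[mu]_(u in D n) (f u)%:E) @[n --> \oo] -->
      0%:E + \int[mu]_(u in `]0%R, +oo[) (f u)%:E)%E.
    apply: cvgeD => //.
    by apply/fine_cvgP; split; [exact: nearW|exact: r0].
  rewrite -[RHS]add0e; apply: (cvg_unique _ cvgg) => //.
  apply: cvg_trans h; apply: near_eq_cvg; near=> n.
  have n1 : n.+1%:R^-1 < n.+1%:R :> R.
    have n0 : (0 < n)%N by near: n; exact: nbhs_infty_gt.
    by rewrite (@lt_trans _ _ 1)// ?invf_lt1 ?ltr1n.
  rewrite /r /f /g /D; have := @powR_exp_parts a _ _ _ n1.
  rewrite invr_gt0 ltr0n => /(_ isT).
  move=> <-.
  by apply: eq_integral => u _; congr EFin; ring.
rewrite /powR_mean /Gamma /Rintegral.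
rewrite -integral_itv_obnd_cbnd; last first.
  apply/measurable_EFinP; apply: measurable_funTS.
  apply: measurable_funM; last exact: measurable_powR.
  by apply: continuous_measurable_fun; exact: continuous_exp_weight.
have -> : (\int[mu]_(x in `]0%R, +oo[) (exp_weight 1 x * x `^ a)%:E =
    \int[mu]_(x in `]0%R, +oo[) (f x)%:E)%E.
  by apply: eq_integral => u _; rewrite /exp_weight /f !mul1r.
rewrite -E.
have -> : (\int[mu]_(u in `]0%R, +oo[) (a * g u)%:E =
    a%:E * \int[mu]_(u in `]0%R, +oo[) (g u)%:E)%E.
  rewrite -ge0_integralZl_EFin//.
  - by move=> u _; rewrite lee_fin.
  - by apply/measurable_EFinP; apply: measurable_funTS.
  - exact: ltW.
have : (0 <= \int[mu]_(u in `]0%R, +oo[) (g u)%:E)%E.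
  by apply: integral_ge0 => u _; rewrite lee_fin.
(* Were the integral infinite, [fine] would make both sides 0. *)
by case: (\int[mu]_(u in _) (g u)%:E)%E => //= _; rewrite gt0_muley ?lte_fin//= mulr0.
Unshelve. all: by end_near. Qed.

(** Only lags in [[1, 2]] are kept, where [u ^ a >= 1]. A positive bound on this finite mean
    excludes, through [powR_mean1], that [Gamma a] is the default value 0 of a divergent
    integral. *)
Lemma powR_mean_ge1 a : 0 < a < 2 -> expR (- 2) <= powR_mean 1 a.
Proof.
move=> a02; have /andP[a0 a2] := a02.
rewrite /powR_mean -lee_fin /Rintegral fineK; last first.
  by apply: integrable_fin_num => //; exact: integrable_exp_weight_powR.
have m : measurable_fun setT (fun u : R => (exp_weight 1 u * u `^ a)%:E).
  apply/measurable_EFinP; apply: measurable_funM; last exact: measurable_powR.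
  by apply: continuous_measurable_fun; exact: continuous_exp_weight.
apply: (@le_trans _ _ (\int[mu]_(u in `[1%R, 2%R]) (exp_weight 1 u * u `^ a)%:E)%E).
  have m1 : mu (`[1%R : R, 2%R]%classic) = 1%E.
    by rewrite lebesgue_measure_itv/= lte_fin ltr1n// -EFinB; congr (_%:E); ring.
  rewrite -[leLHS]mule1 -[X in (_ * X <= _)%E]m1 -integral_cst//; apply: ge0_le_integral => //.
  - by move=> u _; rewrite lee_fin expR_ge0.
  - exact: measurable_funTS.
  - move=> u /=; rewrite in_itv/= => /andP[u1 u2]; rewrite lee_fin /exp_weight !mul1r.
    rewrite -[leLHS]mulr1 ler_pM ?expR_ge0// ?ler_expR ?lerN2//.
    apply: (@le_trans _ _ (1 `^ a)); first by rewrite powR1.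
    by rewrite ge0_ler_powR ?nnegrE ?(ltW a0)// (le_trans _ u1).
apply: ge0_subset_integral => //.
- exact: measurable_funTS.
- by move=> u _; rewrite lee_fin mulr_ge0 ?powR_ge0 ?exp_weight_ge0.
- by move=> u /=; rewrite !in_itv/= andbT => /andP[u1 _]; rewrite (le_trans _ u1).
Qed.

Lemma Gamma_gt0 a : 0 < a < 2 -> 0 < Gamma a.
Proof.
move=> a02; have /andP[a0 a2] := a02.
have := lt_le_trans (expR_gt0 _) (powR_mean_ge1 a02).
by rewrite powR_mean1// pmulr_rgt0.
Qed.

End gamma_moment.

Section powR_mean_scaling.
Context {R : realType}.
Notation mu := (@lebesgue_measure R).
Implicit Types a lam : R.

Lemma within_continuous_powR a : 0 < a ->
  {within `[0, +oo[, continuous (fun u : R => u `^ a)}.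
Proof.
move=> a0; apply/continuous_within_itvcyP; split.
  by move=> x; rewrite in_itv/= andbT; exact: continuous_powR_gt0.
by rewrite powR0 ?gt_eqF//; exact: powR_cvg0.
Qed.

(** The substitution [u := lam * u] reduces to [lam = 1]. *)
Lemma powR_meanE lam a : 0 < lam -> 0 < a < 2 ->
  powR_mean lam a = a * Gamma a * lam `^ (- a).
Proof.
move=> lam0 a02; have /andP[a0 a2] := a02.
have cw : continuous (@exp_weight R 1) by exact: continuous_exp_weight.
have dF : derive1 (fun u : R => lam * u) = cst lam.
  apply/funext => u; rewrite derive1E.
  have h : is_derive u 1 (fun u : R => lam * u) lam by drv.
  exact: derive_val.
have F0 : lam * 0 = 0 by rewrite mulr0.
have iw : mu.-integrable `[0, +oo[ (fun u => (exp_weight lam u * u `^ a)%:E).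
  exact: integrable_exp_weight_powR.
pose G (x : R) := exp_weight 1 x * x `^ a; pose F (u : R) := lam * u.
have h : (\int[mu]_(x in `[(F 0)%R, +oo[) (G x)%:E =
    \int[mu]_(x in `[0%R, +oo[) (((G \o F) * derive1 F)%R x)%:E)%E.
  apply: increasing_ge0_integration_by_substitutiony; rewrite /F ?dF ?F0.
  - by move=> x y _ _; rewrite ltr_pM2l.
  - by move=> x _; exact: cvg_cst.
  - by apply/cvg_ex; exists lam; exact: cvg_cst.
  - by apply/cvg_ex; exists lam; exact: cvg_cst.
  - split=> [x _|]; last first.
      by apply: cvg_at_right_filter; exact: mulrl_continuous.
    exact: derivableZ.
  - by apply: gt0_cvgMry => //; exact: cvg_id.
  - move=> x; apply: cvgM; last exact: within_continuous_powR.
    exact: continuous_subspaceT.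
  - by move=> x _; rewrite mulr_ge0 ?powR_ge0 ?exp_weight_ge0.
have E : powR_mean 1 a = lam `^ a * powR_mean lam a.
  rewrite /powR_mean -[in LHS]F0 [LHS]/(fine _) h -RintegralZl//.
  congr fine; apply: eq_integral => u; rewrite inE/= in_itv/= andbT => u0.
  rewrite fctE dF /= /G /F /exp_weight !mul1r.
  by rewrite powRM ?(ltW lam0)//; congr EFin; ring.
by rewrite -powR_mean1// E powRN mulrC mulKf// ?gt_eqF// ?powR_gt0.
Qed.

End powR_mean_scaling.

(** * Nondegeneracy of the discounted noise *)

Section riemann_sums.
Context {R : realType}.
Implicit Types (f : R -> R) (x y t e : R).

(** Uniform continuity by compactness; only [x] is confined to [[0, t]], [y] may leave it. *)
Lemma compact_modulus f t e : continuous f -> 0 < e ->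
  \forall n \near \oo, forall x y, 0 <= x <= t -> `|x - y| <= n.+1%:R^-1 ->
    `|f x - f y| <= e.
Proof.
move=> cf e0.
have K : near_covering (`[0, t]%classic : set R).
  by apply/compact_near_coveringP; exact: segment_compact.
have h := K nat \oo
  (fun n x => forall y, `|x - y| <= n.+1%:R^-1 -> `|f x - f y| <= e).
have {h} : \forall n \near \oo, `[0, t]%classic `<=`
    (fun x => forall y, `|x - y| <= n.+1%:R^-1 -> `|f x - f y| <= e).
  apply: h => x _.
  have e2 : 0 < e / 2 by rewrite divr_gt0.
  have /cvgrPdist_le/(_ _ e2) := cf x.
  move=> /nbhs_ballP[r /= r0 hr].
  have r2 : 0 < r / 2 by rewrite divr_gt0.
  exists (ball x (r / 2), [set n : nat | n.+1%:R^-1 < r / 2]) => /=.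
    split; first exact: nbhsx_ballx.
    have /cvgr0_norm_lt/(_ _ r2) := @cvg_harmonic R.
    by apply: filterS => n; rewrite ger0_norm// invr_ge0.
  move=> [x' n] /= [xx' nr] y x'y.
  have hx' : `|f x - f x'| <= e / 2.
    apply: hr; apply: lt_le_trans xx' _; rewrite ler_pdivrMr//; lra.
  have hy : `|f x - f y| <= e / 2.
    apply: hr; rewrite /ball/= (le_lt_trans (ler_distD x' x y))//.
    by rewrite [ltRHS](splitr r) ltrD// (le_lt_trans x'y).
  rewrite (le_trans (ler_distD (f x) _ _))// distrC [leRHS](splitr e) lerD//.
by apply: filterS => n h x y x0 xy; apply: h => //=; rewrite in_itv.
Qed.

Definition riemann_sum f (m n : nat) : R :=
  \sum_(i < m * n.+1) f (i%:R / n.+1%:R) / n.+1%:R.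

(** On each cell the mean value theorem compares the increment of [prim f] with the value of [f] at
    the left endpoint; the errors add up to at most [m * (e / m.+1)]. *)
Lemma riemann_sum_cvg f (m : nat) : continuous f ->
  riemann_sum f m n @[n --> \oo] --> prim f m%:R.
Proof.
move=> cf; apply/cvgrPdist_le => e e0.
have em : 0 < e / m.+1%:R by rewrite divr_gt0.
have := compact_modulus m%:R cf em; apply: filterS => n h.
have step (k : nat) : (k <= m * n.+1)%N ->
    `|prim f (k%:R / n.+1%:R) - \sum_(i < k) f (i%:R / n.+1%:R) / n.+1%:R| <=
    k%:R * (e / m.+1%:R / n.+1%:R).
  elim: k => [_|k IH km]; first by rewrite mul0r prim0 big_ord0 subr0 normr0 mul0r.
  have kk : (k%:R / n.+1%:R : R) < k.+1%:R / n.+1%:R.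
    by rewrite ltr_pM2r ?invr_gt0// ltr_nat.
  have k0 : (0 : R) <= k%:R / n.+1%:R by rewrite divr_ge0.
  have dP x : x \in `](k%:R / n.+1%:R), (k.+1%:R / n.+1%:R)[ ->
      is_derive x 1 (prim f) (f x).
    rewrite in_itv/= => /andP[x0 _]; apply: is_derive_prim => //.
    exact: le_lt_trans x0.
  have [c] := MVT kk dP (continuous_subspaceT (continuous_prim cf)).
  rewrite in_itv/= => /andP[kc ck] E.
  have d : k.+1%:R / n.+1%:R - k%:R / n.+1%:R = n.+1%:R^-1 :> R.
    by rewrite -mulrBl -natrB// subSnn mul1r.
  rewrite d in E.
  rewrite big_ord_recr/= -natr1 [leRHS]mulrDl mul1r.
  rewrite natr1.
  have -> : prim f (k.+1%:R / n.+1%:R) -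
      (\sum_(i < k) f (i%:R / n.+1%:R) / n.+1%:R + f (k%:R / n.+1%:R) / n.+1%:R) =
      (prim f (k%:R / n.+1%:R) - \sum_(i < k) f (i%:R / n.+1%:R) / n.+1%:R) +
      (f c - f (k%:R / n.+1%:R)) / n.+1%:R.
    by rewrite mulrBl -E; ring.
  rewrite (le_trans (ler_normD _ _))// lerD ?IH//; first exact: ltnW.
  rewrite normrM (ger0_norm (_ : 0 <= n.+1%:R^-1))// ler_wpM2r// distrC.
  apply: h.
    rewrite k0 ler_pdivrMr// -natrM ler_nat; exact: ltnW.
  rewrite distrC ger0_norm ?subr_ge0 ?(ltW kc)// -[leRHS]d lerD2r; exact: ltW.
have := step _ (leqnn _); rewrite natrM mulfK// => s; apply: (le_trans s).
rewrite (_ : _ * _ = m%:R * e / m.+1%:R); last first.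
  by field; rewrite !nat1r !pnatr_eq0.
by rewrite ler_pdivrMr// mulrC ler_wpM2l ?(ltW e0)// ler_nat.
Qed.

End riemann_sums.

(** * Lower limits of sequences of events *)

Section eventual_sets.
Context (d : measure_display) (T : measurableType d) (R : realType).
Variable P : {measure set T -> \bar R}.
Implicit Types A : nat -> set T.

Definition eventually_in A : set T := \bigcup_N \bigcap_(n in [set n | (N <= n)%N]) A n.

Lemma measurable_eventually_in A : (forall n, measurable (A n)) ->
  measurable (eventually_in A).
Proof.
by move=> mA; apply: bigcupT_measurable => N; apply: bigcap_measurableType.
Qed.

(** Continuity from below: the tail intersections increase to the lower limit, and each lies in some
    [A N]. *)
Lemma measure_eventually_in A (c : \bar R) : (forall n, measurable (A n)) ->
  (forall n, (P (A n) <= c)%E) -> (P (eventually_in A) <= c)%E.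
Proof.
move=> mA Ac.
have mI N : measurable (\bigcap_(n in [set n | (N <= n)%N]) A n).
  by apply: bigcap_measurableType.
have nd : nondecreasing_seq (fun N => \bigcap_(n in [set n | (N <= n)%N]) A n).
  move=> N M NM; apply/subsetPset => w h n /= Mn; apply: h => /=.
  exact: leq_trans Mn.
have h := @nondecreasing_cvg_mu _ _ _ P _ mI (bigcupT_measurable _ mI) nd.
apply: (cvge_to_le h).
apply: nearW => N /=.
apply: le_trans (Ac N); apply: le_measure; rewrite ?inE//.
by move=> w; apply; rewrite /=.
Qed.

End eventual_sets.

(** * A lower bound for the variance of the Riemann sums *)

Section discounted_variance.
Context {R : realType}.
Variables (H th : R).
Hypotheses (H01 : 0 < H < 1) (th0 : 0 < th).
Implicit Types t s : R.

Let H2 : 0 <= 2 * H. Proof. by case/andP: H01 => h _; rewrite mulr_ge0// ltW. Qed.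

Lemma fbm_covC t s : fbm_cov H t s = fbm_cov H s t.
Proof. by rewrite /fbm_cov distrC (addrC (`|t| `^ _)). Qed.

Lemma fbm_cov_ge t s : 0 <= s <= t -> 2^-1 * s `^ (2 * H) <= fbm_cov H t s.
Proof.
move=> /andP[s0 st]; have t0 := le_trans s0 st.
rewrite /fbm_cov !ger0_norm ?subr_ge0// ler_wpM2l// -addrA addrCA lerDl subr_ge0.
by rewrite ge0_ler_powR ?nnegrE ?subr_ge0// gerBl.
Qed.

Lemma fbm_cov_ge0 t s : 0 <= t -> 0 <= s -> 0 <= fbm_cov H t s.
Proof.
move=> t0 s0; wlog st : t s t0 s0 / s <= t.
  move=> h; have [st|/ltW ts] := leP s t; first exact: h.
  by rewrite fbm_covC; exact: h.
by rewrite (le_trans _ (@fbm_cov_ge t s _)) ?s0// mulr_ge0 ?powR_ge0.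
Qed.

Lemma fbm_cov_ge_half t s : 1 <= t -> 1 <= s -> 2^-1 <= fbm_cov H t s.
Proof.
move=> t1 s1; wlog st : t s t1 s1 / s <= t.
  move=> h; have [st|/ltW ts] := leP s t; first exact: h.
  by rewrite fbm_covC; exact: h.
have s0 := le_trans ler01 s1.
rewrite (le_trans _ (@fbm_cov_ge t s _)) ?s0// -[leLHS]mulr1 ler_wpM2l//.
apply: (@le_trans _ _ (1 `^ (2 * H))); first by rewrite powR1.
by rewrite ge0_ler_powR ?nnegrE.
Qed.

Definition mesh (n i : nat) : R := i%:R / n.+1%:R.
Definition discount (n i : nat) : R := th * expR (- (th * mesh n i)) / n.+1%:R.

Let discount_ge0 n i : 0 <= discount n i.
Proof. by rewrite divr_ge0// mulr_ge0 ?expR_ge0// ltW. Qed.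

Let mesh_ge0 n i : 0 <= mesh n i. Proof. by rewrite divr_ge0. Qed.

(* Only the mesh points in [1, 2] are kept: there the covariance is at least
   1/2, and elsewhere it is nonnegative. *)
Lemma comb_var_discount_ge (m n : nat) :
  2^-1 * (th * expR (- (th * 2))) ^+ 2 <=
  comb_var H (fun i : 'I_(m.+2 * n.+1) => discount n i) (fun i => mesh n i).
Proof.
pose c := th * expR (- (th * 2)) / n.+1%:R.
have c0 : 0 <= c by rewrite divr_ge0// mulr_ge0 ?expR_ge0// ltW.
pose u (i : nat) : R := if (n.+1 <= i <= n.+1 * 2)%N then c else 0.
have u0 i : 0 <= u i by rewrite /u; case: ifP.
apply: (@le_trans _ _ (2^-1 * (\sum_(i < m.+2 * n.+1) u i) ^+ 2)).
  rewrite ler_wpM2l// lerXn2r ?nnegrE ?sumr_ge0//.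
    by rewrite mulr_ge0 ?expR_ge0// ltW.
  rewrite -(big_mkord xpredT u) (big_cat_nat (n := n.+1 * 2))//=; last first.
    by rewrite mulnC leq_mul2r.
  rewrite (big_cat_nat (n := n.+1) (p := n.+1 * 2))//=; last by rewrite muln2 -addnn leq_addr.
  (* Leaving out the endpoint 2, exactly [n.+1] mesh points remain, which cancels the mesh size in
     [c]. *)
  rewrite (eq_big_nat _ _ (m := n.+1) (n := n.+1 * 2) (F2 := fun=> c)); last first.
    by move=> i /andP[ni i2]; rewrite /u ni ltnW.
  rewrite sumr_const_nat muln2 -addnn addnK -[X in _ + X + _]mulr_natr divfK//.
  by rewrite -[leLHS]addr0 lerD ?sumr_ge0// -[leLHS]add0r lerD2r sumr_ge0.
rewrite expr2 big_distrlr/= mulr_sumr; apply: ler_sum => i _.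
rewrite mulr_sumr; apply: ler_sum => j _.
have uP k : u k != 0 -> [/\ 1 <= mesh n k & c <= discount n k].
  rewrite /u; case: ifP => [/andP[nk k2] _|_]; last by rewrite eqxx.
  have k1 : 1 <= mesh n k by rewrite ler_pdivlMr// mul1r ler_nat.
  split => //; rewrite ler_wpM2r// ler_wpM2l ?(ltW th0)// ler_expR lerN2.
  by rewrite ler_wpM2l ?(ltW th0)// ler_pdivrMr// -natrM ler_nat mulnC.
have [ui|/uP[i1 ci]] := eqVneq (u i) 0.
  by rewrite ui mul0r mulr0 mulr_ge0//; [exact: mulr_ge0|exact: fbm_cov_ge0].
have [uj|/uP[j1 cj]] := eqVneq (u j) 0.
  by rewrite uj !mulr0 mulr_ge0//; [exact: mulr_ge0|exact: fbm_cov_ge0].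
have uc k : u k <= c by rewrite /u; case: ifP.
rewrite mulrC ler_pM ?mulr_ge0 ?fbm_cov_ge_half//.
by rewrite ler_pM// ?(le_trans (uc _)).
Qed.

End discounted_variance.

(** * The limit of the discounted noise does not vanish *)

Section noise_nonzero.
Context {R : realType} (d : measure_display) (Omega : measurableType d)
  (P : probability Omega R).
Variables (H th x0 : R) (B : R -> {RV P >-> R}).
Hypotheses (H01 : 0 < H < 1) (th0 : 0 < th).
Hypothesis fB : fractional_brownian_motion H B.

Let v0 : R := 2^-1 * (th * expR (- (th * 2))) ^+ 2.

Let v0_gt0 : 0 < v0.
Proof. by rewrite mulr_gt0// exprn_gt0// mulr_gt0// expR_gt0. Qed.

(** The Riemann sum of the noise integral over [[0, m + 2]]; every such horizon contains [[1, 2]],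
    where the variance is bounded below. *)
Let Y (m n : nat) (w : Omega) : R :=
  \sum_(i < m.+2 * n.+1) discount th n i * B (@mesh R n i) w.

Let A (e : R) (m n : nat) : set Omega := [set w | `|Y m n w - - x0| <= e].

Let mA e m n : measurable (A e m n).
Proof.
have mY : measurable_fun setT (fun w => `|Y m n w - - x0|).
  apply: measurableT_comp => //; apply: measurable_funB => //.
  by apply: measurable_sum => i; exact: measurable_funM.
by rewrite -[A e m n]setTI; exact: (measurable_fun_le _ mY (measurable_cst e)).
Qed.

Let PA e m n : 0 <= e -> (P (A e m n) <= (2 * e / Num.sqrt v0)%:E)%E.
Proof. by apply: (fbm_small_ball fB) => //; exact: comb_var_discount_ge. Qed.

(** The inner lower limit refines the mesh at a fixed horizon, the outer one lets the horizon
    grow. *)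
Let near_zero (e : R) : set Omega := eventually_in (fun m => eventually_in (A e m)).

Let measurable_near_zero e : measurable (near_zero e).
Proof. by apply: measurable_eventually_in => m; exact: measurable_eventually_in. Qed.

Let P_near_zero e : 0 <= e -> (P (near_zero e) <= (2 * e / Num.sqrt v0)%:E)%E.
Proof.
move=> e0; apply: measure_eventually_in => m; first exact: measurable_eventually_in.
by apply: measure_eventually_in => // n; exact: PA.
Qed.

Let near_zeroP e w : 0 < e -> continuous (fun t => B t w) ->
  discounted_noise th x0 (fun t => B t w) T @[T --> +oo] --> (0 : R) -> near_zero e w.
Proof.
move=> e0 cw /cvgr0_norm_lt/(_ _ e0) [M [_ hM]].
exists (Num.trunc M) => // m /= Mm.
have Mm2 : M < m.+2%:R.
  by rewrite (lt_le_trans (truncnS_gt _))// ler_nat ltnS ltnW.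
have h := hM _ Mm2.
have cf : continuous (fun s : R => expR (- (th * s)) * B s w) by ctn.
have YE n : Y m n w = th * riemann_sum (fun s => expR (- (th * s)) * B s w) m.+2 n.
  rewrite /riemann_sum mulr_sumr; apply: eq_bigr => i _.
  by rewrite /discount /mesh; ring.
have : Y m n w - - x0 @[n --> \oo] --> discounted_noise th x0 (fun t => B t w) m.+2%:R.
  rewrite /discounted_noise [X in _ --> X]addrC -[x0 in X in _ --> X]opprK.
  apply: cvgB; last exact: cvg_cst.
  rewrite (_ : Y m ^~ w = (fun n => th * riemann_sum (fun s => expR (- (th * s)) * B s w) m.+2 n)).
    by apply: cvgMr; exact: riemann_sum_cvg.
  by apply/funext.
move=> /cvg_norm/cvgr_lt/(_ _ h)[N _ hN].
by exists N => // n /= Nn; rewrite /A /= ltW// hN.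
Qed.

Lemma ae_discounted_noise_limit_neq0 : \forall w \ae P, forall xi : R,
  discounted_noise th x0 (fun t => B t w) T @[T --> +oo] --> xi -> xi != 0.
Proof.
have [_ _ _ cB] := fB.
pose N := \bigcap_k near_zero k.+1%:R^-1.
have mN : measurable N by apply: bigcapT_measurable.
have PN : P N = 0%E.
  apply/eqP; rewrite eq_le measure_ge0 andbT.
  have h : ((2 * k.+1%:R^-1 / Num.sqrt v0)%:E @[k --> \oo] --> (0 : R)%:E)%E.
    apply/fine_cvgP; split; first exact: nearW.
    rewrite (_ : 0 = 2 * 0 / Num.sqrt v0); last by rewrite mulr0 mul0r.
    by apply: cvgMl; apply: cvgMr; exact: cvg_harmonic.
  apply: (cvge_to_ge h); apply: nearW => k.
  apply: le_trans (P_near_zero _) => //; apply: le_measure; rewrite ?inE//.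
  by move=> w; apply.
have nN : \forall w \ae P, ~ N w.
  by exists N; split => // w /= /contrapT.
apply: filterS2 cB nN => w cw nNw xi hxi; apply/eqP => xi0; apply: nNw => k _.
by rewrite xi0 in hxi; apply: near_zeroP => //; rewrite invr_gt0.
Qed.

End noise_nonzero.

(** * Consistency of the estimators *)

Section continuous_path.
Context {R : realType}.
Notation mu := (@lebesgue_measure R).

(* The equation only determines [x] at nonnegative times; prolonging the
   integral by 0 to the left gives a path that is continuous everywhere. *)
Lemma langevin_continuous_path (x0 th : R) (b x : R -> R) : continuous b ->
  (forall t, 0 <= t -> mu.-integrable `[0, t] (fun s => (x s)%:E) /\
    x t = x0 + th * (\int[mu]_(s in `[0, t]) x s) + b t) ->
  exists y : R -> R, [/\ continuous y, forall t : R, 0 <= t -> x t = y t &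
    forall t : R, 0 <= t -> y t = x0 + th * prim y t + b t].
Proof.
move=> cb hx.
have cp : continuous (prim x).
  by apply: continuous_prim_integrable => t t0; have [] := hx _ t0.
pose y t := x0 + th * prim x t + b t.
have xy (t : R) : 0 <= t -> x t = y t by move=> t0; have [] := hx _ t0.
exists y; split => //; first by rewrite /y; ctn.
move=> t t0; rewrite {1}/y; congr (_ + _ * _ + _).
apply: eq_Rintegral => s; rewrite inE/= in_itv/= => /andP[s0 _].
exact: xy.
Qed.

End continuous_path.

Section consistency.
Context {R : realType} (d : measure_display) (Omega : measurableType d)
  (P : probability Omega R).
Notation mu := (@lebesgue_measure R).
Variables (H x0 theta : R) (B X : R -> {RV P >-> R}).
Hypotheses (H01 : 0 < H < 1) (fB : fractional_brownian_motion H B).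
Hypothesis XB : fractional_OU x0 theta B X.

Let a02 : 0 < 2 * H < 2.
Proof. by case/andP: H01 => h1 h2; lra. Qed.

Lemma theta_hat1_consistent : theta < 0 ->
  strongly_consistent P (fun T w => theta_hat1 H (fun t => X t w) T) theta.
Proof.
move=> th0; have /andP[H0 H1] := H01.
pose lam := - theta; have lam0 : 0 < lam by rewrite oppr_gt0.
have lam4 : 0 < lam / 4 by rewrite divr_gt0.
have [b [cb mb hb]] := fbm_continuous_modification fB.
(* The bound [1/2] is the range of [sum_inv_powR_le]; [4 - 4 * H] is the decay exponent of the
   squared lag covariance. *)
pose g : R := Num.min 2^-1 (4 - 4 * H).
have g0 : 0 < g by rewrite lt_min invr_gt0; apply/andP; split; [|lra].
have g02 : 0 < g <= 2^-1 by rewrite g0 ge_min lexx.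
have gH : g <= 4 - 4 * H by rewrite ge_min lexx orbT.
have [_ _ _ cB] := fB.
have [K [K0 hK]] := energy_ergodic H01 lam0 fB cb mb hb g02 gH.
rewrite /strongly_consistent.
apply: filterS3 cB hK (filterI XB (fbm_growth H0 fB lam4)) => w cw hw [xw [M hM]].
have [y [cy xy yE]] := langevin_continuous_path cw xw.
have yE' (t : R) : 0 <= t -> y t = x0 - lam * prim y t + B t w.
  by move=> t0; rewrite yE// /lam mulNr opprK.
have lim := langevin_energy_limit lam0 cw cy yE' hM K0 hw.
have GH : 0 < Gamma (2 * H) by exact: Gamma_gt0.
rewrite powR_meanE// in lim.
have l0 : 0 < lam `^ (- (2 * H)) by exact: powR_gt0.
have lim2 : (H * Gamma (2 * H))^-1 * (prim (fun t => y t ^+ 2) T / T) @[T --> +oo] -->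
    lam `^ (- (2 * H)).
  (* Halving the limit turns the factor [2 * H] of [powR_meanE] into the [H] of the estimator. *)
  have -> : lam `^ (- (2 * H)) = (H * Gamma (2 * H))^-1 *
      (2 * H * Gamma (2 * H) * lam `^ (- (2 * H)) / 2).
    by field; rewrite !gt_eqF.
  exact: cvgMr.
have thE : theta = - (lam `^ (- (2 * H))) `^ (- (2 * H)^-1).
  rewrite -powRrM mulrNN mulfV ?powRr1 ?opprK ?(ltW lam0)//.
  by rewrite gt_eqF// mulr_gt0.
rewrite [X in _ --> X]thE; apply: cvgN.
have lim3 : ((H * Gamma (2 * H))^-1 * (prim (fun t => y t ^+ 2) T / T))
    `^ (- (2 * H)^-1) @[T --> +oo] --> (lam `^ (- (2 * H))) `^ (- (2 * H)^-1).
  exact: (@continuous_cvg _ _ _ _ _ _ (fun u : R => u `^ (- (2 * H)^-1)) _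
    (continuous_powR_gt0 l0) lim2).
apply: cvg_trans lim3; apply: near_eq_cvg; near=> T.
have -> : \int[mu]_(t in `[0, T]) X t w ^+ 2 = prim (fun t => y t ^+ 2) T.
  by apply: eq_Rintegral => s; rewrite inE/= in_itv/= => /andP[s0 _]; rewrite xy.
by rewrite (invfM _ T) -!mulrA (mulrC T^-1).
Unshelve. all: by end_near. Qed.

Lemma theta_hat2_consistent : 0 < theta ->
  strongly_consistent P (fun T w => theta_hat2 (fun t => X t w) T) theta.
Proof.
move=> th0; have /andP[H0 H1] := H01.
have th2 : 0 < theta / 2 by rewrite divr_gt0.
have [_ _ _ cB] := fB.
rewrite /strongly_consistent.
apply: filterS3 cB (ae_discounted_noise_limit_neq0 x0 H01 th0 fB)
  (filterI XB (fbm_growth H0 fB th2)) => w cw hw [xw [M hM]].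
have [y [cy xy yE]] := langevin_continuous_path cw xw.
have [xi hxi] := discounted_noise_cvg x0 th0 cw hM.
apply: cvg_trans (explosive_ratio_limit th0 cw cy yE hM hxi (hw _ hxi)).
apply: near_eq_cvg; near=> T.
rewrite /theta_hat2 xy//; congr (_ / (_ * _)).
apply: eq_Rintegral => s; rewrite inE/= in_itv/= => /andP[s0 _].
by rewrite xy.
Unshelve. all: by end_near. Qed.

End consistency.

Theorem theorem3p1 (R : realType) (d : measure_display)
    (Omega : measurableType d) (P : probability Omega R)
    (H x0 theta : R) (B X : R -> {RV P >-> R}) :
  0 < H < 1 ->
  fractional_brownian_motion H B ->
  fractional_OU x0 theta B X ->
  (theta < 0 ->
    strongly_consistent P (fun T w => theta_hat1 H (fun t => X t w) T) theta) /\
  (0 < theta ->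
    strongly_consistent P (fun T w => theta_hat2 (fun t => X t w) T) theta).
Proof.
move=> H01 fB XB; split.
  exact: (theta_hat1_consistent H01 fB XB).
exact: (theta_hat2_consistent H01 fB XB).
Qed.
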